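(* Let $X$ and $W$ be independent nonnegative random variables, such that the law of $X$ belongs to the class $\mathrm{ME}$ of mixtures of exponential distributions and the law of $W$ is a generalized gamma convolution (GGC). Then for every $c\ge 0$ there exist independent nonnegative random variables $\widetilde W$ and $M$ such that $$\widetilde W\stackrel{d}{=}W,\qquad M\in\mathrm{ME},\qquad (X+c)W\stackrel{d}{=}c\widetilde W+M.$$ In particular, $(X+c)W$ is infinitely divisible.
   Context: A function $k$ on $(0,\infty)$ is completely monotone if it is smooth and $(-1)^m k^{(m)}(x)\ge 0$ for every integer $m\ge 0$ and $x>0$. A probability distribution on $[0,\infty)$ is infinitely divisible if for every integer $n\ge 2$ it is the convolution of $n$ identical probability distributions; equivalently, its Laplace transform has the form $$\mathbb{E}[e^{-\lambda X}]=\exp\left\{-a\lambda-\int_0^\infty(1-e^{-\lambda x})\,\nu(dx)\right\},\qquad \lambda\ge 0,$$ with $a\ge 0$ and a measure $\nu$ on $(0,\infty)$ satisfying $\int_0^\infty(1\wedge x)\,\nu(dx)<\infty$. A distribution on $[0,\infty)$ is a generalized gamma convolution (GGC) if its Laplace transform has the form $$\mathbb{E}[e^{-\lambda X}]=\exp\left\{-a\lambda-\int_0^\infty(1-e^{-\lambda x})\,k(x)\,\frac{dx}{x}\right\},\qquad \lambda\ge 0,$$ with $a\ge 0$, where $k$ is nonnegative and completely monotone on $(0,\infty)$ and $\int_0^\infty(1\wedge x)\,k(x)\,\frac{dx}{x}<\infty$; equivalently, it belongs to the weak closure of finite convolutions of gamma distributions. A probability distribution belongs to the class $\mathrm{ME}$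 (mixtures of exponential distributions, with an atom at zero allowed) if it is the law of $\Gamma_1Y$, where $\Gamma_1\sim\mathrm{Exp}(1)$ is independent of a nonnegative random variable $Y$. Equivalently, it is of the form $\beta\delta_0+f(x)\,dx$ with $0\le\beta\le 1$, $f$ completely monotone on $(0,\infty)$ and $\beta+\int_0^\infty f(x)\,dx=1$. One writes $M\in\mathrm{ME}$ when the law of $M$ is in $\mathrm{ME}$. *)

(* Defs.v *)
From HB Require Import structures.
From mathcomp Require Import all_boot all_order all_algebra.
From mathcomp Require Import all_classical all_reals all_analysis measurable_realfun.
Set Implicit Arguments.
Unset Strict Implicit.
Unset Printing Implicit Defensive.
Import Order.TTheory GRing.Theory Num.Theory.
Import numFieldNormedType.Exports.
Local Open Scope classical_set_scope.
Local Open Scope ring_scope.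

Section laws.
Context {R : realType}.
Implicit Types (mu nu : probability R R).

(* Laws are compared on measurable sets only: [distribution P X] is a total
   set function whose values on non-measurable sets carry no meaning. *)
Definition eq_law (m1 m2 : set R -> \bar R) : Prop :=
  forall A : set R, measurable A -> m1 A = m2 A.

Definition on_nonneg mu : Prop := mu [set x : R | 0 <= x] = 1%E.

Definition nonneg_rv d (T : measurableType d) (P : probability T R)
    (X : {RV P >-> R}) : Prop := forall t, 0 <= X t.

Definition independent_rv d (T : measurableType d) (P : probability T R)
    (X Y : {RV P >-> R}) : Prop :=
  forall A B : set R, measurable A -> measurable B ->
    P (X @^-1` A `&` Y @^-1` B) = (P (X @^-1` A) * P (Y @^-1` B))%E.

Definition laplace mu (lambda : R) : \bar R :=
  (\int[mu]_x (expR (- (lambda * x)))%:E)%E.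

(* [k] is a total function but, (0, oo) being open, its derivatives at [x > 0]
   only depend on its restriction to (0, oo); smoothness is derivability of the
   derivatives of all orders. *)
Definition completely_monotone (k : R -> R) : Prop :=
  forall (m : nat) (x : R), 0 < x ->
    derivable (derive1n m k) x 1 /\ 0 <= (-1) ^+ m * derive1n m k x.

Definition GGC mu : Prop :=
  on_nonneg mu /\
  exists (a : R) (k : R -> R),
    [/\ 0 <= a,
        (forall x : R, 0 < x -> 0 <= k x) /\ completely_monotone k,
        (\int[lebesgue_measure]_(x in `]0%R, +oo[)
           (Num.min 1 x * k x / x)%:E < +oo)%E &
        forall lambda : R, 0 <= lambda ->
          laplace mu lambda =
          expeR (- (a * lambda)%:E -
                 \int[lebesgue_measure]_(x in `]0%R, +oo[)
                   ((1 - expR (- (lambda * x))) * k x / x)%:E)%E].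

Definition ME mu : Prop :=
  exists (d : measure_display) (T : measurableType d) (P : probability T R)
         (G Y : {RV P >-> R}),
    [/\ eq_law (distribution P G) (exponential_prob 1),
        nonneg_rv Y,
        independent_rv G Y &
        eq_law mu (distribution P (G * Y))].

End laws.

Section convolution.
Context {R : realType}.
Implicit Types (mu nu : probability R R).

Definition add_pair (p : R * R) : R := p.1 + p.2.

Lemma measurable_add_pair : measurable_fun setT add_pair.
Proof. exact: measurable_funD. Qed.

HB.instance Definition _ :=
  isMeasurableFun.Build _ _ _ _ add_pair measurable_add_pair.

Definition convolution mu nu : probability R R :=
  distribution (mu \x nu)%E add_pair.

Fixpoint convolution_power nu (n : nat) : probability R R :=
  if n is m.+1 then convolution nu (convolution_power nu m)
  else dirac (0 : R).

Definition infinitely_divisible mu : Prop :=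
  on_nonneg mu /\
  forall n : nat, (2 <= n)%N ->
    exists nu, eq_law mu (convolution_power nu n).

End convolution.

(* Main.v *)
(* Let phi be the Laplace transform of W and L that of (X + c) W, so that by
   independence L(l) = E[phi (l (X + c))].  It suffices that
   S(l) = L(l) / phi (l c) be a mixture of the functions l |-> 1 / (1 + l z),
   the Laplace transforms of exponential laws: then L(l) = phi (l c) S(l) is the
   transform of c W' + M with M in ME.

   As phi is a limit of products of factors (1 + b l)^-p, the quotient
   phi (l (s + c)) / phi (l c) is, as a function of (l, s), a limit of products of
   (1 + s C(l))^-p with C(l) = b l / (1 + b c l), hence a limit of mixtures of
   exp (- s C(l)) with C a finite sum of functions a l / (1 + b l).  Averaging
   over s = X, a mixture of exponentials, gives mixtures of (1 + z C(l))^-1,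
   and each of these is a Stieltjes function w^T (1 + l A)^-1 w with A
   symmetric and nonnegative, by the spectral theorem.

   For infinite divisibility, phi (l c)^(1/n) is of the same kind as phi, and
   S^(1/n) is a limit of mixtures of exp (- l x): with h = 1 / S - 1, a power
   (1 + h)^-a is a limit of such mixtures as soon as every (1 + u h)^-1,
   0 <= u <= 1, is; the latter is again a Stieltjes function, of the form
   w^T (1 + l K Z K)^-1 w for a rank one perturbation K of the identity. *)

Require Import Defs.
From HB Require Import structures.
From mathcomp Require Import all_boot all_order all_algebra.
From mathcomp Require Import sesquilinear spectral complex.
From mathcomp Require Import ring lra.
From mathcomp Require Import all_classical all_reals all_analysis measurable_realfun.
Import Order.TTheory GRing.Theory Num.Theory.
Import numFieldNormedType.Exports.
Local Open Scope classical_set_scope.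
Local Open Scope ring_scope.

Set Implicit Arguments.
Unset Strict Implicit.
Unset Printing Implicit Defensive.

(** * Spectral form of resolvents of Gram matrices *)

Section spectral.
Local Open Scope sesquilinear_scope.

(** The mixtures of the functions [1 / (1 + l z)] are not stable under products, [(1 + l)^-2] being
    none of them, so the gamma factors of W cannot be treated one at a time. Products are therefore
    taken before averaging over X, among the [exp (- s C(l))], where multiplication only adds the
    C's; the law of X enters once, afterwards, through [E exp (- X C) = E 1 / (1 + C Y)]. Membership
    in the Stieltjes class usually rests on complex analysis; with finitely many atoms it is the
    diagonalisation of one symmetric matrix, and limits do the rest. As limits are taken at [l > 0]
    only, mass may escape to infinity; the limit 1 at [l = 0] shows at the end that none did. *)

Lemma resolvent_spectral_closed (C : numClosedFieldType) (m n : nat)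
    (G : 'M[C]_(m, n)) (w : 'cV[C]_n) :
  exists r y : 'I_n -> C,
    [/\ forall j, 0 <= r j, forall j, 0 <= y j,
        \sum_j r j = (w^t* *m w) 0 0 &
        forall (l : C) (x : 'cV[C]_n), 0 <= l ->
          x + l *: (G^t* *m G *m x) = w ->
          (w^t* *m x) 0 0 = \sum_j r j / (1 + l * y j)].
Proof.
pose B := G^t* *m G.
have tcM k1 k2 k3 (A : 'M[C]_(k1, k2)) (A' : 'M[C]_(k2, k3)) :
    (A *m A')^t* = A'^t* *m A^t* by rewrite trmx_mul map_mxM.
have tcK k1 k2 (A : 'M[C]_(k1, k2)) : A^t*^t* = A.
  by apply/matrixP => i j; rewrite !mxE conjCK.
have Bt : B^t* = B by rewrite tcM tcK.
have /orthomx_spectralP Bsp : B \is normalmx by apply/normalmxP; rewrite Bt.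
set P := spectralmx B in Bsp; set sp := spectral_diag B in Bsp.
have Pu : P \is unitarymx := spectral_unitarymx B.
rewrite invmx_unitary // in Bsp.
have PPt : P *m P^t* = 1%:M by apply/unitarymxP.
have PtP : P^t* *m P = 1%:M by apply: mulmx1C.
(* The diagonal form of [B] is the Gram matrix of the columns of [H], so the eigenvalues are sums of
   squared moduli. *)
pose H := G *m P^t*.
have spE : diag_mx sp = H^t* *m H.
  rewrite tcM tcK mulmxA -(mulmxA P) -/B Bsp !mulmxA PPt mul1mx -mulmxA PPt.
  by rewrite mulmx1.
have sp0 j : 0 <= sp 0 j.
  have -> : sp 0 j = diag_mx sp j j by rewrite [RHS]mxE eqxx mulr1n.
  rewrite spE mxE sumr_ge0 // => i _; rewrite !mxE mulrC; exact: mul_conjC_ge0.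
(* Weights: squared moduli of the coordinates of [w] in the eigenbasis, with sum the squared norm of
   [w] as [P] is unitary. Nodes: the eigenvalues. *)
exists (fun j => (P *m w) j 0 * ((P *m w) j 0)^*), (fun j => sp 0 j); split.
- by move=> j; exact: mul_conjC_ge0.
- exact: sp0.
- transitivity (((P *m w)^t* *m (P *m w)) 0 0); last first.
    by rewrite tcM mulmxA -(mulmxA _ _ P) PtP mulmx1.
  by rewrite mxE; apply: eq_bigr => j _; rewrite !mxE mulrC.
move=> l x l0 xw.
transitivity (((P *m w)^t* *m (P *m x)) 0 0).
  by rewrite tcM mulmxA -(mulmxA _ _ P) PtP mulmx1.
(* In the eigenbasis the system decouples into scalar equations with coefficients
   [1 + l * sp 0 j]. *)
have Pxw : P *m w = P *m x + l *: (diag_mx sp *m (P *m x)).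
  rewrite -xw mulmxDr -scalemxAr; congr (_ + _ *: _).
  by rewrite -/B [X in _ *m (X *m x)]Bsp !mulmxA PPt mul1mx.
rewrite mxE; apply: eq_bigr => j _; rewrite !mxE.
have den : 1 + l * sp 0 j != 0.
  by rewrite gt_eqF // ltr_wpDr // mulr_ge0.
have -> : (\sum_k P j k * w k 0) = (P *m w) j 0 by rewrite mxE.
have -> : (\sum_k P j k * x k 0) = (P *m x) j 0 by rewrite mxE.
have -> : (P *m w) j 0 = (1 + l * sp 0 j) * (P *m x) j 0.
  rewrite mulrDl mul1r -mulrA; move: Pxw; rewrite mul_diag_mx => ->.
  by rewrite mxE; congr (_ + _); rewrite 2!mxE.
set a := (P *m x) j 0; set d := 1 + _ in den *; rewrite mulrAC [d * a]mulrC mulfK //; exact: mulrC.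
Qed.

(** Over [R[i]] the weights and nodes are nonnegative, hence real; injectivity of the embedding
    brings the identity for a real solution [x] back to [R]. *)
Lemma resolvent_spectral (R : rcfType) (m n : nat)
    (G : 'M[R]_(m, n)) (w : 'cV[R]_n) :
  exists r y : 'I_n -> R,
    [/\ forall j, 0 <= r j, forall j, 0 <= y j,
        \sum_j r j = (w^T *m w) 0 0 &
        forall (l : R) (x : 'cV[R]_n), 0 <= l ->
          x + l *: (G^T *m G *m x) = w ->
          (w^T *m x) 0 0 = \sum_j r j / (1 + l * y j)].
Proof.
pose f := real_complex R : {rmorphism R -> R[i]%C}.
have fre (c : R[i]%C) : 0 <= c -> c = f (complex.Re c).
  by move=> /ger0_real c0; rewrite /f /= RRe_real.
have ftc k1 k2 (A : 'M[R]_(k1, k2)) : (map_mx f A)^t* = map_mx f A^T.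
  by apply/matrixP => i j; rewrite !mxE; exact: conjc_real.
have [r [y [r0 y0 rs xE]]] := resolvent_spectral_closed (map_mx f G) (map_mx f w).
have finj : injective f by apply: fmorph_inj.
have rE j := fre _ (r0 j); have yE j := fre _ (y0 j).
exists (fun j => complex.Re (r j)), (fun j => complex.Re (y j)); split.
- by move=> j; have := r0 j; rewrite {1}rE /f /= ler0c.
- by move=> j; have := y0 j; rewrite {1}yE /f /= ler0c.
- apply: finj; rewrite rmorph_sum; under eq_bigr do rewrite -rE.
  by rewrite rs ftc -map_mxM [LHS]mxE.
move=> l x l0 xw; apply: finj.
have /xE : 0 <= f l by rewrite /f /= ler0c.
move=> /(_ (map_mx f x)).
rewrite !ftc -!map_mxM -map_mxZ -map_mxD xw => /(_ erefl).
rewrite [LHS]mxE => ->; rewrite rmorph_sum; apply: eq_bigr => j _.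
by rewrite fmorph_div rmorphD rmorph1 rmorphM -rE -yE.
Qed.

End spectral.

(** * Convex hulls closed under pointwise limits *)

Section hull.
Context {R : realType} (I : Type) (D : set I).
Implicit Types (G : (I -> R) -> Prop) (f g h : I -> R).

(* Limits are only required on [D]: outside [D] the functions are junk. *)
Inductive hull G : (I -> R) -> Prop :=
| hull_base f : G f -> hull G f
| hull_conv p f g : 0 <= p <= 1 -> hull G f -> hull G g ->
    hull G (fun i => p * f i + (1 - p) * g i)
| hull_lim (F : nat -> I -> R) f : (forall n, hull G (F n)) ->
    (forall i, D i -> F n i @[n --> \oo] --> f i) -> hull G f.

Lemma hull_ext G f g : hull G f -> (forall i, D i -> f i = g i) -> hull G g.
Proof.
move=> Gf fg; apply: (@hull_lim _ (fun=> f)) => // i /fg <-; exact: cvg_cst.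
Qed.

Lemma hull_sub G G' f : (forall g, G g -> hull G' g) -> hull G f -> hull G' f.
Proof.
move=> GG'; elim=> [{}f /GG'//|p {}f g p01 _ f' _ g'|F {}f _ F' Ff].
- exact: hull_conv.
- exact: hull_lim Ff.
Qed.

Lemma hull_wsum G (J : Type) (r : seq J) (w : J -> R) (f : J -> I -> R) :
  (forall j, 0 <= w j) -> (forall j, hull G (f j)) -> 0 < \sum_(j <- r) w j ->
  hull G (fun i => (\sum_(j <- r) w j * f j i) / \sum_(j <- r) w j).
Proof.
move=> w0 Gf; elim: r => [|j r IHr]; first by rewrite big_nil ltxx.
rewrite big_cons => W0.
(* Splitting off the head divides by the weight of the tail; a tail of weight 0 contributes
   nothing. *)
have [r0|rn0] := eqVneq (\sum_(k <- r) w k) 0.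
  apply: (hull_ext (Gf j)) => i _.
  have {}rz : \sum_(k <- r) w k * f k i = 0.
    elim: r r0 {IHr W0} => [|k r IHr]; first by rewrite !big_nil.
    rewrite !big_cons => /eqP; rewrite paddr_eq0 ?sumr_ge0 // => /andP[/eqP -> /eqP].
    by move=> /IHr ->; rewrite mul0r addr0.
  rewrite big_cons r0 rz !addr0 mulrC mulKf //.
  by move: W0; rewrite r0 addr0 => /lt0r_neq0.
have r0 : 0 < \sum_(k <- r) w k by rewrite lt_neqAle eq_sym rn0 sumr_ge0.
apply: (hull_ext (hull_conv (p := w j / (w j + \sum_(k <- r) w k)) _ (Gf j) (IHr r0))).
  by rewrite divr_ge0 ?(ltW W0) //= ler_pdivrMr // mul1r lerDl ltW.
move=> i _; rewrite big_cons; move: (\sum_(k <- r) w k * _) => S.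
by field; rewrite rn0 lt0r_neq0.
Qed.

Lemma hull_sum G (J : Type) (r : seq J) (w : J -> R) (f : J -> I -> R) :
  (forall j, 0 <= w j) -> (forall j, hull G (f j)) -> \sum_(j <- r) w j = 1 ->
  hull G (fun i => \sum_(j <- r) w j * f j i).
Proof.
move=> w0 Gf w1; have := @hull_wsum G J r w f w0 Gf; rewrite w1 => /(_ ltr01) /hull_ext.
by apply=> i _; rewrite divr1.
Qed.

Section multiplicative.
Variable G : (I -> R) -> Prop.
Hypothesis G1 : hull G (fun=> 1).
Hypothesis GM : forall f g, G f -> G g -> hull G (fun i => f i * g i).

(** Multiplication by a fixed function commutes with convex combinations and limits, so a double
    induction reduces to two generators, whose product need only lie in the hull. *)
Lemma hull_mul f g : hull G f -> hull G g -> hull G (fun i => f i * g i).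
Proof.
move=> Gf; elim: Gf g => [{}f Gf|p {}f f' p01 Gf IHf Gf' IHf'|F {}f GF IH Ff] g.
- elim=> [{}g Gg|p {}g g' p01 Gg IHg Gg' IHg'|F {}g GF IH Fg].
  + exact: GM.
  + apply: (hull_ext (hull_conv p01 IHg IHg')) => i _ /=; ring.
  + by apply: (hull_lim IH) => i Di; apply: cvgM; [exact: cvg_cst|exact: Fg].
- move=> Gg; apply: (hull_ext (hull_conv p01 (IHf _ Gg) (IHf' _ Gg))) => i _ /=; ring.
- move=> Gg; apply: (hull_lim (fun n => IH n _ Gg)) => i Di.
  by apply: cvgM; [exact: Ff|exact: cvg_cst].
Qed.

Lemma hull_prod (J : Type) (r : seq J) (f : J -> I -> R) :
  (forall j, hull G (f j)) -> hull G (fun i => \prod_(j <- r) f j i).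
Proof.
move=> Gf; elim: r => [|j r IHr].
  by apply: (hull_ext G1) => i _; rewrite big_nil.
by apply: (hull_ext (hull_mul (Gf j) IHr)) => i _; rewrite big_cons.
Qed.

Lemma hull_exp n f : hull G f -> hull G (fun i => f i ^+ n).
Proof.
move=> Gf; elim: n => [|n IHn]; first by apply: (hull_ext G1) => i _; rewrite expr0.
by apply: (hull_ext (hull_mul Gf IHn)) => i _; rewrite exprS.
Qed.

(** A Poisson mixture of powers of [f]: the terms are [exp (- w) w^k / k!] times [f^k]. Partial sums
    are divided by their total weight [W n] to become convex combinations. *)
Lemma hull_expR (w : R) f : 0 <= w -> hull G f ->
  hull G (fun i => expR (- (w * (1 - f i)))).
Proof.
move=> w0 Gf.
pose W n := series (exp_coeff w) n.+1.
have W0 n : 0 < W n.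
  rewrite /W /series /= big_nat_recl //= ltr_pwDl //.
    by rewrite /exp_coeff /= expr0 fact0 divr1.
  by rewrite sumr_ge0 // => j _; exact: exp_coeff_ge0.
apply: (@hull_lim _ (fun n i => series (exp_coeff (w * f i)) n.+1 / W n)).
  move=> n.
  have := @hull_wsum G nat (index_iota 0 n.+1) (exp_coeff w) (fun k i => f i ^+ k).
  move=> /(_ (fun k => exp_coeff_ge0 k w0) (fun k => hull_exp k Gf) (W0 n)) /hull_ext.
  apply=> i _; congr (_ / _); rewrite /series /=; apply: eq_bigr => k _.
  by rewrite /exp_coeff /= exprMn mulrAC.
move=> i _; have -> : - (w * (1 - f i)) = w * f i - w by ring.
rewrite expRB; apply: cvgM.
  rewrite (cvg_shiftS (series (exp_coeff (w * f i)))); exact: is_cvg_series_exp_coeff.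
apply: cvgV; first by rewrite expR_eq0.
rewrite (cvg_shiftS (series (exp_coeff w))); exact: is_cvg_series_exp_coeff.
Qed.

End multiplicative.

(* With [e N = exp (- h / (N + 1))], [(1 + h)^-1] is the limit of
   [(1 - q) sum_k q^k (e N)^k] for [q = (N + 1) / (N + 2)]. *)
Lemma hull_geom G h : (forall i, D i -> 0 <= h i) ->
  (forall r, 0 <= r -> hull G (fun i => expR (- (r * h i)))) ->
  hull G (fun i => (1 + h i)^-1).
Proof.
move=> h0 Gh.
pose q (N : nat) : R := N.+1%:R / N.+2%:R.
pose e N i := expR (- (N.+1%:R^-1 * h i)).
have q01 N : 0 < q N < 1.
  by rewrite /q divr_gt0 //= ltr_pdivrMr // mul1r ltr_nat.
have e01 N i : D i -> 0 < e N i <= 1.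
  by move=> Di; rewrite expR_gt0 /= expR_le1 oppr_le0 mulr_ge0 // h0.
apply: (@hull_lim _ (fun N i => (1 - q N) / (1 - q N * e N i))).
  move=> N; have /andP[q0 q1] := q01 N.
  apply: (@hull_lim _ (fun n i => (\sum_(0 <= k < n.+1) q N ^+ k * e N i ^+ k) /
     \sum_(0 <= k < n.+1) q N ^+ k)).
    move=> n; apply: (@hull_wsum G nat _ (fun k => q N ^+ k) (fun k i => e N i ^+ k)).
    - by move=> k; rewrite exprn_ge0 // ltW.
    - move=> k; apply: (hull_ext (Gh (k%:R / N.+1%:R) _)); first by rewrite divr_ge0.
      by move=> i _; rewrite /e -expRM_natl mulrN mulrA.
    - rewrite big_nat_recl //= expr0 ltr_pwDl // sumr_ge0 // => k _.
      by rewrite exprn_ge0 // ltW.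
  move=> i Di; have /andP[e0 e1] := e01 N i Di.
  have qe1 : q N * e N i < 1.
    by rewrite (le_lt_trans _ q1) // ler_piMr // ltW.
  have qe0 : 0 <= q N * e N i by rewrite mulr_ge0 ?ltW.
  have cx (x : R) : 0 <= x < 1 ->
      (\sum_(0 <= k < n.+1) x ^+ k) @[n --> \oo] --> (1 - x)^-1.
    move=> /andP[x0 x1].
    have := @cvg_geometric_series R 1 x; rewrite ger0_norm // mul1r => /(_ x1).
    rewrite -cvg_shiftS; apply: cvg_trans; apply: near_eq_cvg; near=> n => /=.
    by rewrite /series /=; apply: eq_bigr => k _; rewrite mul1r.
  rewrite mulrC; apply: cvgM.
    under eq_fun do (under eq_bigr do rewrite -exprMn).
    by apply: cx; rewrite qe0.
  rewrite -[X in _ --> X]invrK; apply: cvgV.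
    by rewrite invr_eq0 subr_eq0 gt_eqF.
  by apply: cx; rewrite ltW.
move=> i Di; have hi := h0 i Di.
(* The value of [q] is chosen for this form, as [(N + 1) (1 - exp (- h / (N + 1)))] tends to [h]. *)
have E N : (1 - q N) / (1 - q N * e N i) = (1 + N.+1%:R * (1 - e N i))^-1.
  have /andP[e0 e1] := e01 N i Di.
  have n1 : 1 + N.+1%:R * (1 - e N i) != 0.
    by rewrite gt_eqF // ltr_wpDr // mulr_ge0 // subr_ge0.
  have n2 : 1 - q N * e N i = (1 + N.+1%:R * (1 - e N i)) / N.+2%:R.
    by rewrite /q; field.
  have -> : 1 - q N = N.+2%:R^-1.
    rewrite /q -[X in X - _](@divff _ N.+2%:R) // -mulrBl.
    by rewrite -[X in X - _]natr1 addrAC subrr add0r mul1r.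
  by rewrite n2 invf_div mulKf.
under eq_fun do rewrite E.
apply: cvgV; first by rewrite gt_eqF // ltr_wpDr.
apply: cvgD; first exact: cvg_cst.
apply: (@squeeze_cvgr _ _ _ _ (fun N : nat => h i / (1 + N.+1%:R^-1 * h i)) (fun=> h i)).
- near=> N; rewrite /e.
  set x := N.+1%:R^-1 * h i; have x0 : 0 <= x by rewrite mulr_ge0.
  have hx : h i = N.+1%:R * x by rewrite /x mulVKf.
  rewrite hx; apply/andP; split; last first.
    by rewrite ler_wpM2l // lerBlDr -lerBlDl expR_ge1Dx.
  rewrite -mulrA ler_wpM2l // lerBrDl -lerBrDr expRN.
  have -> : 1 - x / (1 + x) = (1 + x)^-1 by field; rewrite gt_eqF // ltr_wpDr.
  by rewrite lef_pV2 ?expR_ge1Dx // posrE ?expR_gt0 // ltr_wpDr.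
- rewrite -[X in _ --> X]divr1; apply: cvgM; first exact: cvg_cst.
  apply: cvgV; first by [].
  rewrite -[X in _ --> X]addr0; apply: cvgD; first exact: cvg_cst.
  rewrite -[X in _ --> X](mul0r (h i)); apply: cvgM; last exact: cvg_cst.
  exact: cvg_harmonic.
- exact: cvg_cst.
Unshelve. all: by end_near. Qed.

(* [ln (1 + h)] is the integral of [h / (1 + u h)] over [0 <= u <= 1]; its Riemann
   sums are the [\sum_k v N k], which turn [(1 + h)^-a] into a limit of Poisson
   compounds of the [(1 + u h)^-1]. *)
Lemma hull_powR G h a : hull G (fun=> 1) ->
  (forall f g, G f -> G g -> hull G (fun i => f i * g i)) ->
  (forall i, D i -> 0 <= h i) -> 0 <= a ->
  (forall u, 0 <= u <= 1 -> hull G (fun i => (1 + u * h i)^-1)) ->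
  hull G (fun i => (1 + h i)^-1 `^ a).
Proof.
move=> G1 GM h0 a0 Gh.
pose v N k i := k.+1%:R^-1 * (1 - (1 + k.+1%:R / N.+1%:R * h i)^-1).
apply: (@hull_lim _ (fun N i => expR (- (a * \sum_(0 <= k < N.+1) v N k i)))).
  move=> N.
  have : hull G (fun i => \prod_(k <- index_iota 0 N.+1 | (k <= N)%N)
      expR (- (a / k.+1%:R * (1 - (1 + k.+1%:R / N.+1%:R * h i)^-1)))).
    (* [hull_prod] asks for membership at every index; [minn k N] keeps the parameter [u] at most 1
       for indices out of range. *)
    apply: (@hull_ext _ (fun i => \prod_(k <- [seq k <- index_iota 0 N.+1 | (k <= N)%N])
      expR (- (a / k.+1%:R * (1 - (1 + (minn k N).+1%:R / N.+1%:R * h i)^-1))))).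
      apply: hull_prod => // k; apply: hull_expR => //; first by rewrite divr_ge0.
      apply: Gh; rewrite divr_ge0 //= ler_pdivrMr // mul1r ler_nat ltnS.
      exact: geq_minr.
    move=> i _; rewrite big_filter; apply: eq_bigr => k kN.
    by rewrite (minn_idPl kN).
  move=> /hull_ext; apply=> i _.
  rewrite mulr_sumr -sumrN expR_sum [LHS]big_mkcond [RHS]big_seq_cond [LHS]big_seq_cond.
  apply: eq_bigr => k; rewrite mem_index_iota /= andbT ltnS => ->.
  by rewrite /v mulrA.
move=> i Di; have hi := h0 i Di.
have h1 : 0 < 1 + h i by rewrite ltr_wpDr.
rewrite /powR invr_eq0 gt_eqF // lnV ?posrE // mulrN.
apply: continuous_cvg; first exact: continuous_expR.
apply: cvgN; apply: cvgM; first exact: cvg_cst.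
apply: (@squeeze_cvgr _ _ _ _ (fun N : nat => ln (1 + h i) - N.+1%:R^-1 * h i)
  (fun=> ln (1 + h i))).
- near=> N.
  pose x := N.+1%:R^-1 * h i; pose t k := 1 + k%:R * x.
  have x0 : 0 <= x by rewrite mulr_ge0.
  have t0 k : 0 < t k by rewrite ltr_wpDr // mulr_ge0.
  have tS k : t k.+1 = t k + x by rewrite /t -natr1; ring.
  have vE k : v N k i = x / t k.+1.
    rewrite /v -[_ / _ * h i]mulrA -/x -/(t k.+1).
    have tn := lt0r_neq0 (t0 k.+1); set T := t k.+1 in tn *.
    have -> : x = k.+1%:R^-1 * (T - 1) by rewrite /T /t addrAC subrr add0r mulKf.
    by rewrite -mulrA mulrBl mul1r divff.
  (* Each increment of [ln] between [t k] and [t k.+1] lies between [x / t k.+1], which is [v N k],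
     and [x / t k]. Upper and lower sums differ by a telescoping sum, [x (1 - 1 / t k)]. *)
  have key k : \sum_(0 <= j < k) v N j i <= ln (t k) <=
      \sum_(0 <= j < k) v N j i + x * (1 - (t k)^-1).
    elim: k => [|k /andP[IH1 IH2]].
      by rewrite big_nil /t mul0r addr0 ln1 invr1 subrr mulr0 addr0 lexx.
    have lnS : ln (t k.+1) = ln (t k) + ln (t k.+1 / t k).
      by rewrite -lnM ?posrE ?divr_gt0 // mulrCA divff ?mulr1 // lt0r_neq0.
    have ln_le (y : R) : 0 < y -> ln y <= y - 1.
      by move=> y0; have := expR_ge1Dx (ln y); rewrite lnK ?posrE // lerBrDl.
    rewrite big_nat_recr //= lnS vE; apply/andP; split.
      apply: lerD => //.
      have := ln_le (t k / t k.+1); rewrite divr_gt0 // => /(_ isT).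
      rewrite -[t k / _]invf_div lnV ?posrE ?divr_gt0 // invf_div lerNl opprB.
      apply: le_trans; rewrite le_eqVlt tS; apply/orP; left; apply/eqP.
      by field; rewrite -tS lt0r_neq0.
    have := ln_le (t k.+1 / t k); rewrite divr_gt0 // => /(_ isT) H.
    apply: (le_trans (lerD IH2 H)); rewrite le_eqVlt tS; apply/orP; left; apply/eqP.
    by field; rewrite -tS !lt0r_neq0.
  have /andP[] := key N.+1.
  have -> : t N.+1 = 1 + h i by rewrite /t /x mulVKf.
  move=> k1 k2; rewrite k1 andbT lerBlDr (le_trans k2) // lerD2l -/x.
  by rewrite ler_piMr // gerBl invr_ge0 ltW.
- rewrite -[X in _ --> X]subr0; apply: cvgB; first exact: cvg_cst.
  rewrite -[X in _ --> X](mul0r (h i)); apply: cvgM; last exact: cvg_cst.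
  exact: cvg_harmonic.
- exact: cvg_cst.
Unshelve. all: by end_near. Qed.

End hull.

(** * Stieltjes functions *)

Section transforms.
Context {R : realType}.
Implicit Types (f g h : R -> R) (l x y z : R).

Definition laplace_hull : (R -> R) -> Prop :=
  hull [set l | 0 < l]
    (fun f => exists2 x, 0 <= x & f = fun l => expR (- (l * x))).

Definition stieltjes_hull : (R -> R) -> Prop :=
  hull [set l | 0 < l]
    (fun f => exists2 z, 0 <= z & f = fun l => (1 + l * z)^-1).

Lemma laplace_hull1 : laplace_hull (fun=> 1).
Proof.
apply: hull_base; exists 0 => //; apply/funext => l.
by rewrite mulr0 oppr0 expR0.
Qed.

Lemma laplace_hullM f g :
  laplace_hull f -> laplace_hull g -> laplace_hull (fun l => f l * g l).
Proof.
apply: hull_mul => _ _ [x x0 ->] [y y0 ->].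
apply: hull_base; exists (x + y); first exact: addr_ge0.
by apply/funext => l; rewrite -expRD mulrDr opprD.
Qed.

Lemma stieltjes_laplace_hull f : stieltjes_hull f -> laplace_hull f.
Proof.
apply: hull_sub => _ [z z0 ->]; apply: hull_geom => [l /= /ltW l0|r r0].
  exact: mulr_ge0.
apply: hull_base; exists (r * z); first exact: mulr_ge0.
by apply/funext => l; rewrite mulrCA.
Qed.

(** The unit norm of [w] makes the spectral weights sum to 1. The resolvent enters through a
    solution [x l] of the linear system, so that each use exhibits a vector instead of inverting a
    matrix. *)
Lemma stieltjes_hull_resolvent (m n : nat) (G : 'M[R]_(m, n)) (w : 'cV[R]_n)
    (x : R -> 'cV[R]_n) (f : R -> R) : (w^T *m w) 0 0 = 1 ->
  (forall l, 0 < l -> x l + l *: (G^T *m G *m x l) = w) ->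
  (forall l, 0 < l -> f l = (w^T *m x l) 0 0) ->
  stieltjes_hull f.
Proof.
move=> w1 xE fE; have [r [y [r0 y0 rs Hx]]] := resolvent_spectral G w.
have : stieltjes_hull (fun l => \sum_j r j * (1 + l * y j)^-1).
  apply: hull_sum => //; last by rewrite rs.
  by move=> j; apply: hull_base; exists (y j).
by move=> /hull_ext; apply=> l l0; rewrite (fE l l0) (Hx _ _ (ltW l0) (xE l l0)).
Qed.

(* The complete Bernstein functions whose Stieltjes measure is finite and purely atomic. *)
Definition cbf (r : seq (R * R)) l := \sum_(p <- r) p.1 * l / (1 + p.2 * l).

Definition nonneg_pairs (r : seq (R * R)) := all (fun p => (0 <= p.1) && (0 <= p.2)) r.

Lemma cbf_ge0 r l : nonneg_pairs r -> 0 <= l -> 0 <= cbf r l.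
Proof.
move=> /allP r0 l0; rewrite /cbf big_seq sumr_ge0 // => p /r0 /andP[p1 p2].
by rewrite divr_ge0 ?mulr_ge0 // addr_ge0 // mulr_ge0.
Qed.

(* [(1 + sum_i a_i l / (1 + b_i l))^-1] is the corner entry of [(1 + l G^T G)^-1]
   for [G = (sqrt a | diag (sqrt b))], by Schur complement. *)
Lemma stieltjes_hull_inv_cbf r : nonneg_pairs r ->
  stieltjes_hull (fun l => (1 + cbf r l)^-1).
Proof.
move=> r0; pose m := size r.
pose a (i : 'I_m) := (tnth (in_tuple r) i).1.
pose b (i : 'I_m) := (tnth (in_tuple r) i).2.
have ab0 i : 0 <= a i /\ 0 <= b i.
  by have /allP/(_ _ (mem_tnth i (in_tuple r)))/andP := r0.
pose A : 'cV[R]_m := \col_i Num.sqrt (a i).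
pose B : 'M[R]_m := diag_mx (\row_i Num.sqrt (b i)).
pose x0 l : R := (1 + cbf r l)^-1.
(* The lower block of the system, [x1 + l B^T (A x0 + B x1) = 0], determines [x1] from [x0]; the
   upper block then reads [x0 (1 + cbf r l) = 1]. *)
pose x1 l : 'cV[R]_m :=
  \col_i (- (l * (Num.sqrt (a i) * Num.sqrt (b i)) * x0 l / (1 + b i * l))).
apply: (@stieltjes_hull_resolvent m (1 + m) (row_mx A B) (col_mx 1%:M 0)
  (fun l => col_mx (x0 l)%:M (x1 l))).
- rewrite tr_col_mx mul_row_col trmx0 mul0mx addr0 trmx1 mul1mx.
  by rewrite mxE eqxx.
- move=> l l0; have cb := cbf_ge0 r0 (ltW l0).
  rewrite -mulmxA mul_row_col.
  have den i : 1 + b i * l != 0.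
    by rewrite gt_eqF // ltr_wpDr // mulr_ge0 ?(ltW l0) //; case: (ab0 i).
  have -> : A *m (x0 l)%:M + B *m x1 l =
      \col_i (Num.sqrt (a i) * x0 l / (1 + b i * l)).
    apply/colP => i; rewrite mul_diag_mx mul_mx_scalar !mxE.
    have [_ /sqr_sqrtr] := ab0 i; set s := Num.sqrt (b i) => bi.
    by move: (den i); rewrite -bi => di; field.
  rewrite tr_row_mx mul_col_mx scale_col_mx add_col_mx; congr col_mx.
    apply/matrixP => i j; rewrite !ord1 !mxE eqxx !mulr1n mulr_sumr.
    rewrite [RHS](_ : 1 = x0 l * (1 + cbf r l)); last first.
      by rewrite mulVf // gt_eqF // ltr_wpDr.
    rewrite [RHS]mulrDr mulr1; congr (_ + _).
    rewrite /cbf [in RHS](big_tnth _ _ r) mulr_sumr; apply: eq_bigr => k _.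
    rewrite !mxE -/(a k) -/(b k).
    have [/sqr_sqrtr] := ab0 k; set s := Num.sqrt (a k) => ak _.
    by rewrite -ak; field; exact: den.
  apply/colP => i; rewrite tr_diag_mx mul_diag_mx !mxE.
  by field; exact: den.
- move=> l l0; rewrite tr_col_mx mul_row_col trmx0 mul0mx addr0 trmx1 mul1mx.
  by rewrite mxE eqxx mulr1n.
Qed.

(* With [S = w^T (1 + l Z)^-1 w] and [K = 1 - (1 - sqrt u) w w^T], the function
   below is [w^T (1 + l K Z K)^-1 w], by the rank one update formula. *)
Lemma stieltjes_hull_deform n (w z : 'I_n -> R) (u : R) :
  (forall j, 0 <= w j) -> (forall j, 0 <= z j) -> \sum_j w j = 1 ->
  0 < u <= 1 ->
  let S l := \sum_j w j / (1 + l * z j) in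
  stieltjes_hull (fun l => S l / (u + (1 - u) * S l)).
Proof.
move=> w0 z0 ws /andP[u0 u1] S.
pose su := Num.sqrt u; pose k := 1 - su.
have su2 : su ^+ 2 = u by rewrite sqr_sqrtr // ltW.
pose om : 'cV[R]_n := \col_j Num.sqrt (w j).
(* Square roots of the nodes: the Gram matrix of [Z *m K] is then the perturbed matrix. *)
pose Z : 'M[R]_n := diag_mx (\row_j Num.sqrt (z j)).
pose K : 'M[R]_n := 1%:M - k *: (om *m om^T).
pose Q l := u + (1 - u) * S l.
pose B l : 'cV[R]_n := \col_j (Num.sqrt (w j) / (1 + l * z j)).
(* [B l] solves the unperturbed system [B + l Z^2 B = om]. The coefficients of [x l] are those for
   which [om^T x = S / Q] and [K x = (su / Q) B]; the relation [l Z^2 B = om - B] then closes the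
   computation. *)
pose x l : 'cV[R]_n := (su / Q l) *: B l + (k * S l / Q l) *: om.
have den l j : 0 < l -> 1 + l * z j != 0.
  by move=> l0; rewrite gt_eqF // ltr_wpDr // mulr_ge0 // ltW.
have om1 : om^T *m om = 1%:M.
  apply/matrixP => i j; rewrite !ord1 !mxE eqxx -ws; apply: eq_bigr => a _.
  by rewrite !mxE -expr2 sqr_sqrtr.
have omB l : om^T *m B l = (S l)%:M.
  apply/matrixP => i j; rewrite !ord1 !mxE eqxx mulr1n; apply: eq_bigr => a _.
  by rewrite !mxE mulrA -expr2 sqr_sqrtr.
have Q0 l : 0 < l -> Q l != 0.
  move=> l0; rewrite gt_eqF // ltr_wpDr // mulr_ge0 ?subr_ge0 // sumr_ge0 // => j _.
  by rewrite divr_ge0 // addr_ge0 // mulr_ge0 // ltW.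
have omx l : 0 < l -> om^T *m x l = (S l / Q l)%:M.
  move=> l0; rewrite mulmxDr -!scalemxAr omB om1 !scale_scalar_mx -raddfD.
  by congr (_%:M); rewrite /k; field; exact: Q0.
have KE (v : 'cV[R]_n) (t : R) : om^T *m v = t%:M -> K *m v = v - (k * t) *: om.
  move=> vt; rewrite mulmxBl mul1mx -scalemxAl -mulmxA vt mul_mx_scalar.
  by rewrite scalerA.
have KT : K^T = K.
  by rewrite /K linearB linearZ /= trmx1 trmx_mul trmxK.
apply: (@stieltjes_hull_resolvent n n (Z *m K) om x).
- by rewrite om1 mxE eqxx.
- move=> l l0; have Ql := Q0 l l0.
  have Kx : K *m x l = (su / Q l) *: B l.
    by rewrite (KE _ _ (omx l l0)) /x mulrA addrK.
  rewrite trmx_mul KT -!mulmxA Kx -!scalemxAr.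
  have -> : Z^T *m (Z *m B l) = l^-1 *: (om - B l).
    apply/colP => j; rewrite tr_diag_mx !mul_diag_mx !mxE.
    have /sqr_sqrtr := z0 j; set s := Num.sqrt (z j) => zj.
    by move: (den l j l0); rewrite -zj => dj; field; rewrite dj gt_eqF.
  rewrite -scalemxAr (KE _ (1 - S l)); last first.
    by rewrite mulmxBr om1 omB -raddfB.
  apply/colP => j; rewrite !mxE.
  have := den l j l0 => dj.
  rewrite /k -[in 1 - S l]/(S l).
  have -> : Num.sqrt (w j) = Num.sqrt (w j) * Q l / Q l by rewrite mulfK.
  rewrite /Q -su2.
  by field; rewrite dj (gt_eqF l0) su2 -/(Q l) Ql.
- by move=> l l0; rewrite omx // mxE eqxx mulr1n.
Qed.

End transforms.

(** * Generalized gamma convolutions *)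

Section gamma_closure.
Context {R : realType}.
Implicit Types (f g h : R -> R) (l x y z : R).

(** The Goldie-Steutel theorem, infinite divisibility of mixtures of exponential laws, in the case
    of finitely many nodes. *)
Lemma stieltjes_sum_powR n (w z : 'I_n -> R) (a : R) :
  (forall j, 0 <= w j) -> (forall j, 0 <= z j) -> \sum_j w j = 1 -> 0 <= a ->
  laplace_hull (fun l => (\sum_j w j / (1 + l * z j)) `^ a).
Proof.
move=> w0 z0 w1 a0; pose S l := \sum_j w j / (1 + l * z j).
have den l j : 0 < l -> 1 <= 1 + l * z j.
  by move=> l0; rewrite lerDl mulr_ge0 // ltW.
have S1 l : 0 < l -> S l <= 1.
  move=> l0; rewrite -w1; apply: ler_sum => j _.
  rewrite ler_piMr // invf_le1 ?den //.
  exact: lt_le_trans (den _ _ l0).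
have S0 l : 0 < l -> 0 < S l.
  move=> l0; have Sge j : 0 <= w j / (1 + l * z j).
    by rewrite divr_ge0 // (le_trans _ (den _ _ l0)).
  rewrite lt_neqAle sumr_ge0 // andbT eq_sym; apply/negP => /eqP /psumr_eq0P H.
  have : \sum_j w j = 0.
    apply: big1 => j _; have /eqP := H (fun i _ => Sge i) j isT.
    by rewrite mulf_eq0 invr_eq0 [X in _ || X]gt_eqF ?orbF ?(lt_le_trans _ (den _ _ l0)) // => /eqP.
  by rewrite w1 => /eqP; rewrite oner_eq0.
have h0 l : 0 < l -> 0 <= (S l)^-1 - 1.
  by move=> l0; rewrite subr_ge0 invf_ge1 // ?S0 // S1.
apply: (@hull_ext _ _ _ _ (fun l => (1 + ((S l)^-1 - 1))^-1 `^ a)); last first.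
  by move=> l _; rewrite subrKC invrK.
apply: hull_powR => //.
- exact: laplace_hull1.
- by move=> f g Gf Gg; apply: laplace_hullM; exact: hull_base.
(* The deformation is stated for [u > 0]; at [u = 0] the function is the constant 1. *)
move=> u /andP[]; rewrite le_eqVlt => /predU1P[<- _|u0 u1].
  by apply: (hull_ext laplace_hull1) => l _; rewrite mul0r addr0 invr1.
apply: stieltjes_laplace_hull.
have := @stieltjes_hull_deform _ _ w z u w0 z0 w1.
rewrite u0 u1 => /(_ isT) /hull_ext; apply=> l l0; rewrite -/(S l).
have Sn := lt0r_neq0 (S0 l l0).
have -> : 1 + u * ((S l)^-1 - 1) = (u + (1 - u) * S l) / S l by field.
by rewrite invf_div.
Qed.

(* Laplace transforms of the limits of finite convolutions of gamma laws;
   positivity of the limit excludes an escape of mass to infinity. *)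
Inductive gamma_closure : (R -> R) -> Prop :=
| gamma_base b p : 0 <= b -> 0 <= p ->
    gamma_closure (fun l => (1 + b * l)^-1 `^ p)
| gamma_mul f g : gamma_closure f -> gamma_closure g ->
    gamma_closure (fun l => f l * g l)
| gamma_lim (F : nat -> R -> R) f : (forall n, gamma_closure (F n)) ->
    (forall l, 0 <= l -> F n l @[n --> \oo] --> f l) ->
    (forall l, 0 <= l -> 0 < f l) -> gamma_closure f.

Lemma gamma_closure_itv01 f : gamma_closure f ->
  forall l, 0 <= l -> 0 < f l <= 1.
Proof.
elim=> [b p b0 p0|{}f g _ f01 _ g01|F {}f _ F01 Ff f0] l l0.
- have d1 : 1 <= 1 + b * l by rewrite lerDl mulr_ge0.
  have d0 : 0 < 1 + b * l by apply: lt_le_trans d1.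
  rewrite powR_gt0 ?invr_gt0 //=.
  apply: (@le_trans _ _ (1 `^ p)); last by rewrite powR1.
  by apply: ge0_ler_powR => //; rewrite ?nnegrE ?invr_ge0 ?(ltW d0) ?invf_le1.
- have /andP[? ?] := f01 l l0; have /andP[? ?] := g01 l l0.
  by rewrite mulr_gt0 //= mulr_ile1 // ltW.
- rewrite f0 //= -(cvg_lim _ (Ff l l0)) //; apply: limr_le.
    by apply/cvg_ex; exists (f l); exact: Ff.
  by near=> n; have /andP[] := F01 n l l0.
Unshelve. all: by end_near. Qed.

Lemma gamma_closure_ext f g : gamma_closure f ->
  (forall l, 0 <= l -> f l = g l) -> gamma_closure g.
Proof.
move=> Gf fg; apply: (@gamma_lim (fun=> f)) => // l l0; rewrite -fg //.
  exact: cvg_cst.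
by have /andP[] := gamma_closure_itv01 Gf l0.
Qed.

Lemma gamma_closure1 : gamma_closure (fun=> 1).
Proof.
apply: (gamma_closure_ext (gamma_base (lexx 0) (lexx 0))) => l _.
by rewrite powRr0.
Qed.

Lemma gamma_closure_prod (J : Type) (r : seq J) (F : J -> R -> R) :
  (forall j, gamma_closure (F j)) -> gamma_closure (fun l => \prod_(j <- r) F j l).
Proof.
move=> GF; elim: r => [|j r IHr].
  by apply: (gamma_closure_ext gamma_closure1) => l _; rewrite big_nil.
by apply: (gamma_closure_ext (gamma_mul (GF j) IHr)) => l _; rewrite big_cons.
Qed.

Lemma powR_cvg (u : nat -> R) (x a : R) : 0 < x -> u n @[n --> \oo] --> x ->
  u n `^ a @[n --> \oo] --> x `^ a.
Proof.
move=> x0 ux; rewrite {2}/powR gt_eqF //.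
have : expR (a * ln (u n)) @[n --> \oo] --> expR (a * ln x).
  apply: continuous_cvg; first exact: continuous_expR.
  by apply: cvgM; [exact: cvg_cst|apply: continuous_cvg => //; exact: continuous_ln].
apply: cvg_trans; apply: near_eq_cvg; near=> n.
rewrite /powR gt_eqF //; near: n.
by apply: (cvgr_gt _ ux).
Unshelve. all: by end_near. Qed.

(** A power only multiplies the shape parameters [p], so convolution roots stay in the class.
    Positivity of the limits makes the power continuous there. *)
Lemma gamma_closure_powR f a : 0 <= a -> gamma_closure f ->
  gamma_closure (fun l => f l `^ a).
Proof.
move=> a0; elim=> [b p b0 p0|{}f g Gf IHf Gg IHg|F {}f GF IH Ff f0].
- apply: (gamma_closure_ext (gamma_base b0 (mulr_ge0 p0 a0))) => l _.
  by rewrite powRrM.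
- apply: (gamma_closure_ext (gamma_mul IHf IHg)) => l l0.
  have /andP[/ltW ? _] := gamma_closure_itv01 Gf l0.
  have /andP[/ltW ? _] := gamma_closure_itv01 Gg l0.
  by rewrite powRM.
- apply: (gamma_lim IH) => l l0; last by rewrite powR_gt0 ?f0.
  by apply: powR_cvg; [exact: f0|exact: Ff].
Qed.

Lemma gamma_closure_laplace f : gamma_closure f -> laplace_hull f.
Proof.
elim=> [b p b0 p0|{}f g _ IHf _ IHg|F {}f _ IH Ff _].
- apply: hull_powR => //.
  + exact: laplace_hull1.
  + by move=> f' g' Gf Gg; apply: laplace_hullM; exact: hull_base.
  + by move=> l /= /ltW l0; exact: mulr_ge0.
  move=> u /andP[u0 _]; apply: stieltjes_laplace_hull; apply: hull_base.
  exists (u * b); first exact: mulr_ge0.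
  by apply/funext => l; rewrite [l * _]mulrC mulrA.
- exact: laplace_hullM.
- by apply: (hull_lim IH) => l /= /ltW; exact: Ff.
Qed.

(* Pairs [ls = (l, s)], where [s] stands for a value of [X]. *)
Definition cbf_hull : (R * R -> R) -> Prop :=
  hull [set ls : R * R | 0 < ls.1 /\ 0 <= ls.2]
    (fun F => exists2 r, nonneg_pairs r &
              F = fun ls => expR (- (ls.2 * cbf r ls.1))).

(** Multiplying two generators of [cbf_hull] concatenates their lists of atoms, hence stability
    under products. Positivity in [gamma_lim] keeps the limit of the denominators away from 0. *)
Lemma gamma_closure_ratio f c : 0 <= c -> gamma_closure f ->
  cbf_hull (fun ls => f (ls.1 * (ls.2 + c)) / f (ls.1 * c)).
Proof.
move=> c0.
have hM F G : cbf_hull F -> cbf_hull G -> cbf_hull (fun ls => F ls * G ls).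
  apply: hull_mul => _ _ [r r0 ->] [q q0 ->]; apply: hull_base; exists (r ++ q).
    by rewrite /nonneg_pairs all_cat; apply/andP.
  by apply/funext => ls; rewrite /cbf big_cat /= mulrDr opprD expRD.
elim=> [b p b0 p0|{}f g Gf IHf Gg IHg|F {}f GF IH Ff f0].
- apply: (@hull_ext _ _ _ _
    (fun ls => (1 + ls.2 * cbf [:: (b, b * c)] ls.1)^-1 `^ p)).
    apply: hull_powR => //.
    + apply: hull_base; exists [::] => //; apply/funext => ls.
      by rewrite /cbf big_nil mulr0 oppr0 expR0.
    + by move=> F G HF HG; apply: hM; exact: hull_base.
    + move=> [l s] /= [/ltW l0 s0]; rewrite mulr_ge0 // cbf_ge0 //= b0.
      by rewrite mulr_ge0.
    move=> u /andP[u0 _]; apply: hull_geom.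
      move=> [l s] /= [/ltW l0 s0]; rewrite !mulr_ge0 // cbf_ge0 //= b0.
      by rewrite mulr_ge0.
    move=> r r0; apply: hull_base; exists [:: (r * u * b, b * c)].
      by rewrite /= !mulr_ge0.
    apply/funext => -[l s] /=; rewrite /cbf !big_seq1 /=; congr (expR (- _)).
    by move: (_^-1) => D; ring.
  move=> [l s] /= [l0 s0]; rewrite /cbf big_seq1 /=.
  have d1 : 0 < 1 + b * c * l by rewrite ltr_wpDr // !mulr_ge0 // ltW.
  have d2 : 0 < 1 + b * (l * (s + c)).
    by rewrite ltr_wpDr // !mulr_ge0 ?addr_ge0 // ltW.
  have d3 : 1 + b * (l * c) = 1 + b * c * l by ring.
  have d4 : 0 < 1 + s * (b * l / (1 + b * c * l)).
    have l0' := ltW l0.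
    by rewrite ltr_wpDr // mulr_ge0 // divr_ge0 ?(ltW d1) // mulr_ge0.
  have -> : (1 + b * (l * (s + c)))^-1 =
      (1 + s * (b * l / (1 + b * c * l)))^-1 * (1 + b * c * l)^-1.
    by rewrite -invfM; congr (_^-1); field; exact: lt0r_neq0.
  rewrite d3 powRM ?invr_ge0 ?ltW // mulfK //.
  by rewrite gt_eqF // powR_gt0 // invr_gt0.
- apply: (hull_ext (hM _ _ IHf IHg)) => -[l s] /= [l0 s0].
  have [fn gn] : f (l * c) != 0 /\ g (l * c) != 0.
    have lc : 0 <= l * c by rewrite mulr_ge0 // ltW.
    have /andP[/lt0r_neq0 ? _] := gamma_closure_itv01 Gf lc.
    by have /andP[/lt0r_neq0 ? _] := gamma_closure_itv01 Gg lc.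
  by field; rewrite fn gn.
- apply: (hull_lim IH) => -[l s] /= [/ltW l0 s0].
  apply: cvgM; first by apply: Ff; rewrite mulr_ge0 // addr_ge0.
  apply: cvgV; first by rewrite gt_eqF // f0 // mulr_ge0.
  by apply: Ff; rewrite mulr_ge0.
Qed.

End gamma_closure.

(** * Completely monotone functions as limits of exponential sums *)

Section completely_monotone_approximation.
Context {R : realType}.
Implicit Types (c : nat -> R) (i j l m n : nat).

(* A completely monotone function is a limit of exponential sums by the Hausdorff
   moment argument: the Bernstein weights of order [N] of the sequence
   [k (e + j / (n + 1))] are nonnegative, and their moments differ from the sequence
   by O(1 / N). *)
Fixpoint fdiff m c i : R :=
  if m is m'.+1 then fdiff m' (fun j => c j - c j.+1) i else c i.

(** With [E] the shift of sequences, this is the binomial expansion of [1 = ((1 - E) + E)^n] applied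
    to [c]. *)
Lemma fdiff_newton n c i :
  c i = \sum_(0 <= l < n.+1) 'C(n, l)%:R * fdiff (n - l) c (i + l).
Proof.
elim: n c i => [|n IHn] c i; first by rewrite big_nat1 bin0 mul1r addn0.
rewrite big_nat_recl //= bin0 mul1r addn0 ?subn0 /=.
have -> : \sum_(0 <= l < n.+1) 'C(n.+1, l.+1)%:R * fdiff (n.+1 - l.+1) c (i + l.+1) =
    \sum_(0 <= l < n) 'C(n, l.+1)%:R * fdiff (n - l.+1) (fun j => c j - c j.+1) (i + l.+1) +
    \sum_(0 <= l < n.+1) 'C(n, l)%:R * fdiff (n - l) c (i.+1 + l).
  rewrite big_nat_recr //= [in RHS]big_nat_recr //= addrA -big_split /=; congr (_ + _).
    rewrite !big_mkord; apply: eq_bigr => l _.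
    rewrite binS natrD mulrDl subSS addnS addSn; congr (_ + _).
    by rewrite -[in LHS](@subnSK l n) // subSS.
  by rewrite binS bin_small // add0n subSS addnS addSn.
rewrite addrA -(IHn c i.+1).
have := IHn (fun j => c j - c j.+1) i.
rewrite big_nat_recl // bin0 mul1r addn0 subn0 => <-.
by rewrite subrK.
Qed.

(** If [c] is the moment sequence of a measure on [0, 1], this is the integral of the Bernstein
    polynomial [C(N, j) x^j (1 - x)^(N - j)]; it serves as the mass placed at [j / N]. *)
Definition bern_weight c N j : R := 'C(N, j)%:R * fdiff (N - j) c j.

Lemma bin_ffact_shift N i j : (i + j <= N)%N ->
  ('C(N, i + j) * (i + j) ^_ i = 'C(N - i, j) * N ^_ i)%N.
Proof.
move=> ijN; apply/eqP; rewrite -(eqn_pmul2r (fact_gt0 (N - (i + j)))).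
rewrite -(eqn_pmul2r (fact_gt0 j)); apply/eqP.
transitivity (N`!).
  rewrite -(bin_fact ijN) -!mulnA; congr (_ * _)%N.
  rewrite -(@ffact_fact (i + j) i) ?leq_addr // addKn.
  by rewrite -!mulnA; congr (_ * _)%N; rewrite mulnC.
have iN : (i <= N)%N by apply: leq_trans ijN; rewrite leq_addr.
rewrite -(ffact_fact iN) -(@bin_fact (N - i) j); last by rewrite leq_subRL.
by rewrite subnDA; ring.
Qed.

(** Factorial moments are reproduced exactly: the terms [j < i] vanish and the others form the
    Newton expansion of order [N - i] at [i]. *)
Lemma bern_weight_ffact c N i : (i <= N)%N ->
  \sum_(0 <= j < N.+1) bern_weight c N j * (j ^_ i)%:R = (N ^_ i)%:R * c i.
Proof.
move=> iN; rewrite (@big_cat_nat _ _ _ i) //=; last exact: leqW.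
rewrite big1_seq ?add0r; last first.
  by move=> j; rewrite mem_index_iota => /andP[_ /andP[_ ji]]; rewrite ffact_small ?mulr0.
rewrite -[X in \sum_(X <= _ < _) _]add0n big_addn subSn // (fdiff_newton (N - i) c i) mulr_sumr.
rewrite !big_mkord; apply: eq_bigr => -[l /= lN] _.
have ilN : (i + l <= N)%N by rewrite -leq_subRL.
rewrite /bern_weight [(l + i)%N]addnC subnDA mulrAC -natrM bin_ffact_shift // natrM.
by ring.
Qed.

(** The cost of replacing factorial moments by ordinary ones. The ratio of falling factorials is a
    product of [(j - i) / (N - i)], each at most [i / N] below [j / N]; the errors add up, and
    [i^2 + i <= (i + 1)^2]. *)
Lemma bern_power_bound N i j : (0 < N)%N -> (i <= N)%N -> (j <= N)%N ->
  0 <= (j%:R / N%:R : R) ^+ i - (j ^_ i)%:R / (N ^_ i)%:R <= (i ^ 2)%:R / N%:R.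
Proof.
move=> N0 iN jN; have Nn : N%:R != 0 :> R by rewrite pnatr_eq0 -lt0n.
have x01 : 0 <= (j%:R / N%:R : R) <= 1.
  by rewrite divr_ge0 //= ler_pdivrMr ?ltr0n // mul1r ler_nat.
elim: i iN => [|i IHi] iN; first by rewrite expr0 !ffactn0 divr1 subrr lexx divr_ge0.
have /IHi /andP[e0 e1] : (i <= N)%N by exact: ltnW.
have /andP[x0 x1] := x01.
set x := j%:R / N%:R : R in e0 e1 x0 x1 *.
set P := (j ^_ i)%:R / (N ^_ i)%:R : R in e0 e1.
pose q : R := (j - i)%:R / (N - i)%:R.
have NiR : (N - i)%:R != 0 :> R by rewrite pnatr_eq0 -lt0n subn_gt0.
have -> : (j ^_ i.+1)%:R / (N ^_ i.+1)%:R = P * q.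
  by rewrite !ffactnSr !natrM /P /q invfM; ring.
have P0 : 0 <= P by rewrite divr_ge0.
have P1 : P <= 1 by rewrite (le_trans (_ : P <= x ^+ i)) ?exprn_ile1 // -subr_ge0.
have xq : 0 <= x - q <= i%:R / N%:R.
  (* For [j < i] truncated subtraction gives [q = 0], and [x] itself is below [i / N]. *)
  have [ij|ji] := leqP i j; last first.
    rewrite /q (_ : (j - i)%N = 0%N) ?mul0r ?subr0 ?x0; last by apply/eqP; exact: ltnW.
    by rewrite ler_pM2r ?invr_gt0 ?ltr0n // ler_nat ltnW.
  have -> : x - q = (i%:R / N%:R) * ((N - j)%:R / (N - i)%:R).
    rewrite /x /q !natrB ?(ltnW iN) // in NiR *.
    by field; rewrite NiR.
  rewrite mulr_ge0 ?divr_ge0 //= ler_piMr ?divr_ge0 // ler_pdivrMr ?ltr0n ?subn_gt0 //.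
  by rewrite mul1r ler_nat leq_sub2l.
have -> : x ^+ i.+1 - P * q = x * (x ^+ i - P) + P * (x - q).
  by rewrite exprS; ring.
case/andP: xq => q0 q1; rewrite addr_ge0 ?mulr_ge0 //=.
apply: (@le_trans _ _ ((i ^ 2)%:R / N%:R + i%:R / N%:R)).
  apply: lerD; first by apply: le_trans e1; rewrite ler_piMl.
  by apply: le_trans q1; rewrite ler_piMl.
rewrite -mulrDl -natrD ler_pM2r ?invr_gt0 ?ltr0n // ler_nat.
by rewrite -[i.+1]addn1 sqrnD exp1n muln1 -addnA leq_add2l mul2n -addnn addnA leq_addl.
Qed.

(* [kappa m] stands for [(-1)^m] times the [m]-th derivative. *)
Definition alternating (kappa : nat -> R -> R) :=
  forall m (x : R), 0 < x ->
    is_derive x 1 (kappa m) (- kappa m.+1 x) /\ 0 <= kappa m x.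

Lemma alternating_nincr kappa m (x y : R) : alternating kappa -> 0 < x ->
  x <= y -> kappa m y <= kappa m x.
Proof.
move=> K x0 xy.
have [||z /andP[zx zy]] := @MVT_segment _ (kappa m) (fun z => - kappa m.+1 z) x y xy.
- move=> z; rewrite in_itv => /andP[xz _]; have z0 := lt_trans x0 xz.
  by have [] := K m z z0.
- apply: derivable_within_continuous => z; rewrite in_itv => /andP[xz _].
  have z0 := lt_le_trans x0 xz.
  by have [[]] := K m z z0.
move=> E; rewrite -subr_le0 E mulNr oppr_le0 mulr_ge0 ?subr_ge0 //.
by have [_] := K m.+1 z (lt_le_trans x0 zx).
Qed.

(** One difference preserves complete monotonicity, so iterated differences keep their sign by
    induction, without a mean value formula of higher order. *)
Lemma alternating_shift kappa (h : R) : 0 <= h -> alternating kappa ->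
  alternating (fun m x => kappa m x - kappa m (x + h)).
Proof.
move=> h0 K m x x0; split; last first.
  by rewrite subr_ge0; apply: (alternating_nincr _ K) => //; rewrite lerDl.
have xh0 : 0 < x + h by rewrite ltr_wpDr.
have [K1 _] := K m x x0; have [K2 _] := K m (x + h) xh0.
have K3 : is_derive x 1 (fun y : R => y + h) 1.
  by rewrite -[X in is_derive _ _ _ X]addr0; apply: is_deriveD.
have := @is_derive1_comp _ (kappa m) (fun y => y + h) x _ _ K2 K3.
by rewrite mulr1 opprD => K4; exact: is_deriveB.
Qed.

Lemma alternating_fdiff kappa (e h : R) m i : 0 < e -> 0 <= h -> alternating kappa ->
  0 <= fdiff m (fun j => kappa 0%N (e + j%:R * h)) i.
Proof.
move=> e0 h0; elim: m kappa => [|m IHm] kappa K /=.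
  by have [] := K 0%N (e + i%:R * h) _; rewrite ?ltr_wpDr ?mulr_ge0.
have := IHm _ (alternating_shift h0 K); congr (_ <= fdiff _ _ _).
by apply/funext => j; rewrite -addrA -natr1 mulrDl mul1r.
Qed.

Lemma completely_monotone_alternating (k : R -> R) : completely_monotone k ->
  alternating (fun m x => (-1) ^+ m * derive1n m k x).
Proof.
move=> K m x x0; have [dk k0] := K m x x0; split=> //.
have dkE : is_derive x 1 (derive1n m k) (derive1n m.+1 k x).
  by rewrite derive1nS derive1E; exact: derivableP.
have := is_deriveZ ((-1) ^+ m : R) dkE.
by rewrite exprS mulN1r mulNr opprK.
Qed.

Lemma completely_monotone_continuous (k : R -> R) (x : R) :
  completely_monotone k -> 0 < x -> {for x, continuous k}.
Proof.
move=> K x0; have [dk _] := K 0%N x x0.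
exact/differentiable_continuous/derivable1_diffP.
Qed.

Lemma completely_monotone_nincr (k : R -> R) (x y : R) :
  completely_monotone k -> 0 < x -> x <= y -> k y <= k x.
Proof.
move=> /completely_monotone_alternating K x0 xy.
by have := alternating_nincr 0 K x0 xy; rewrite !expr0 !mul1r.
Qed.

(** Sampling starts at [e > 0] because [k] may blow up at 0. The total mass of the weights is [k e],
    which gives the uniform bound used later for dominated convergence. *)
Lemma completely_monotone_exp_approx (k : R -> R) (e : R) :
  completely_monotone k -> 0 < e ->
  exists (N : nat -> nat) (p b : nat -> nat -> R),
    let E n x := \sum_(0 <= j < N n) p n j * expR (- (b n j * x)) in
    [/\ forall n j, 0 <= p n j, forall n j, 0 <= b n j,
        forall n x, 0 < x -> E n x <= k e &
        forall x, 0 < x -> E n x @[n --> \oo] --> k (e + x)].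
Proof.
move=> K e0; have A := completely_monotone_alternating K.
(* The value at [x] is a moment of order [i] close to [x (n + 1)]; the cube makes the error
   [i^2 / N n] of order [1 / n]. *)
pose N n := (n.+1 ^ 3)%N.
pose c n j := k (e + j%:R * n.+1%:R^-1).
pose p n j := bern_weight (c n) (N n) j.+1.
(* Chosen so that [exp (- b i / (n + 1))] is [((j + 1) / N)^i]. The node 0, of infinite rate, is
   dropped by the shift of [j]: it adds nothing to moments of positive order. [minn] keeps the rate
   nonnegative at every index. *)
pose b n j : R := n.+1%:R * ln ((N n)%:R / (minn j.+1 (N n))%:R).
have NR n : (0 < (N n)%:R :> R) by rewrite ltr0n expn_gt0.
have w0 n j : 0 <= bern_weight (c n) (N n) j.
  rewrite mulr_ge0 //; have := @alternating_fdiff _ e n.+1%:R^-1 (N n - j) j e0 _ A.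
  rewrite invr_ge0 ler0n => /(_ isT); congr (_ <= fdiff _ _ _).
  by apply/funext => i; rewrite expr0 mul1r.
have b0 n j : 0 <= b n j.
  rewrite mulr_ge0 // ln_ge0 // ler_pdivlMr ?ltr0n ?leq_min ?ltn0Sn ?expn_gt0 //.
  by rewrite mul1r ler_nat geq_minr.
exists N, p, b => E; split => //; first by move=> n j; exact: w0.
  move=> n x x0.
  have := @bern_weight_ffact (c n) (N n) 0 (leq0n _).
  rewrite ffactn0 mul1r [c n 0%N]/c mul0r addr0 => <-.
  rewrite big_nat_recl //= ler_wpDl //; first by rewrite mulr_ge0 ?w0.
  apply: ler_sum => j _; rewrite ffactn0 ler_wpM2l ?w0 // expR_le1 oppr_le0.
  by rewrite mulr_ge0 // ltW.
move=> x x0; pose h n : R := n.+1%:R^-1.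
have hn n : h n * n.+1%:R = 1 by rewrite mulVf.
have Enincr n y z : y <= z -> E n z <= E n y.
  move=> yz; apply: ler_sum => j _; rewrite ler_wpM2l ?w0 // ler_expR lerN2.
  by rewrite ler_wpM2l.
have EE n i : (0 < i)%N ->
    E n (i%:R * h n) = \sum_(0 <= j < (N n).+1) bern_weight (c n) (N n) j * (j%:R / (N n)%:R) ^+ i.
  move=> i0; rewrite [RHS]big_nat_recl //= mul0r expr0n gtn_eqF // mulr0 add0r.
  rewrite /E !big_mkord; apply: eq_bigr => -[j /= jN] _; congr (_ * _).
  rewrite /b (minn_idPl jN).
  have -> : - (n.+1%:R * ln ((N n)%:R / j.+1%:R) * (i%:R * h n)) =
      i%:R * - ln ((N n)%:R / j.+1%:R) * (h n * n.+1%:R) by ring.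
  rewrite hn mulr1 expRM_natl -lnV ?posrE ?divr_gt0 // invf_div lnK //.
  by rewrite posrE divr_gt0.
have Ebound n i : (0 < i <= N n)%N ->
    c n i <= E n (i%:R * h n) <= c n i + (i ^ 2)%:R / (N n)%:R * k e.
  case/andP=> i0 iN; rewrite EE //.
  have ciE : c n i = \sum_(0 <= j < (N n).+1) bern_weight (c n) (N n) j *
      ((j ^_ i)%:R / (N n ^_ i)%:R).
    under eq_bigr do rewrite mulrA.
    rewrite -mulr_suml bern_weight_ffact // mulrC mulKf //.
    by rewrite pnatr_eq0 -lt0n ffact_gt0.
  have c0E : k e = \sum_(0 <= j < (N n).+1) bern_weight (c n) (N n) j.
    have := @bern_weight_ffact (c n) (N n) 0 (leq0n _).
    rewrite ffactn0 mul1r [c n 0%N]/c mul0r addr0 => <-.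
    by apply: eq_bigr => j _; rewrite ffactn0 mulr1.
  rewrite ciE c0E mulr_sumr -big_split /=.
  have B j : (j < (N n).+1)%N -> _ := fun jN =>
    @bern_power_bound (N n) i j (leq_trans i0 iN) iN jN.
  rewrite !big_mkord; apply/andP; split; apply: ler_sum => -[j /= jN] _.
    by rewrite ler_wpM2l // -subr_ge0; have /andP[] := B j jN.
  rewrite [(i ^ 2)%:R / _ * _]mulrC -mulrDr ler_wpM2l // -lerBlDl.
  by have /andP[] := B j jN.
have hcvg : h n @[n --> \oo] --> 0 by exact: cvg_harmonic.
have kc : {for e + x, continuous k}.
  by apply: completely_monotone_continuous => //; rewrite addr_gt0.
apply: (@squeeze_cvgr _ _ _ _ (fun n => k (e + x + h n))
  (fun n => k (e + x - h n) + x ^+ 2 * h n * k e)).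
- near=> n.
  (* [x] lies between the grid points [i h] and [(i + 1) h]; as [E n] and [k] are nonincreasing, the
     bounds at these two points suffice. *)
  pose i := Num.truncn (x * n.+1%:R).
  have xn0 : 0 <= x * n.+1%:R by rewrite mulr_ge0 // ltW.
  have /andP[ix xi] := truncn_itv xn0; rewrite -/i in ix xi.
  have h0 : 0 < h n by rewrite invr_gt0.
  have ihx : i%:R * h n <= x by rewrite -ler_pdivlMr ?invrK.
  have xih : x < i.+1%:R * h n by rewrite -ltr_pdivrMr ?invrK.
  have xnN : x < n.+1%:R.
    by apply: (@lt_trans _ _ n%:R); [near: n; exact: nbhs_infty_gtr|rewrite ltr_nat].
  have i0 : (0 < i)%N.
    rewrite truncn_gt_nat -ler_pdivrMr // mul1r; apply: ltW.
    by near: n; apply: (cvgr_lt _ hcvg).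
  have iN : (i.+1 <= N n)%N.
    rewrite -(ltr_nat R); apply: (le_lt_trans ix).
    rewrite /N expnS natrM mulrC ltr_pM2l // (lt_le_trans xnN) // ler_nat.
    by rewrite expnS expn1 leq_pmulr.
  have xhh : h n < x by near: n; apply: (cvgr_lt _ hcvg).
  have /andP[lo _] := Ebound n i.+1 iN.
  have iN' : (0 < i <= N n)%N by rewrite i0 ltnW.
  have /andP[_ hi] := Ebound n i iN'.
  apply/andP; split.
    apply: (le_trans _ (Enincr n _ _ (ltW xih))); apply: (le_trans _ lo).
    apply: (completely_monotone_nincr K); rewrite ?addr_gt0 ?mulr_gt0 //.
    by rewrite -addrA lerD2l -natr1 mulrDl mul1r lerD2r.
  apply: (le_trans (Enincr n _ _ ihx)); apply: (le_trans hi).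
  apply: lerD.
    apply: (completely_monotone_nincr K); first by rewrite -addrA addr_gt0 // subr_gt0.
    rewrite -addrA lerD2l lerBlDr -[X in _ + X]mul1r -mulrDl natr1.
    exact: ltW.
  have ke0 : 0 <= k e by have [_] := K 0%N e e0; rewrite expr0 mul1r.
  apply: ler_wpM2r => //; rewrite ler_pdivrMr //.
  have -> : x ^+ 2 * h n * (N n)%:R = (x * n.+1%:R) ^+ 2.
    rewrite /N expnS natrM mulrA -[_ * h n * _]mulrA hn mulr1 natrX.
    by rewrite exprMn.
  by rewrite natrX lerXn2r // nnegrE.
- apply: continuous_cvg; first exact: kc.
  rewrite -[X in _ --> X]addr0; apply: cvgD => //; exact: cvg_cst.
- rewrite -[X in _ --> X]addr0; apply: cvgD.
    apply: continuous_cvg; first exact: kc.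
    rewrite -[X in _ --> X]subr0; apply: cvgB => //; exact: cvg_cst.
  rewrite -(mul0r (k e)) -(mulr0 (x ^+ 2)).
  by apply: cvgM; [apply: cvgM => //; exact: cvg_cst|exact: cvg_cst].
Unshelve. all: by end_near. Qed.

End completely_monotone_approximation.

Lemma measurable_expRM {R : realType} (l : R) : measurable_fun setT (fun x => expR (- (l * x)) : R).
Proof.
by apply: measurableT_comp => //; apply: measurableT_comp => //; exact: measurable_funM.
Qed.

(** * Frullani's integral *)

Section frullani.
Context {R : realType}.
Notation mu := (@lebesgue_measure R).

Lemma integral_derive (f F : R -> R) (a b : R) : a < b ->
  (forall x, a <= x <= b -> is_derive x 1 F (f x)) ->
  (forall x, a <= x <= b -> {for x, continuous f}) ->
  (\int[mu]_(x in `[a, b]) (f x)%:E = (F b)%:E - (F a)%:E)%E.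
Proof.
move=> ab dF cf.
have cF x : a <= x <= b -> {for x, continuous F}.
  move=> /dF dFx; apply/differentiable_continuous/derivable1_diffP.
  exact: ex_derive.
apply: continuous_FTC2 => //.
- by apply: continuous_in_subspaceT => x; rewrite inE /= in_itv; exact: cf.
- split.
  + move=> x; rewrite in_itv /= => /andP[/ltW ax /ltW xb].
    have := dF x; rewrite ax xb => /(_ isT) ?; exact: ex_derive.
  + by apply: cvg_at_right_filter; apply: cF; rewrite lexx ltW.
  + by apply: cvg_at_left_filter; apply: cF; rewrite lexx ltW.
- move=> x; rewrite in_itv /= => /andP[/ltW ax /ltW xb].
  have := dF x; rewrite ax xb derive1E => /(_ isT) ?; exact: derive_val.
Qed.

Lemma integral_expRN (c : R) : 0 < c ->
  (\int[mu]_(x in `]0%R, +oo[) (expR (- (c * x)))%:E = (c^-1)%:E)%E.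
Proof.
move=> c0; have mE := @measurable_expRM R c.
rewrite integral_itv_obnd_cbnd; last first.
  by apply/measurable_EFinP; apply: measurable_funTS.
have := integral_exponential_pdf c0.
rewrite /exponential_pdf -[X in X = _ -> _]/(\int[_]_x (EFin \o _) x)%E -restrict_EFin.
rewrite -integral_mkcond => E1.
have : (c%:E * \int[mu]_(x in `[0%R, +oo[) (expR (- (c * x)))%:E = 1)%E.
  have mE' : measurable_fun (`[0%R, +oo[ : set R) (fun x => (expR (- (c * x)))%:E).
    by apply/measurable_EFinP; apply: measurable_funTS.
  rewrite -E1 -ge0_integralZl_EFin ?(ltW c0) //.
  by apply: eq_integral => x _; rewrite /= -EFinM mulNr.
move=> E2; rewrite -[LHS]mul1e -(@mulVf _ c) ?gt_eqF // EFinM -muleA E2.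
by rewrite mule1.
Qed.

(* Frullani's integral, by Tonelli applied to [exp (- (b + v) x)] on [0 <= v <= l]. *)
Lemma frullani_exp (b l : R) : 0 < b -> 0 <= l ->
  (\int[mu]_(x in `]0%R, +oo[) ((1 - expR (- (l * x))) * expR (- (b * x)) / x)%:E
    = (ln (1 + l / b))%:E)%E.
Proof.
move=> b0; rewrite le_eqVlt => /predU1P[<-|l0].
  rewrite mul0r addr0 ln1; apply: integral0_eq => x _.
  by rewrite mul0r oppr0 expR0 subrr !mul0r.
pose D := `]0%R, +oo[%classic : set R; pose E := `[0%R, l]%classic : set R.
pose g (z : R * R) := expR (- ((b + z.2) * z.1)).
pose f := (EFin \o g) \_ (D `*` E).
have mDE : measurable (D `*` E) by apply: measurableX; exact: measurable_itv.
have mg : measurable_fun setT g.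
  apply: measurableT_comp => //; apply: measurableT_comp => //.
  apply: measurable_funM => //; exact: measurable_funD.
have mf : measurable_fun setT f.
  apply/(measurable_restrictT _ mDE)/measurable_EFinP; exact: measurable_funTS.
have f0 z : (0 <= f z)%E.
  by apply: erestrict_ge0 => ? _; rewrite lee_fin expR_ge0.
have fE x v : f (x, v) = if x \in D then ((fun v => (g (x, v))%:E) \_ E) v else 0%E.
  by rewrite /f !patchE in_setX /=; case: (x \in D).
have fE' x v : f (x, v) = if v \in E then ((fun x => (g (x, v))%:E) \_ D) x else 0%E.
  by rewrite /f !patchE in_setX /= andbC; case: (v \in E).
have := fubini_tonelli (m1 := mu) (m2 := mu) f mf f0.
have -> : (\int[mu]_x \int[mu]_y f (x, y))%E =
    (\int[mu]_(x in D) ((1 - expR (- (l * x))) * expR (- (b * x)) / x)%:E)%E.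
  rewrite [RHS]integral_mkcond; apply: eq_integral => x _.
  under eq_integral do rewrite fE.
  rewrite patchE; case: ifPn => xD; last by rewrite integral0.
  rewrite -integral_mkcond.
  have x0 : 0 < x by move: xD; rewrite inE /D /= in_itv /= andbT.
  pose F v := - (expR (- ((b + v) * x)) / x).
  have dF v : 0 <= v <= l -> is_derive v 1 F (expR (- ((b + v) * x))).
    move=> _; apply: is_derive_eq.
    rewrite scaler0 !add0r /GRing.scale /=; field; exact: lt0r_neq0.
  have cg v : 0 <= v <= l -> {for v, continuous (fun v => expR (- ((b + v) * x)))}.
    move=> _; apply: continuous_comp; last exact: continuous_expR.
    apply: continuousN; apply: continuousM; last exact: cst_continuous.
    by apply: continuousD; [exact: cst_continuous|exact: cvg_id].
  rewrite /g /= (integral_derive l0 dF cg) /F -EFinB addr0; congr (_%:E).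
  by rewrite mulrDl opprD expRD; field; exact: lt0r_neq0.
move=> ->.
have -> : (\int[mu]_y \int[mu]_x f (x, y))%E = (\int[mu]_(v in E) ((b + v)^-1)%:E)%E.
  rewrite [RHS]integral_mkcond; apply: eq_integral => v _.
  under eq_integral do rewrite fE'.
  rewrite patchE; case: ifPn => vE; last by rewrite integral0.
  rewrite -integral_mkcond /g /= integral_expRN //.
  move: vE; rewrite inE /E /= in_itv /= => /andP[v0 _].
  by rewrite ltr_wpDr.
have bv v : 0 <= v <= l -> 0 < b + v by case/andP=> v0 _; rewrite ltr_wpDr.
have dF v : 0 <= v <= l -> is_derive v 1 (fun v => ln (b + v)) (b + v)^-1.
  move=> /bv v0; have := @is_derive1_comp _ (@ln R) (fun v => b + v) v _ _ (is_derive1_ln v0).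
  have dv : is_derive v 1 (fun v => b + v) 1 by rewrite -[X in is_derive _ _ _ X]add0r; apply: is_deriveD.
  by move=> /(_ _ dv); rewrite mulr1.
have cg v : 0 <= v <= l -> {for v, continuous (fun v => (b + v)^-1)}.
  move=> /bv v0; apply: cvgV; first exact: lt0r_neq0.
  by apply: continuousD; [exact: cst_continuous|exact: cvg_id].
rewrite (integral_derive l0 dF cg) -EFinB addr0.
rewrite -ln_div ?posrE ?addr_gt0 //; congr (ln _)%:E.
by field; exact: lt0r_neq0.
Qed.

End frullani.

(** * From the exponent of a GGC to limits of gamma transforms *)

Section ggc.
Context {R : realType}.
Notation mu := (@lebesgue_measure R).
Notation pos := (`]0%R, +oo[%classic : set R).
Implicit Types (k K : R -> R) (l x : R).

Definition levy_integrand k l x := (1 - expR (- (l * x))) * k x / x.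

Definition levy_exponent k l := (\int[mu]_(x in pos) (levy_integrand k l x)%:E)%E.

Lemma levy_kernel_ge0 l x : 0 <= l -> 0 <= x -> 0 <= 1 - expR (- (l * x)).
Proof. by move=> l0 x0; rewrite subr_ge0 expR_le1 oppr_le0 mulr_ge0. Qed.

Lemma levy_integrand_ge0 k l x : 0 <= l -> 0 < x -> 0 <= k x ->
  0 <= levy_integrand k l x.
Proof.
by move=> l0 x0 kx; rewrite divr_ge0 ?mulr_ge0 ?levy_kernel_ge0 // ltW.
Qed.

Let posE x : pos x = (0 < x) :> Prop.
Proof. by rewrite /= in_itv /= andbT. Qed.

Lemma measurable_inv_pos : measurable_fun pos (fun x : R => x^-1).
Proof.
apply: open_continuous_measurable_fun; first exact: interval_open.
by move=> x; rewrite inE posE => x0; apply: inv_continuous; exact: lt0r_neq0.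
Qed.

Lemma measurable_levy_integrand k l : measurable_fun pos k ->
  measurable_fun pos (levy_integrand k l).
Proof.
move=> mk; apply: measurable_funM; last exact: measurable_inv_pos.
apply: measurable_funM => //; apply: measurable_funTS; apply: measurable_funB => //.
exact: measurable_expRM.
Qed.

Lemma levy_exponent_ge0 k l : (forall x, 0 < x -> 0 <= k x) -> 0 <= l ->
  (0 <= levy_exponent k l)%E.
Proof.
move=> k0 l0; apply: integral_ge0 => x; rewrite posE => x0.
by rewrite lee_fin levy_integrand_ge0 // k0.
Qed.

Lemma levy_exponent_cvg (F : nat -> R -> R) k K l : 0 <= l ->
  (forall n, measurable_fun pos (F n)) -> measurable_fun pos K ->
  (forall n x, 0 < x -> 0 <= F n x <= K x) ->
  (forall x, 0 < x -> F n x @[n --> \oo] --> k x) ->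
  (levy_exponent K l < +oo)%E ->
  levy_exponent (F n) l @[n --> \oo] --> levy_exponent k l /\
  (levy_exponent k l < +oo)%E.
Proof.
move=> l0 mF mK FK Fk Kl.
have F0 n x : 0 < x -> 0 <= F n x by move=> /(FK n)/andP[].
have K0 x : 0 < x -> 0 <= K x.
  by move=> /(FK 0%N)/andP[? ?]; apply: (@le_trans _ _ (F 0%N x)).
have k0 x : 0 < x -> 0 <= k x.
  move=> x0; rewrite -(cvg_lim _ (Fk x x0)) //; apply: limr_ge.
    by apply/cvg_ex; exists (k x); exact: Fk.
  by apply: nearW => n; exact: F0.
have mk : measurable_fun pos k.
  apply: (measurable_fun_cvg (h := F)) => // x; rewrite posE; exact: Fk.
have FKl n x : 0 < x -> levy_integrand (F n) l x <= levy_integrand K l x.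
  move=> x0; have /andP[_ FKx] := FK n x x0.
  by rewrite ler_pM2r ?invr_gt0 // ler_wpM2l // levy_kernel_ge0 // ltW.
have cvgl : forall x,  0 < x -> levy_integrand (F n) l x @[n --> \oo] --> levy_integrand k l x.
  move=> x x0; apply: cvgM; last exact: cvg_cst.
  by apply: cvgM; [exact: cvg_cst|exact: Fk].
have iK : mu.-integrable pos (EFin \o levy_integrand K l).
  apply/integrableP; split.
    by apply/measurable_EFinP; exact: measurable_levy_integrand.
  rewrite [X in (X < _)%E](_ : _ = levy_exponent K l) //; apply: eq_integral => x.
  by rewrite inE posE => x0; rewrite /= ger0_norm // levy_integrand_ge0 // K0.
split.
  apply: (@dominated_cvg _ _ _ mu pos _ (fun n => EFin \o levy_integrand (F n) l) _
    (EFin \o levy_integrand K l)) => //.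
  - by move=> n; apply/measurable_EFinP; exact: measurable_levy_integrand.
  - by move=> x; rewrite posE => x0; apply: cvg_EFin; [exact: nearW|exact: cvgl].
  - move=> n x; rewrite posE => x0 /=.
    by rewrite ger0_norm ?levy_integrand_ge0 ?F0 // lee_fin FKl.
apply: le_lt_trans Kl; apply: ge0_le_integral => //.
- by move=> x; rewrite posE => x0; rewrite lee_fin; apply: levy_integrand_ge0 => //; exact: k0.
- by apply/measurable_EFinP; exact: measurable_levy_integrand.
- by apply/measurable_EFinP; exact: measurable_levy_integrand.
- move=> x; rewrite posE => x0; rewrite lee_fin -(cvg_lim _ (cvgl x x0)) //.
  apply: limr_le; first by apply/cvg_ex; exists (levy_integrand k l x); exact: cvgl.
  by apply: nearW => n; exact: FKl.
Qed.

Lemma levy_exponent_fineK k l : (forall x, 0 < x -> 0 <= k x) -> 0 <= l ->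
  (levy_exponent k l < +oo)%E -> (fine (levy_exponent k l))%:E = levy_exponent k l.
Proof.
by move=> k0 l0 kl; rewrite fineK // ge0_fin_numE // levy_exponent_ge0.
Qed.

Lemma gamma_closure_levy_lim (F : nat -> R -> R) k K :
  (forall n, measurable_fun pos (F n)) -> measurable_fun pos K ->
  (forall n x, 0 < x -> 0 <= F n x <= K x) ->
  (forall x, 0 < x -> F n x @[n --> \oo] --> k x) ->
  (forall l, 0 <= l -> (levy_exponent K l < +oo)%E) ->
  (forall n, gamma_closure (fun l => expR (- fine (levy_exponent (F n) l)))) ->
  gamma_closure (fun l => expR (- fine (levy_exponent k l))).
Proof.
move=> mF mK FK Fk Kl GF; apply: (gamma_lim GF) => l l0; last exact: expR_gt0.
have [cJ kl] := levy_exponent_cvg l0 mF mK FK Fk (Kl l l0).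
apply: continuous_cvg; first exact: continuous_expR.
apply: cvgN; apply: fine_cvg; rewrite levy_exponent_fineK // => x x0.
rewrite -(cvg_lim _ (Fk x x0)) //; apply: limr_ge.
  by apply/cvg_ex; exists (k x); exact: Fk.
by apply: nearW => n; have /andP[] := FK n x x0.
Qed.

Lemma measurable_expRN (b : R) : measurable_fun pos (fun x => expR (- (b * x))).
Proof. by apply: measurable_funTS; exact: measurable_expRM. Qed.

(** Each exponential contributes one Frullani integral, the exponent of a gamma law of shape [p j]
    and rate [b j]: the pairs are the atoms of the Thorin measure. *)
Lemma levy_exponent_exp_sum (J : Type) (r : seq J) (p b : J -> R) l :
  (forall j, 0 <= p j) -> (forall j, 0 < b j) -> 0 <= l ->
  levy_exponent (fun x => \sum_(j <- r) p j * expR (- (b j * x))) l =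
  (\sum_(j <- r) p j * ln (1 + l / b j))%:E.
Proof.
move=> p0 b0 l0.
have g0 j x : 0 < x -> 0 <= levy_integrand (fun x => expR (- (b j * x))) l x.
  by move=> x0; apply: levy_integrand_ge0; rewrite ?expR_ge0.
transitivity (\sum_(j <- r) (\int[mu]_(x in pos)
    ((p j)%:E * (levy_integrand (fun x => expR (- (b j * x))) l x)%:E)))%E.
  rewrite -ge0_integral_sum //.
  - apply: eq_integral => x _; rewrite /levy_integrand.
    under [RHS]eq_bigr do rewrite -EFinM.
    rewrite sumEFin mulr_sumr mulr_suml; congr (_%:E).
    by apply: eq_bigr => j _; ring.
  - move=> j; apply: measurable_funeM; apply/measurable_EFinP.
    by apply: measurable_levy_integrand; exact: measurable_expRN.
  - move=> j x; rewrite posE => x0; apply: mule_ge0; rewrite lee_fin //; exact: g0.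
rewrite -sumEFin; apply: eq_bigr => j _.
rewrite ge0_integralZl_EFin //; last first.
- apply/measurable_EFinP; apply: measurable_levy_integrand; exact: measurable_expRN.
- move=> x; rewrite posE => x0; rewrite lee_fin; exact: g0.
by rewrite EFinM -frullani_exp.
Qed.

Lemma gamma_closure_exp_sum (J : Type) (r : seq J) (p b : J -> R) :
  (forall j, 0 <= p j) -> (forall j, 0 < b j) ->
  gamma_closure (fun l => expR (- fine
    (levy_exponent (fun x => \sum_(j <- r) p j * expR (- (b j * x))) l))).
Proof.
move=> p0 b0.
have G j : gamma_closure (fun l => (1 + (b j)^-1 * l)^-1 `^ p j).
  by apply: gamma_base => //; rewrite invr_ge0 ltW.
apply: (gamma_closure_ext (gamma_closure_prod r G)) => l l0.
rewrite levy_exponent_exp_sum //= -sumrN expR_sum; apply: eq_bigr => j _.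
have d0 : 0 < 1 + (b j)^-1 * l by rewrite ltr_wpDr // mulr_ge0 // invr_ge0 ltW.
by rewrite /powR invr_eq0 gt_eqF // lnV ?posrE // mulrN mulrC [l / _]mulrC mulrC.
Qed.

(** The point mass at [a] is the limit of the gamma laws of shape [n] and scale [a / n], whose mean
    is [a]. *)
Lemma gamma_closure_drift (a : R) : 0 <= a ->
  gamma_closure (fun l => expR (- (a * l))).
Proof.
move=> a0.
apply: (@gamma_lim _ (fun n l => (1 + a / n.+1%:R * l)^-1 `^ n.+1%:R)).
- by move=> n; apply: gamma_base => //; rewrite divr_ge0.
- move=> l l0.
  have d0 n : 0 < 1 + a / n.+1%:R * l.
    by rewrite ltr_wpDr // mulr_ge0 // divr_ge0.
  have ln_le y : 0 < y -> ln y <= y - 1 :> R.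
    by move=> y0; have := expR_ge1Dx (ln y); rewrite lnK ?posrE // lerBrDl.
  have E n : (1 + a / n.+1%:R * l)^-1 `^ n.+1%:R =
      expR (- (n.+1%:R * ln (1 + a / n.+1%:R * l))).
    by rewrite /powR invr_eq0 gt_eqF // lnV ?posrE // mulrN.
  under eq_fun do rewrite E.
  apply: continuous_cvg; first exact: continuous_expR.
  apply: cvgN.
  apply: (@squeeze_cvgr _ _ _ _ (fun n => a * l / (1 + n.+1%:R^-1 * (a * l)))
    (fun=> a * l)).
  + near=> n.
    have x0 := d0 n; have h := ln_le _ x0.
    have := ln_le _ (eq_ind_r (fun b => is_true b) x0 (invr_gt0 _)).
    rewrite lnV ?posrE // => h'.
    apply/andP; split.
      rewrite -ler_pdivrMl //; apply: le_trans (_ : 1 - (1 + a / n.+1%:R * l)^-1 <= _).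
        rewrite le_eqVlt; apply/orP; left; apply/eqP.
        have x0' : 1 + n.+1%:R^-1 * (a * l) != 0.
          by apply: lt0r_neq0; move: x0; congr (0 < _); ring.
        have -> : 1 + a / n.+1%:R * l = 1 + n.+1%:R^-1 * (a * l) by ring.
        by rewrite mulrA; move: x0'; move: (_^-1 * (a * l)) => y y1; field.
      by rewrite -lerN2 opprB.
    rewrite -ler_pdivlMl //; apply: (le_trans h).
    by rewrite addrAC subrr add0r le_eqVlt; apply/orP; left; apply/eqP; ring.
  + rewrite -[X in _ --> X]divr1; apply: cvgM; first exact: cvg_cst.
    apply: cvgV; first by [].
    rewrite -[X in _ --> X]addr0; apply: cvgD; first exact: cvg_cst.
    rewrite -[X in _ --> X](mul0r (a * l)); apply: cvgM; last exact: cvg_cst.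
    exact: cvg_harmonic.
  + exact: cvg_cst.
- by move=> l _; exact: expR_gt0.
Unshelve. all: by end_near. Qed.

Lemma GGC_gamma_closure (m : probability R R) : GGC m ->
  gamma_closure (fun l => fine (laplace m l)).
Proof.
case=> m0 [a [k [a0 [k0 K] kfin lapE]]].
have kc x : 0 < x -> {for x, continuous k}.
  by move=> x0; exact: completely_monotone_continuous.
have mk : measurable_fun pos k.
  apply: open_continuous_measurable_fun; first exact: interval_open.
  by move=> x; rewrite inE posE; exact: kc.
have kl l : 0 <= l -> (levy_exponent k l < +oo)%E.
  move=> l0.
  have mmin : measurable_fun pos (fun x => Num.min 1 x * k x / x).
    apply: measurable_funM; last exact: measurable_inv_pos.
    apply: measurable_funM => //; apply: measurable_funTS.
    exact: measurable_minr.
  (* Being at most 1 and at most [l x], the factor [1 - exp (- l x)] is at most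
     [(1 + l) min (1, x)]. *)
  apply: (@le_lt_trans _ _ ((1 + l)%:E * \int[mu]_(x in pos)
      (Num.min 1 x * k x / x)%:E)%E); last first.
    by rewrite lte_mul_pinfty // lee_fin addr_ge0.
  have min0 x : 0 < x -> 0 <= Num.min 1 x by move=> /ltW x0; rewrite le_min ler01.
  rewrite -ge0_integralZl_EFin ?addr_ge0 //; last 2 first.
  - move=> x; rewrite posE => x0; rewrite lee_fin divr_ge0 ?(ltW x0) //.
    by rewrite mulr_ge0 ?min0 ?k0.
  - exact/measurable_EFinP.
  apply: ge0_le_integral => //.
  - move=> x; rewrite posE => x0; rewrite lee_fin; apply: levy_integrand_ge0 => //.
    exact: k0.
  - by apply/measurable_EFinP; exact: measurable_levy_integrand.
  - by apply: measurable_funeM; exact/measurable_EFinP.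
  - move=> x; rewrite posE => x0; rewrite -EFinM lee_fin !mulrA.
    rewrite ler_pM2r ?invr_gt0 // ler_wpM2r ?k0 //.
    have e1 : 1 - expR (- (l * x)) <= 1 by rewrite gerBl expR_ge0.
    have e2 : 1 - expR (- (l * x)) <= l * x.
      by rewrite lerBlDr -lerBlDl; exact: expR_ge1Dx.
    have [x1|x1] := leP 1 x; first by rewrite mulr1 (le_trans e1) // lerDl.
    by rewrite (le_trans e2) // ler_pM2r // lerDr.
have JE l : 0 <= l -> laplace m l = (expR (- (a * l)) * expR (- fine (levy_exponent k l)))%:E.
  move=> l0; rewrite lapE // -[X in (_ - X)%E](levy_exponent_fineK k0 l0 (kl l l0)).
  by rewrite -EFinN -EFinD /= expRD.
suff G : gamma_closure (fun l => expR (- fine (levy_exponent k l))).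
  apply: (gamma_closure_ext (gamma_mul (gamma_closure_drift a0) G)) => l l0.
  by rewrite JE.
(* Two regularisations, [exp (- e x) k (e + x)]: the shift makes the approximating sums bounded by
   [k e], and the exponential factor makes their rates positive, as Frullani's integral requires.
   The inner limit is dominated by [k e exp (- e x)], the outer one by [k]. *)
pose e n : R := n.+1%:R^-1.
have e0 n : 0 < e n by rewrite invr_gt0.
have ke n x : 0 < x -> 0 <= k (e n + x) <= k x.
  move=> x0; rewrite k0 ?addr_gt0 //=.
  by apply: completely_monotone_nincr => //; rewrite lerDr ltW.
have mke n : measurable_fun pos (fun x => k (e n + x)).
  apply: open_continuous_measurable_fun; first exact: interval_open.
  move=> x; rewrite inE posE => x0; apply: continuous_comp.
    by apply: continuousD; [exact: cst_continuous|exact: cvg_id].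
  by apply: kc; rewrite addr_gt0.
have ex1 n x : 0 < x -> 0 < expR (- (e n * x)) <= 1.
  by move=> /ltW x0; rewrite expR_gt0 expR_le1 oppr_le0 mulr_ge0 // ltW.
have ecvg : e n @[n --> \oo] --> 0 by exact: cvg_harmonic.
apply: (@gamma_closure_levy_lim (fun n x => expR (- (e n * x)) * k (e n + x)) k k) => //.
- by move=> n; apply: measurable_funM => //; exact: measurable_expRN.
- move=> n x x0; have /andP[? ?] := ke n x x0; have /andP[/ltW ? ?] := ex1 n x x0.
  by rewrite mulr_ge0 //= (le_trans _ (_ : k (e n + x) <= _)) // ler_piMl.
- move=> x x0; rewrite -[X in _ --> X]mul1r; apply: cvgM.
    rewrite -expR0; apply: continuous_cvg; first exact: continuous_expR.
    rewrite -oppr0; apply: cvgN; rewrite -[X in _ --> X](mul0r x).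
    by apply: cvgM => //; exact: cvg_cst.
  apply: continuous_cvg; first exact: kc.
  by rewrite -[X in _ --> X]add0r; apply: cvgD => //; exact: cvg_cst.
move=> n; have [N [p [b /= [p0 b0 Ele Ecvg]]]] :=
  completely_monotone_exp_approx K (e0 n).
pose E i x := \sum_(0 <= j < N i) p i j * expR (- ((b i j + e n) * x)).
have EE i x : E i x = expR (- (e n * x)) * \sum_(0 <= j < N i) p i j * expR (- (b i j * x)).
  rewrite mulr_sumr; apply: eq_bigr => j _.
  by rewrite mulrDl opprD expRD; ring.
have be i j : 0 < b i j + e n by rewrite ltr_wpDl.
apply: (@gamma_closure_levy_lim E _ (fun x => k (e n) * expR (- (e n * x)))).
- move=> i; apply: measurable_sum => j; apply: measurable_funM => //.
  exact: measurable_expRN.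
- by apply: measurable_funM => //; exact: measurable_expRN.
- move=> i x x0; rewrite EE mulrC; have /andP[/ltW ? ?] := ex1 n x x0.
  rewrite mulr_ge0 //=; last by apply: sumr_ge0 => j _; rewrite mulr_ge0 ?expR_ge0.
  by rewrite ler_wpM2r // Ele.
- move=> x x0; under eq_fun do rewrite EE.
  by apply: cvgM; [exact: cvg_cst|exact: Ecvg].
- move=> l l0.
  have := @levy_exponent_exp_sum unit [:: tt] (fun=> k (e n)) (fun=> e n) l.
  move=> /(_ (fun=> k0 _ (e0 n)) (fun=> e0 n) l0).
  rewrite (_ : (fun x => _) = (fun x => k (e n) * expR (- (e n * x)))); last first.
    by apply/funext => x; rewrite big_seq1.
  by move=> ->; rewrite ltry.
- by move=> i; apply: gamma_closure_exp_sum.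
Qed.

End ggc.

(** * Compactness and uniqueness for probabilities on the line *)

Lemma exists_mfun d d' (T : measurableType d) (T' : measurableType d')
    (f : T -> T') : measurable_fun setT f ->
  exists X : {mfun T >-> T'}, forall t, X t = f t.
Proof. by move=> mf; exists (mfun_Sub (mem_set mf)). Qed.

Section quantile.
Context {R : realType}.
Implicit Types (P Q : probability R R) (x y u : R).

Lemma eq_probability_rays P Q :
  (forall x, P `]x, +oo[%classic = Q `]x, +oo[%classic) -> eq_law P Q.
Proof.
move=> PQ A mA.
apply: (@measure_unique _ R _ (@RGenOInfty.G R)
  (fun k => `](- k%:R)%R, +oo[%classic) _ _ _ _ P Q) => //.
- exact: RGenOInfty.measurableE.
- move=> _ _ [x ->] [y ->]; exists (Num.max x y).
  apply/seteqP; split => z /=; rewrite !in_itv /= !andbT gt_max.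
    by case=> -> ->.
  by case/andP.
- by move=> k; exists (- k%:R).
- rewrite -subTset => x _; exists (Num.truncn `|x|).+1 => //=.
  rewrite in_itv /= andbT ltrNl; apply: (@le_lt_trans _ _ `|x|).
    by rewrite -normrN ler_norm.
  have /truncn_itv/andP[_ //] := normr_ge0 x.
- by move=> _ [x ->]; exact: PQ.
- by move=> k; rewrite -ge0_fin_numE // fin_num_measure.
Qed.

Notation U := (uniform_prob (@ltr01 R)).

Lemma uniform_ray (y : R) : 0 <= y <= 1 -> (U `]y, +oo[%classic = (1 - y)%:E)%E.
Proof.
move=> /andP[y0 y1].
have mray : measurable (`]y, +oo[%classic : set R) by exact: measurable_itv.
rewrite -[X in U X]setIT -integral_indic //.
rewrite integral_uniform; [|by apply/measurable_EFinP|by move=> x; rewrite lee_fin].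
rewrite subr0 invr1 mul1e integral_indic //.
rewrite (_ : _ `&` _ = `]y, 1]%classic); last first.
  apply/seteqP; split => z /=; rewrite !in_itv /= ?andbT.
    by move=> [-> /andP[_ ->]].
  by move=> /andP[yz ->]; rewrite yz (ltW (le_lt_trans y0 yz)).
have E := lebesgue_measure_itv `]y, 1]%R; apply: (etrans E); rewrite /= lte_fin.
by move: y1; rewrite le_eqVlt => /predU1P[->|->]; rewrite ?ltxx ?subrr ?EFinB.
Qed.

Variable rho : probability R R.
Hypothesis rho01 : rho `[0, 1]%classic = 1%E.

Let F x := fine (rho `]-oo, x]%classic).

Let rhoF x : rho `]-oo, x]%classic = (F x)%:E.
Proof. by rewrite fineK // fin_num_measure. Qed.

Let Fnd : {homo F : x y / x <= y}.
Proof.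
move=> x y xy; rewrite -lee_fin -!rhoF le_measure ?inE //.
exact: subset_itvl.
Qed.

Let F1 x : 1 <= x -> F x = 1.
Proof.
move=> x1; apply: EFin_inj; rewrite -rhoF; apply/eqP; rewrite eq_le probability_le1 //=.
rewrite -rho01 le_measure ?inE // => z; rewrite /= !in_itv /= => /andP[_ z1].
exact: le_trans x1.
Qed.

Let F0 x : x < 0 -> F x = 0.
Proof.
move=> x0; apply: EFin_inj; rewrite -rhoF; apply/eqP; rewrite eq_le measure_ge0 andbT.
apply: (@le_trans _ _ (rho (~` `[0, 1]%classic))); last first.
  by rewrite probability_setC // rho01 subee.
rewrite le_measure ?inE //; first exact: measurableC.
move=> z; rewrite /= !in_itv /= => zx /andP[z0 _].
by move: (lt_le_trans (le_lt_trans zx x0) z0); rewrite ltxx.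
Qed.

Let F01 x : 0 <= F x <= 1.
Proof. by rewrite -!lee_fin -rhoF measure_ge0 probability_le1. Qed.

Let Frc x u : (forall y, x < y -> u <= F y) -> u <= F x.
Proof.
move=> uF.
have [idR idE] := exists_mfun (@measurable_id _ R setT).
have idF y : cdf (idR : {RV rho >-> R}) y = (F y)%:E.
  by rewrite /cdf /distribution /pushforward -rhoF; congr (rho _); apply/seteqP; split => z /=; rewrite idE.
have := @cdf_right_continuous _ _ _ rho idR x.
rewrite (_ : cdf idR = fun y => (F y)%:E); last by apply/funext => y; exact: idF.
move=> /fine_cvg cF.
rewrite -(cvg_lim _ cF) //; apply: limr_ge; first by apply/cvg_ex; exists (F x).
near=> y; apply: uF; near: y; exact: nbhs_right_gt.
Unshelve. all: by end_near. Qed.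

Let S u := [set x | 0 <= x <= 1 /\ (u <= F x \/ x = 1)].

(** Quantiles realise all laws on [0, 1] on one space, the unit interval with its uniform law, so
    that weak convergence becomes pointwise convergence. [S u] contains 1 for every [u], so the
    infimum makes sense even for [u > 1]. *)
Definition quantile u := inf (S u).

Let S1 u : S u 1. Proof. by split; [rewrite ler01 lexx|right]. Qed.

Let Sinf u : has_inf (S u).
Proof. by split; [exists 1|exists 0 => x [/andP[]]]. Qed.

Lemma quantile01 u : 0 <= quantile u <= 1.
Proof.
apply/andP; split; last by apply: ge_inf; [exact: (Sinf u).2|exact: S1].
by apply: lb_le_inf; [exact: (Sinf u).1|move=> x [/andP[]]].
Qed.

Lemma quantile_nd : {homo quantile : u v / u <= v}.
Proof.
move=> u v uv; apply: lb_le_inf; first exact: (Sinf v).1.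
move=> x [x01 vx]; apply: ge_inf; first exact: (Sinf u).2.
split=> //; case: vx => [vx|->]; [left|by right].
exact: le_trans vx.
Qed.

(** The Galois connection between quantiles and the distribution function; one direction is right
    continuity of the latter. *)
Lemma quantile_le u x : 0 <= x < 1 -> (quantile u <= x) = (u <= F x).
Proof.
case/andP=> x0 x1; apply/idP/idP => [qx|ux].
  apply: Frc => y xy.
  have qy : inf (S u) < Num.min y 1 by rewrite (le_lt_trans qx) // lt_min xy.
  have [z [z01 uz]] := inf_lt (Sinf u).1 qy; rewrite lt_min => /andP[zy z1].
  case: uz => [uz|z1']; first by rewrite (le_trans uz) // Fnd // ltW.
  by rewrite z1' ltxx in z1.
by apply: ge_inf; [exact: (Sinf u).2|split; [rewrite x0 ltW|left]].
Qed.

Lemma measurable_quantile : measurable_fun setT quantile.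
Proof. by apply: nondecreasing_measurable => // u v *; apply: quantile_nd. Qed.

Lemma quantile_law (X : {RV U >-> R}) : (forall u, X u = quantile u) ->
  eq_law (distribution U X) rho.
Proof.
move=> XE; apply: eq_probability_rays => x.
have -> : rho `]x, +oo[%classic = (1 - F x)%:E.
  rewrite -setCitvl probability_setC; last exact: measurable_itv.
  by rewrite rhoF EFinB.
rewrite -[LHS]/(U (X @^-1` `]x, +oo[%classic)).
have [x0|x0] := ltP x 0.
  rewrite [X in _ X = _](_ : _ = setT) ?probability_setT ?F0 ?subr0 //.
  apply/seteqP; split => // u _; rewrite /= XE in_itv /= andbT.
  by have /andP[q0 _] := quantile01 u; exact: lt_le_trans q0.
have [x1|x1] := leP 1 x.
  rewrite [X in _ X = _](_ : _ = set0) ?measure0 ?F1 ?subrr //.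
  apply/seteqP; split => // u; rewrite /= XE in_itv /= andbT => xq.
  have /andP[_ q1] := quantile01 u.
  by move: (lt_le_trans xq (le_trans q1 x1)); rewrite ltxx.
rewrite -uniform_ray ?F01 //; congr (U _); apply/seteqP.
by split=> u; rewrite /= XE !in_itv /= !andbT !ltNge quantile_le // x0.
Qed.

Lemma integral_quantile (g : R -> R) : measurable_fun setT g -> (forall t, 0 <= g t) ->
  (\int[rho]_t (g t)%:E = \int[U]_u (g (quantile u))%:E)%E.
Proof.
move=> mg g0; have [X XE] := @exists_mfun _ _ (measurableTypeR R) R _ measurable_quantile.
rewrite (eq_measure_integral (distribution U X)); last first.
  by move=> A mA _; apply/esym; exact: (quantile_law XE mA).
rewrite ge0_integral_distribution.
- by apply: eq_integral => u _; rewrite /= XE.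
- exact/measurable_EFinP.
- by move=> t; rewrite lee_fin.
Qed.

End quantile.

Section helly.
Context {R : realType}.
Notation U := (uniform_prob (@ltr01 R)).

(* The limit [Q] is taken along an ultrafilter; the subsequence is then extracted so as
   to converge to [Q] at the rationals, hence at the continuity points of [Q]. *)
Lemma helly_selection (q : nat -> R -> R) :
  (forall n, {homo q n : x y / x <= y}) -> (forall n x, 0 <= q n x <= 1) ->
  exists (phi : nat -> nat) (Q : R -> R) (N : set R),
    [/\ forall j, (j <= phi j)%N, {homo Q : x y / x <= y},
        forall x, 0 <= Q x <= 1, countable N &
        forall x, x \in `]0, 1[%R -> ~ N x -> q (phi j) x @[j --> \oo] --> Q x].
Proof.
move=> qnd q01.
have [G [GU ooG]] := ultraFilterLemma (F := \oo%classic) _.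
have cpt : compact (`[0, 1]%classic : set R) by exact: segment_compact.
have /choice[Q QP] (x : R) : exists y : R, 0 <= y <= 1 /\ (q n x @[n --> G] --> y).
  have GP : ProperFilter G by exact: ultra_proper.
  have [y [y01 clq]] : `[0, 1]%classic `&` cluster (q ^~ x @ G) !=set0.
    apply: cpt; suff : G (q ^~ x @^-1` `[0, 1]%classic) by [].
    by apply: filterS filterT => n _; rewrite /= in_itv; exact: q01.
  exists y; split; first by move: y01; rewrite /= in_itv.
  move=> B yB; have [//|GnB] := in_ultra_setVsetC (q ^~ x @^-1` B) GU.
  by have [z []] := clq (~` B) B GnB yB.
have Q01 x : 0 <= Q x <= 1 by have [] := QP x.
have Qcvg x : q n x @[n --> G] --> Q x by have [] := QP x.
have Qnd : {homo Q : x y / x <= y}.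
  move=> x y xy; apply: (ler_cvg_to (Qcvg x) (Qcvg y)).
  by apply: filterE => n; exact: qnd.
pose r (i : nat) : R := ratr (odflt 0 (unpickle i)).
(* Sets of the ultrafilter are nonempty and stable under finite intersections, so one index beyond
   [j] serves the first [j + 1] rationals at once; this replaces a diagonal extraction. *)
have /choice[phi phiP] j : exists n, (j <= n)%N /\
    forall i, (i <= j)%N -> `|Q (r i) - q n (r i)| < j.+1%:R^-1.
  have GP : ProperFilter G by exact: ultra_proper.
  suff : \forall n \near G, (j <= n)%N /\
      forall i, (i <= j)%N -> `|Q (r i) - q n (r i)| < j.+1%:R^-1.
    by move=> /filter_ex[n]; exists n.
  apply: filterI; first by apply: ooG; exact: nbhs_infty_ge.
  have : \forall n \near G, forall i : 'I_j.+1, `|Q (r i) - q n (r i)| < j.+1%:R^-1.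
    apply: filter_forall => i.
    by have /cvgrPdist_lt/(_ _ _) := Qcvg (r i); apply.
  by apply: filterS => n H i; rewrite -ltnS => ij; exact: (H (Ordinal ij)).
have rcvg i : q (phi j) (r i) @[j --> \oo] --> Q (r i).
  apply/cvgrPdist_lt => e e0; near=> j.
  apply: (@lt_trans _ _ j.+1%:R^-1).
    by have [_ ] := phiP j; apply; near: j; exact: nbhs_infty_ge.
  near: j; have := @cvg_harmonic R => /cvgrPdist_lt /(_ _ e0).
  by apply: filterS => j; rewrite sub0r normrN ger0_norm // harmonic_ge0.
have rat_between x y : x < y -> exists i, x < r i < y.
  move=> xy; have [s /andP[xs sy]] := rat_in_itvoo xy.
  by exists (pickle s); rewrite /r pickleK; apply/andP.
exists phi, Q, [set x | x \in `]0, 1[%R /\ discontinuity Q x]; split => //.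
- by move=> j; have [] := phiP j.
- by apply: discontinuity_countable => x y _ _; exact: Qnd.
move=> x x01 /= Nx.
have cl : cvg (Q y @[y --> x^'-]).
  apply: nondecreasing_at_left_is_cvgr; near=> z; first by move=> s t _ _; exact: Qnd.
  by exists 1 => _ [s _ <-]; have /andP[] := Q01 s.
have cr : cvg (Q y @[y --> x^'+]).
  apply: nondecreasing_at_right_is_cvgr; near=> z; first by move=> s t _ _; exact: Qnd.
  by exists 0 => _ [s _ <-]; have /andP[] := Q01 s.
have lr : lim (Q y @[y --> x^'-]) = lim (Q y @[y --> x^'+]).
  by apply/eqP; apply: contra_notT Nx.
have lQ : lim (Q y @[y --> x^'-]) = Q x.
  apply/eqP; rewrite eq_le; apply/andP; split.
    by apply: limr_le => //; near=> y; apply: Qnd; near: y; exact: nbhs_left_le.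
  rewrite lr; apply: limr_ge => //; near=> y; apply: Qnd; near: y.
  exact: nbhs_right_ge.
apply/cvgrPdist_le => e e0.
have e20 : 0 < e / 2 by rewrite divr_gt0.
have [a [ax Qa]] : exists a, a < x /\ Q x - e / 2 < Q a.
  have H : \forall y \near x^'-, y < x /\ Q x - e / 2 < Q y.
    apply: filterI; first exact: nbhs_left_lt.
    have /cvgrPdist_lt/(_ _ e20) : Q y @[y --> x^'-] --> Q x by rewrite -lQ.
    by apply: filterS => y /ltr_distlBl.
  by have [a aP] := filter_ex H; exists a.
have [b [xb Qb]] : exists b, x < b /\ Q b < Q x + e / 2.
  have H : \forall y \near x^'+, x < y /\ Q y < Q x + e / 2.
    apply: filterI; first exact: nbhs_right_gt.
    have /cvgrPdist_lt/(_ _ e20) : Q y @[y --> x^'+] --> Q x by rewrite -lQ lr.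
    by apply: filterS => y /ltr_distlCDr; rewrite addrC.
  by have [b bP] := filter_ex H; exists b.
(* Convergence is known at rationals only; two of them around [x], where [Q] differs from [Q x] by
   less than [e / 2], squeeze the values at [x] by monotonicity. *)
have [i /andP[ai ix]] := rat_between _ _ ax.
have [k /andP[xk kb]] := rat_between _ _ xb.
near=> j.
have ji : `|Q (r i) - q (phi j) (r i)| < e / 2.
  by near: j; have /cvgrPdist_lt := rcvg i; apply.
have jk : `|Q (r k) - q (phi j) (r k)| < e / 2.
  by near: j; have /cvgrPdist_lt := rcvg k; apply.
have q1 := qnd (phi j) _ _ (ltW ix); have q2 := qnd (phi j) _ _ (ltW xk).
have Q1 := Qnd _ _ (ltW ai); have Q2 := Qnd _ _ (ltW kb).
move: ji jk; rewrite !ltr_norml => /andP[j1 j2] /andP[j3 j4].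
by rewrite ler_norml; apply/andP; split; lra.
Unshelve. all: by end_near. Qed.

End helly.

Lemma exists_probability d (T : measurableType d) (R : realType)
    (m : {measure set T -> \bar R}) (P : probability T R) : m setT = 1%E ->
  exists S : probability T R, forall A, S A = m A.
Proof.
move=> m1; exists (mnormalize m P) => A.
by rewrite /= /mnormalize m1 onee_eq0 /= invr1 mule1.
Qed.

Lemma mixture_probability d (T : measurableType d) (R : realType)
    (P Q : probability T R) (p : R) : 0 <= p <= 1 ->
  exists S : probability T R, forall f : T -> \bar R, measurable_fun setT f ->
    (forall t, 0 <= f t)%E ->
    (\int[S]_t f t = p%:E * \int[P]_t f t + (1 - p)%:E * \int[Q]_t f t)%E.
Proof.
move=> /andP[p0 p1]; have q0 : 0 <= 1 - p by rewrite subr_ge0.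
pose m : {measure set T -> \bar R} :=
  measure_add (mscale (NngNum p0) P) (mscale (NngNum q0) Q).
have m1 : m setT = 1%E.
  rewrite [LHS]measure_addE; transitivity (p%:E + (1 - p)%:E)%E.
    by congr (_ + _)%E; rewrite /= /mscale /= probability_setT mule1.
  by rewrite -EFinD subrKC.
have [S SE] := exists_probability P m1; exists S => f mf f0.
rewrite (eq_measure_integral m); last by move=> A mA _; exact: SE.
by rewrite ge0_integral_measure_add // !ge0_integral_mscale.
Qed.

Lemma ae_countable {R : realType} (N : set R) (G : R -> Prop) :
  countable N -> (forall x, ~ N x -> G x) ->
  {ae (@lebesgue_measure R), forall x, G x}.
Proof.
move=> cN NG; have mN : measurable N by apply: countable_measurable.
exists N; split => //; first exact: countable_lebesgue_measure0.
by move=> x /= nG; apply: contrapT => /NG.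
Qed.

Section hull_representation.
Context {R : realType} (I : Type) (D : set I) (kap : I -> R -> R).
Hypothesis kapc : forall i, continuous (kap i).
Hypothesis kap01 : forall i t, 0 <= kap i t <= 1.
Notation U := (uniform_prob (@ltr01 R)).
Notation mu := (@lebesgue_measure R).

Let kap0 i t : 0 <= kap i t.
Proof. by have /andP[] := kap01 i t. Qed.

Let mkap i : measurable_fun setT (kap i).
Proof. exact: continuous_measurable_fun. Qed.

Lemma integral_uniform_oo (g : R -> R) : measurable_fun setT g -> (forall t, 0 <= g t) ->
  (\int[U]_u (g u)%:E = \int[mu]_(u in `]0%R, 1%R[) (g u)%:E)%E.
Proof.
move=> mg g0; rewrite integral_uniform; last 2 first.
- exact/measurable_EFinP.
- by move=> u; rewrite lee_fin.
rewrite subr0 invr1 mul1e integral_itv_bndoo //.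
by apply/measurable_EFinP; exact: measurable_funTS.
Qed.

(** Induction on the hull: generators give Dirac masses, convex combinations give mixtures, and
    limits are handled by Helly selection on quantile functions with dominated convergence. No mass
    is lost since the parameter ranges over the compact [0, 1]. *)
Lemma hull_representation (f : I -> R) :
  hull D (fun g => exists2 t, 0 <= t <= 1 & g = kap ^~ t) f ->
  exists rho : probability R R, rho `[0, 1]%classic = 1%E /\
    forall i, D i -> (\int[rho]_t (kap i t)%:E = (f i)%:E)%E.
Proof.
have m01 : measurable (`[0, 1]%classic : set R) by exact: measurable_itv.
elim=> [{}f [t t01 ->]|p {}f g p01 _ [P [P01 PE]] _ [Q [Q01 QE]]|F {}f _ IH Ff].
- exists (dirac t); split; first by rewrite /= diracE mem_set // in_itv.
  move=> i _; rewrite integral_dirac //; last exact/measurable_EFinP.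
  by rewrite diracT mul1e.
- have [S SE] := mixture_probability P Q p01; exists S; split.
    have m1 : measurable_fun setT (fun x : R => (\1_(`[0, 1]%classic : set R) x : R)%:E).
      apply/measurable_EFinP; exact: measurable_indic.
    rewrite -[X in S X]setIT -integral_indic // SE //.
    rewrite !integral_indic // !setIT.
    transitivity (p%:E * 1 + (1 - p)%:E * 1)%E; first by congr (_ * _ + _ * _)%E.
    by rewrite !mule1 -EFinD subrKC.
  move=> i Di; rewrite SE ?PE ?QE //; last by move=> t; rewrite lee_fin.
  exact/measurable_EFinP.
have /choice[rho rhoP] := IH.
pose q n := quantile (rho n).
have q01 n x : 0 <= q n x <= 1 by exact: quantile01.
have qnd n : {homo q n : x y / x <= y} by exact: quantile_nd.
have [phi [Q [N [phij Qnd Q01 cN qQ]]]] := helly_selection qnd q01.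
have mQ : measurable_fun setT Q.
  by apply: nondecreasing_measurable => // u v *; apply: Qnd.
have mq n : measurable_fun setT (q n).
  by apply: nondecreasing_measurable => // u v *; apply: qnd.
have [X XE] := @exists_mfun _ _ (measurableTypeR R) R _ mQ.
exists (distribution U X); split.
  rewrite -[LHS]/(U (X @^-1` `[0, 1]%classic)).
  rewrite (_ : _ @^-1` _ = setT) ?probability_setT //.
  by apply/seteqP; split => // u _; rewrite /= XE in_itv /= Q01.
move=> i Di; rewrite ge0_integral_distribution; last 2 first.
- exact/measurable_EFinP.
- by move=> t; rewrite lee_fin.
transitivity (\int[U]_u (kap i (Q u))%:E)%E.
  by apply: eq_integral => u _; rewrite /= XE.
have mkQ : measurable_fun setT (fun u => kap i (Q u)) by exact: measurableT_comp.
rewrite integral_uniform_oo //.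
have fE n : (\int[mu]_(u in `]0%R, 1%R[) (kap i (q n u))%:E = (F n i)%:E)%E.
  rewrite -integral_uniform_oo //; last exact: measurableT_comp.
  by have [r01 <- //] := rhoP n; rewrite (integral_quantile r01).
have cF : (F (phi j) i)%:E @[j --> \oo] --> (f i)%:E.
  apply: cvg_EFin; first exact: nearW.
  apply: cvg_comp (Ff i Di) => A [m _ mA]; exists m => // j mj.
  by apply: mA => /=; exact: leq_trans (phij j).
apply: (cvg_unique _ _ cF) => //.
rewrite (_ : (fun j => _) = (fun j => \int[mu]_(u in `]0%R, 1%R[) (kap i (q (phi j) u))%:E)%E); last first.
  by apply/funext => j; rewrite fE.
have mD : measurable (`]0, 1[%classic : set R) by exact: measurable_itv.
have [] := @dominated_convergence _ _ _ mu _ mD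
  (fun j u => (kap i (q (phi j) u))%:E) (fun u => (kap i (Q u))%:E) (fun=> 1%E).
- by move=> j; apply/measurable_EFinP; apply: measurable_funTS; exact: (measurableT_comp (mkap i) (mq (phi j))).
- by apply/measurable_EFinP; exact: measurable_funTS.
- apply: (ae_countable cN) => u Nu u01; apply: cvg_EFin; first exact: nearW.
  by apply: continuous_cvg; [exact: kapc|exact: qQ].
- apply/integrableP; split; first exact: measurable_cst.
  rewrite (eq_integral (cst 1%E)) => [|u _]; last by rewrite /= normr1.
  rewrite integral_cst // mul1e.
  apply: (@le_lt_trans _ _ 1%E); last exact: ltry.
  have E := @lebesgue_measure_itv R `]0, 1[%R; rewrite le_eqVlt; apply/orP; left; apply/eqP.
  by apply: (etrans E); rewrite /= lte_fin ltr01 -EFinB subr0.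
- apply: aeW => u j _.
  by rewrite /= ger0_norm // lee_fin; have /andP[] := kap01 i (q (phi j) u).
by move=> _ _.
Qed.

End hull_representation.

Lemma max0_continuous {R : realType} : continuous (fun x : R => Num.max 0 x).
Proof.
by move=> x; apply: (continuous_max (f := fun=> 0) (g := id)); [exact: cst_continuous|exact: cvg_id].
Qed.

Section hull_random_variable.
Context {R : realType}.
Implicit Types (l t x : R).

(* [Z] maps [0, 1[ onto [0, oo[; the value [t = 1] is the point at infinity, where all
   kernels vanish, and it carries no mass because [f] tends to 1 at 0. *)
Let Z t : R := Num.max 0 t / (1 - t).

Let Z_cont t : t < 1 -> {for t, continuous Z}.
Proof.
move=> t1; apply: cvgM.
  exact: max0_continuous.
apply: cvgV; first by rewrite subr_eq0 gt_eqF.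
by apply: cvgB; [exact: cvg_cst|exact: cvg_id].
Qed.

Variable K : R -> R -> R.
Hypothesis Kc : forall l, 0 < l -> continuous (K l).
Hypothesis K0 : forall l x, 0 < l -> 0 <= K l x.
Hypothesis KS : forall l x, 0 < l -> 0 <= x -> K l x <= (1 + l * x)^-1.

Let Z0 t : t < 1 -> 0 <= Z t.
Proof. by move=> t1; rewrite divr_ge0 ?subr_ge0 ?(ltW t1) // le_max lexx. Qed.

Let kap l t : R := if 0 < l then if t < 1 then K l (Z t) else 0 else 0.

Let kap01 l t : 0 <= kap l t <= 1.
Proof.
rewrite /kap; case: ifPn => l0; last by rewrite lexx ler01.
case: ifPn => t1; last by rewrite lexx ler01.
have lZ : 0 <= l * Z t by rewrite mulr_ge0 ?Z0 // ltW.
by rewrite K0 //= (le_trans (KS l0 (Z0 t1))) // invf_le1 ?lerDl // ltr_wpDr.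
Qed.

Let kap_cont l : continuous (kap l).
Proof.
have [l0|l0] := ltP 0 l; last first.
  rewrite (_ : kap l = cst 0); first exact: cst_continuous.
  by apply/funext => t; rewrite /kap ltNge l0.
have kE t : kap l t = if t < 1 then K l (Z t) else 0 by rewrite /kap l0.
move=> t; have [t1|t1] := ltP t 1.
  rewrite /continuous_at kE t1.
  have : K l (Z s) @[s --> t] --> K l (Z t).
    by apply: continuous_cvg; [exact: Kc|exact: Z_cont].
  apply: cvg_trans; apply: near_eq_cvg; near=> s; rewrite kE ifT //.
  by near: s; exact: lt_nbhsl.
rewrite /continuous_at [kap l t]kE ltNge t1 /=.
(* The majorant [(1 + l Z)^-1], continued by 0 beyond 1; clearing the denominator [1 - s] makes its
   continuity at 1 visible. *)
pose g s : R := (1 - Num.min s 1) / (1 - Num.min s 1 + l * Num.max 0 (Num.min s 1)).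
have gt : g t = 0 by rewrite /g (min_idPr t1) subrr mul0r.
have kg s : 0 <= kap l s <= g s.
  have [s1|s1] := ltP s 1; last first.
    by rewrite kE ltNge s1 /= /g (min_idPr s1) subrr mul0r lexx.
  rewrite kE s1 K0 //= /g (min_idPl (ltW s1)).
  apply: (le_trans (KS l0 (Z0 s1))); rewrite le_eqVlt; apply/orP; left; apply/eqP.
  have s1' : 0 < 1 - s by rewrite subr_gt0.
  have m0 : 0 <= Num.max 0 s by rewrite le_max lexx.
  have d1 : 0 < 1 - s + l * Num.max 0 s by rewrite ltr_wpDr // mulr_ge0 // ltW.
  have -> : 1 + l * Z s = (1 - s + l * Num.max 0 s) / (1 - s).
    by rewrite /Z; field; exact: lt0r_neq0.
  by rewrite invf_div.
have cmin : Num.min s 1 @[s --> t] --> Num.min t 1.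
  by apply: (continuous_min (f := id) (g := fun=> 1)); [exact: cvg_id|exact: cst_continuous].
have c1 : 1 - Num.min s 1 @[s --> t] --> 1 - Num.min t 1.
  by apply: cvgB => //; exact: cvg_cst.
have cmax : Num.max 0 (Num.min s 1) @[s --> t] --> Num.max 0 (Num.min t 1).
  apply: (@continuous_cvg _ R R (nbhs t) _ (fun s => Num.min s 1) (fun y => Num.max 0 y)) => //.
  exact: max0_continuous.
have gc : (1 - Num.min s 1) / (1 - Num.min s 1 + l * Num.max 0 (Num.min s 1)) @[s --> t]
    --> (1 - Num.min t 1) / (1 - Num.min t 1 + l * Num.max 0 (Num.min t 1)).
  apply: cvgM => //; apply: cvgV.
    by rewrite (min_idPr t1) subrr add0r (max_idPr ler01) mulr1 gt_eqF.
  apply: cvgD => //; apply: cvgM; first exact: cvg_cst.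
  exact: cmax.
apply: (@squeeze_cvgr _ _ _ _ (fun=> 0) g).
- exact: nearW.
- exact: cvg_cst.
- by move: gc; rewrite -/(g t) gt.
Unshelve. all: by end_near. Qed.

(** Serves both [exp (- l x)] and [(1 + l x)^-1]: the bound [KS] holds for each of them and forces
    the kernel to vanish at infinity. *)
Lemma hull_random_variable (f : R -> R) :
  hull [set l | 0 < l] (fun g => exists2 x, 0 <= x & g = K ^~ x) f ->
  f n.+1%:R^-1 @[n --> \oo] --> (1 : R) ->
  exists (rho : probability R R) (X : {RV rho >-> R}),
    nonneg_rv X /\
    forall l, 0 < l -> (\int[rho]_t (K l (X t))%:E = (f l)%:E)%E.
Proof.
move=> Hf f1.
have Hf' : hull [set l | 0 < l] (fun g => exists2 t, 0 <= t <= 1 & g = kap ^~ t) f.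
  apply: hull_sub Hf => _ [x x0 ->].
  have x1 : 0 < 1 + x by rewrite ltr_wpDr.
  have t1 : x / (1 + x) < 1 by rewrite ltr_pdivrMr // mul1r ltrDr.
  have t0 : 0 <= x / (1 + x) by rewrite divr_ge0 // ltW.
  apply: (@hull_ext _ _ _ _ (kap ^~ (x / (1 + x)))).
    by apply: hull_base; exists (x / (1 + x)) => //; rewrite t0 ltW.
  move=> l /= l0; rewrite /kap l0 t1; congr (K l _).
  by rewrite /Z (max_idPr t0); field; rewrite !gt_eqF //= addrK.
have [rho [_ rhoE]] := hull_representation kap_cont kap01 Hf'.
have mkap l : measurable_fun setT (kap l) by exact: continuous_measurable_fun.
have mA : measurable (`[1, +oo[%classic : set R) by exact: measurable_itv.
have mA' : measurable (`]-oo, 1[%classic : set R) by exact: measurable_itv.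
(* The kernel is at most the indicator of [t < 1], so the mass of that set bounds every
   [f (1 / (n + 1))], which tends to 1. *)
have rho1 : rho `[1, +oo[%classic = 0%E.
  have fle n : ((f n.+1%:R^-1)%:E <= rho `]-oo, 1%R[%classic)%E.
    have e0 : [set l : R | 0 < l] n.+1%:R^-1 by rewrite /= invr_gt0.
    rewrite -rhoE // -[X in (_ <= _ X)%E]setIT -integral_indic //.
    apply: ge0_le_integral => //.
    - by move=> t _; rewrite lee_fin; have /andP[] := kap01 n.+1%:R^-1 t.
    - exact/measurable_EFinP.
    - by apply/measurable_EFinP; exact: measurable_indic.
    move=> t _; rewrite lee_fin indicE mem_setE in_itv /=.
    have /andP[_ k1] := kap01 n.+1%:R^-1 t.
    by case: (ltP t 1) => t1 //; rewrite /kap [t < 1]ltNge t1 if_same.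
  have le1 : (1 <= rho `]-oo, 1%R[%classic)%E.
    have c : (f n.+1%:R^-1)%:E @[n --> \oo] --> 1%:E by apply: cvg_EFin => //; exact: nearW.
    rewrite -(cvg_lim _ c) //; apply: lime_le; first by apply/cvg_ex; exists 1%:E.
    exact: nearW.
  rewrite -setCitvl probability_setC //; apply/eqP; rewrite eq_le; apply/andP; split.
    by rewrite leeBlDr ?fin_num_measure // add0e.
  by rewrite sube_ge0 ?probability_le1 // fin_num_measure.
pose Z' t : R := if t < 1 then Z t else 0.
have mZ' : measurable_fun setT Z'.
  have -> : Z' = Z \_ `]-oo, 1[.
    by apply/funext => t; rewrite /Z' patchE mem_setE in_itv.
  apply/(measurable_restrictT _ mA').
  apply: open_continuous_measurable_fun; first exact: interval_open.
  by move=> t; rewrite inE /= in_itv /= => t1; exact: Z_cont.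
have Z'0 t : 0 <= Z' t by rewrite /Z'; case: ifPn => [/Z0|_].
have [X XE] := exists_mfun mZ'.
exists rho, X; split; first by move=> t; rewrite XE.
move=> l l0; rewrite -rhoE //; apply: ge0_ae_eq_integral => //.
- apply/measurable_EFinP; apply: measurableT_comp => //.
  by apply: continuous_measurable_fun; exact: Kc.
- exact/measurable_EFinP.
- by move=> t _; rewrite lee_fin K0.
- by move=> t _; rewrite lee_fin; have /andP[] := kap01 l t.
exists `[1, +oo[%classic; split => // t /= nt; rewrite in_itv /= andbT.
rewrite leNgt; apply/negP => t1; apply: nt => _.
by rewrite XE /kap l0 /Z' t1.
Qed.

End hull_random_variable.

Section laplace_uniqueness.
Context {R : realType}.
Notation D := (`[0, +oo[%classic : set R).
Implicit Types (P Q : probability R R) (l a x : R).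

Let mD : measurable D. Proof. exact: measurable_itv. Qed.

Let DE x : D x = (0 <= x) :> Prop.
Proof. by rewrite /= in_itv /= andbT. Qed.

Lemma on_nonneg_D P : on_nonneg P -> P D = 1%E.
Proof.
move=> <-; congr (P _); apply/seteqP; split => x; by rewrite DE.
Qed.

Lemma on_nonneg_integral P (f : R -> \bar R) : on_nonneg P ->
  measurable_fun setT f -> (forall x, 0 <= f x)%E ->
  (\int[P]_x f x = \int[P]_(x in D) f x)%E.
Proof.
move=> P0 mf f0; rewrite [RHS]integral_mkcond; apply: ge0_ae_eq_integral => //.
- by apply/(measurable_restrictT _ mD); exact: measurable_funTS.
- by move=> x _; apply: erestrict_ge0.
exists (~` D); split; first exact: measurableC.
  by apply: (etrans (probability_setC P mD)); rewrite on_nonneg_D // subee.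
move=> x /= nx Dx; apply: nx => _; by rewrite patchE mem_set.
Qed.

Lemma bounded_integrable P (f : R -> R) : measurable_fun setT f ->
  (forall x, 0 <= x -> 0 <= f x <= 1) -> P.-integrable D (EFin \o f).
Proof.
move=> mf f01; have i1 : P.-integrable D (cst 1%E).
  apply/integrableP; split; first exact: measurable_cst.
  rewrite (eq_integral (cst 1%E)) => [|u _]; last by rewrite /= normr1.
  by rewrite integral_cst // mul1e -ge0_fin_numE // fin_num_measure.
apply: le_integrable i1 => //.
- by apply/measurable_EFinP; exact: measurable_funTS.
- move=> x; rewrite DE => /f01/andP[fx0 fx1] /=.
  by rewrite ger0_norm // normr1 lee_fin.
Qed.

Lemma expRN01 l x : 0 <= l -> 0 <= x -> 0 <= expR (- (l * x)) <= 1.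
Proof. by move=> l0 x0; rewrite expR_ge0 expR_le1 oppr_le0 mulr_ge0. Qed.

(* For [N = n exp (n a)], [g n N 0] tends to the indicator function of []a, oo[]. *)
Let g (n : R) (N : nat) l x := expR (- (l * x)) * (1 - expR (- (n * x))) ^+ N.

Let mg n N l : measurable_fun setT (g n N l).
Proof.
apply: measurable_funM; first exact: measurable_expRM.
apply: measurable_funX; apply: measurable_funB => //; exact: measurable_expRM.
Qed.

Let g01 n N l x : 0 <= n -> 0 <= l -> 0 <= x -> 0 <= g n N l x <= 1.
Proof.
move=> n0 l0 x0; have /andP[e0 e1] := expRN01 l0 x0.
have /andP[d0 d1] := expRN01 n0 x0.
have b0 : 0 <= 1 - expR (- (n * x)) by rewrite subr_ge0.
rewrite mulr_ge0 ?exprn_ge0 //= mulr_ile1 ?exprn_ge0 // exprn_ile1 //.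
Qed.

(** Expanding one factor [1 - exp (- n x)] replaces [l] by [l + n] in the second term, so induction
    on [N] comes down to Laplace transforms, with total mass at [l = 0]. *)
Let g_integral P Q (n : R) N l : on_nonneg P -> on_nonneg Q -> 0 <= n -> 0 <= l ->
  (forall l, 0 < l -> laplace P l = laplace Q l) ->
  (\int[P]_(x in D) (g n N l x)%:E = \int[Q]_(x in D) (g n N l x)%:E)%E.
Proof.
move=> P0 Q0 n0 + PQ; elim: N l => [|N IHN] l l0.
  have E (S : probability R R) : on_nonneg S ->
      (\int[S]_(x in D) (g n 0 l x)%:E = laplace S l)%E.
    move=> S0; rewrite /laplace [RHS]on_nonneg_integral //.
    - by apply: eq_integral => x _; rewrite /g expr0 mulr1.
    - by apply/measurable_EFinP; exact: measurable_expRM.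
  rewrite (E _ P0) (E _ Q0); move: l0; rewrite le_eqVlt => /predU1P[<-|/PQ //].
  have E0 (S : probability R R) : laplace S 0 = 1%E.
    rewrite /laplace (eq_integral (cst 1%E)) => [|x _]; last by rewrite mul0r oppr0 expR0.
    by rewrite integral_cst // mul1e; exact: probability_setT.
  by rewrite !E0.
have E (S : probability R R) : (\int[S]_(x in D) (g n N.+1 l x)%:E =
    \int[S]_(x in D) (g n N l x)%:E - \int[S]_(x in D) (g n N (l + n) x)%:E)%E.
  rewrite -integralB_EFin //; last 2 first.
  - by apply: bounded_integrable => // x x0; exact: g01.
  - by apply: bounded_integrable => // x x0; apply: g01 => //; rewrite addr_ge0.
  apply: eq_integral => x _; rewrite -EFinB; congr (_%:E); rewrite /g.
  have -> : expR (- ((l + n) * x)) = expR (- (l * x)) * expR (- (n * x)).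
    by rewrite -expRD; congr expR; ring.
  by rewrite exprS; ring.
by rewrite !E !IHN // addr_ge0.
Qed.

Let N a n := Num.truncn (n%:R * expR (n%:R * a)).

(** The function behaves like [exp (- n exp (n (a - x)))]. The factor [n] in [N] makes the limit 0
    at [x = a] too, as the open ray requires. *)
Let g_cvg a x : 0 <= x ->
  g n%:R (N a n) 0 x @[n --> \oo] --> (\1_(`]a, +oo[%classic : set R) x : R).
Proof.
move=> x0; have gE n : g n%:R (N a n) 0 x = (1 - expR (- (n%:R * x))) ^+ N a n.
  by rewrite /g mul0r oppr0 expR0 mul1r.
under eq_fun do rewrite gE.
pose y n := expR (- (n%:R * x)).
have y01 n : 0 <= y n <= 1 by apply: expRN01.
have Nle n : (N a n)%:R <= n%:R * expR (n%:R * a).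
  by rewrite truncn_le mulr_ge0 ?expR_ge0.
have Ngt n : n%:R * expR (n%:R * a) < (N a n).+1%:R.
  by have /truncn_itv/andP[] : 0 <= n%:R * expR (n%:R * a) by rewrite mulr_ge0 ?expR_ge0.
rewrite indicE mem_setE in_itv /= andbT; have [ax|xa] := ltP a x.
  pose d := x - a; have d0 : 0 < d by rewrite subr_gt0.
  (* Bernoulli's inequality bounds the defect by [n exp (- n d)], and [exp y >= y^2 / 2] bounds this
     by [2 / (d^2 n)]. *)
  apply: (@squeeze_cvgr _ _ _ _ (fun n => 1 - 2 / d ^+ 2 * n%:R^-1) (fun=> 1)).
  - near=> n; have n0 : 0 < n%:R :> R by rewrite ltr0n; near: n; exact: nbhs_infty_gt.
    have /andP[y0 y1] := y01 n.
    rewrite exprn_ile1 ?subr_ge0 ?gerBl ?y1 // andbT.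
    have bern m : 1 - m%:R * y n <= (1 - y n) ^+ m.
      elim: m => [|m IHm]; first by rewrite mul0r subr0 expr0.
      rewrite exprS; apply: (@le_trans _ _ ((1 - y n) * (1 - m%:R * y n))); last first.
        by rewrite ler_wpM2l // subr_ge0.
      by rewrite -natr1 -subr_ge0 [leRHS](_ : _ = m%:R * y n ^+ 2) ?mulr_ge0 ?exprn_ge0 //; ring.
    apply: le_trans (bern _); rewrite lerD2l lerN2.
    apply: (@le_trans _ _ (n%:R * expR (n%:R * a) * y n)); first by rewrite ler_wpM2r.
    rewrite -mulrA -expRD.
    have -> : n%:R * a + - (n%:R * x) = - (n%:R * d) by rewrite /d; ring.
    have nd0 : 0 < n%:R * d by rewrite mulr_gt0.
    have := expR_ge1Dxn 1 (ltW nd0); rewrite factE /= => h.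
    have {}h : (n%:R * d) ^+ 2 / 2 <= expR (n%:R * d) by apply: le_trans h; rewrite lerDr.
    rewrite expRN ler_pdivrMr ?expR_gt0 //.
    apply: (@le_trans _ _ (2 / d ^+ 2 / n%:R * ((n%:R * d) ^+ 2 / 2))); last first.
      by rewrite ler_wpM2l // !divr_ge0 // exprn_ge0 // ltW.
    rewrite le_eqVlt; apply/orP; left; apply/eqP.
    by field; rewrite !gt_eqF.
  - rewrite -[X in _ --> X]subr0; apply: cvgB; first exact: cvg_cst.
    rewrite -[X in _ --> X](mulr0 (2 / d ^+ 2)); apply: cvgM; first exact: cvg_cst.
    rewrite -cvg_shiftS; exact: cvg_harmonic.
  - exact: cvg_cst.
(* Here [N y >= n - y >= n - 1], since truncation loses less than 1; and
   [exp (1 - n) = exp 2 exp (- (n + 1))] is at most [exp 2 / (n + 1)]. *)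
apply: (@squeeze_cvgr _ _ _ _ (fun=> 0) (fun n => n.+1%:R^-1 * expR 2)).
- near=> n; have /andP[y0 y1] := y01 n.
  rewrite exprn_ge0 ?subr_ge0 //=.
  apply: (@le_trans _ _ (expR (- y n) ^+ N a n)).
    by rewrite lerXn2r ?nnegrE ?subr_ge0 ?expR_ge0 // expR_ge1Dx.
  rewrite -expRM_natl mulrN.
  apply: (@le_trans _ _ (expR (- (n%:R - 1)))).
    rewrite ler_expR lerN2.
    have ny : n%:R <= (N a n).+1%:R * y n.
      apply: le_trans (ler_wpM2r y0 (ltW (Ngt n))).
      by rewrite -mulrA -expRD ler_peMr // -expR0 ler_expR -mulrBr mulr_ge0 ?subr_ge0.
    rewrite lerBlDr (le_trans ny) // -natr1 mulrDl mul1r lerD2l //.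
  rewrite opprB -[1 - _](_ : 2 - n.+1%:R = _); last by rewrite -natr1; ring.
  rewrite expRD mulrC ler_wpM2r ?expR_ge0 // expRN lef_pV2 ?posrE ?expR_gt0 //.
  by apply: le_trans (expR_ge1Dx _); rewrite lerDr.
- exact: cvg_cst.
- rewrite -[X in _ --> X](mul0r (expR 2)); apply: cvgM; last exact: cvg_cst.
  exact: cvg_harmonic.
Unshelve. all: by end_near. Qed.

Lemma laplace_uniqueness P Q : on_nonneg P -> on_nonneg Q ->
  (forall l, 0 < l -> laplace P l = laplace Q l) -> eq_law P Q.
Proof.
move=> P0 Q0 PQ; apply: eq_probability_rays => a.
have lim S : on_nonneg S ->
    (\int[S]_(x in D) (g n%:R (N a n) 0 x)%:E @[n --> \oo] --> S `]a, +oo[%classic)%E.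
  move=> S0.
  have mi : measurable_fun setT (fun x : R => (\1_(`]a, +oo[%classic : set R) x : R)%:E).
    by apply/measurable_EFinP; exact: measurable_indic.
  have -> : S `]a, +oo[%classic = (\int[S]_(x in D) (\1_(`]a, +oo[%classic : set R) x)%:E)%E.
    rewrite -on_nonneg_integral //.
    by rewrite integral_indic // setIT.
  apply: (@dominated_cvg _ _ _ S D mD (fun n x => (g n%:R (N a n) 0 x)%:E) _ (cst 1%E)) => //.
  - by move=> n; apply/measurable_EFinP; exact: measurable_funTS.
  - move=> x; rewrite DE => x0; apply: cvg_EFin; first exact: nearW.
    exact: g_cvg.
  - by apply: (@bounded_integrable S (cst 1)) => // x _; rewrite /= lexx ler01.
  - move=> n x; rewrite DE => x0; rewrite /= lee_fin.
    by have /andP[? ?] := g01 (N a n) (ler0n R n) (lexx 0) x0; rewrite ger0_norm.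
apply: (cvg_unique _ (lim P P0)) => //.
rewrite (_ : (fun n => _) = (fun n => \int[Q]_(x in D) (g n%:R (N a n) 0 x)%:E)%E).
  exact: lim.
by apply/funext => n; apply: g_integral.
Qed.

End laplace_uniqueness.

(** * Laws of products and sums *)

Section density.
Context d (T : measurableType d) (R : realType).
Variables (m mu : {measure set T -> \bar R}) (h : T -> R).
Hypothesis mh : measurable_fun setT h.
Hypothesis h0 : forall t, 0 <= h t.
Hypothesis mE : forall A, measurable A -> m A = (\int[mu]_(t in A) (h t)%:E)%E.
Import HBNNSimple.
Local Open Scope ereal_scope.

Let mhE : measurable_fun setT (EFin \o h).
Proof. exact/measurable_EFinP. Qed.

Let integral_density_nnsfun (f : {nnsfun T >-> R}) :
  \int[m]_t (f t)%:E = \int[mu]_t ((f t)%:E * (h t)%:E).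
Proof.
under [LHS]eq_integral do rewrite fimfunE -fsumEFin //.
rewrite [LHS]ge0_integral_fsum //; last 2 first.
- by move=> r; exact/measurable_EFinP/measurableT_comp.
- by move=> n x _; rewrite EFinM nnfun_muleindic_ge0.
under [RHS]eq_integral.
  move=> x xD; rewrite fimfunE -fsumEFin // ge0_mule_fsuml; last first.
    by move=> r; rewrite EFinM nnfun_muleindic_ge0.
  over.
rewrite [RHS]ge0_integral_fsum //; last 2 first.
- move=> r; apply: emeasurable_funM => //.
  by apply/measurable_EFinP/measurableT_comp.
- by move=> n x _; apply: mule_ge0; [rewrite EFinM nnfun_muleindic_ge0|rewrite lee_fin].
apply: eq_fsbigr => r; rewrite inE => -[x _ xr].
have r0 : (0 <= r)%R by rewrite -xr.
have mA : measurable (f @^-1` [set r]) by [].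
rewrite integralZl_indic_nnsfun // integral_indic // setIT mE //.
rewrite [X in _ * X]integral_mkcond -ge0_integralZl //; last 2 first.
- by apply/(measurable_restrictT _ mA); exact: measurable_funTS.
- by move=> t _; apply: erestrict_ge0 => // s _; rewrite lee_fin.
apply: eq_integral => t _; rewrite EFinM -muleA; congr (_ * _).
by rewrite patchE indicE; case: ifPn => _; rewrite ?mul1e ?mul0e.
Qed.

Lemma integral_density (f : T -> \bar R) : measurable_fun setT f ->
  (forall t, 0 <= f t) -> \int[m]_t f t = \int[mu]_t (f t * (h t)%:E).
Proof.
move=> mf f0; pose g := nnsfun_approx measurableT mf.
have gf t : (g n t)%:E @[n --> \oo] --> f t by apply: cvg_nnsfun_approx.
transitivity (limn (fun n => \int[m]_t (g n t)%:E)).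
  rewrite -monotone_convergence //.
  - by apply: eq_integral => t _; apply/esym/cvg_lim.
  - by move=> n; exact/measurable_EFinP.
  - by move=> n t _; rewrite lee_fin.
  - by move=> t _ a b ab; rewrite lee_fin; exact/lefP/nd_nnsfun_approx.
under eq_fun do rewrite integral_density_nnsfun.
have mgh n : measurable_fun setT (fun t => (g n t)%:E * (h t)%:E).
  by apply: emeasurable_funM => //; exact/measurable_EFinP.
have gh0 n t : 0 <= (g n t)%:E * (h t)%:E by rewrite mule_ge0 // lee_fin.
have ghnd t : setT t -> {homo (fun n => (g n t)%:E * (h t)%:E) : a b / (a <= b)%N >-> a <= b}.
  move=> _ a b ab; rewrite lee_wpmul2r ?lee_fin //; exact/lefP/nd_nnsfun_approx.
rewrite -(monotone_convergence mu measurableT mgh (fun n t _ => gh0 n t) ghnd).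
apply: eq_integral => t _; apply/cvg_lim => //; exact: cvgeZr.
Qed.

End density.

Section random_variables.
Context {R : realType}.

(** Independence makes the joint law the product of the marginals; the inner integral over [s] plays
    the part of an independent copy, on the same space. *)
Lemma independent_integral d (T : measurableType d) (P : probability T R)
    (X Y : {RV P >-> R}) (f : R * R -> \bar R) : independent_rv X Y ->
  measurable_fun setT f -> (forall z, 0 <= f z)%E ->
  (\int[P]_t f (X t, Y t) = \int[P]_t \int[P]_s f (X t, Y s))%E.
Proof.
move=> XY mf f0.
have mXY : measurable_fun setT (fun t => (X t, Y t)).
  by apply/measurable_fun_pairP; split.
have [V VE] := exists_mfun mXY.
transitivity (\int[distribution P V]_z f z)%E.
  rewrite ge0_integral_distribution //.
  by apply: eq_integral => t _; rewrite /= VE.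
transitivity (\int[(distribution P X \x distribution P Y)%E]_z f z)%E.
  apply: eq_measure_integral => A mA _; apply/esym.
  apply: product_measure_unique => // B C mB mC.
  rewrite -[LHS]/(P (V @^-1` (B `*` C))).
  rewrite (_ : V @^-1` (B `*` C) = X @^-1` B `&` Y @^-1` C) ?XY //.
  by apply/seteqP; split => t; rewrite /= VE.
rewrite fubini_tonelli1 // /fubini_F ge0_integral_distribution //=; last 2 first.
- exact: measurable_fun_fubini_tonelli_F.
- by move=> x; apply: integral_ge0.
apply: eq_integral => t _ /=; rewrite ge0_integral_distribution //.
apply: (measurableT_comp mf); apply: measurable_fun_pair => //.
Qed.

Lemma independent_product d1 d2 (T1 : measurableType d1) (T2 : measurableType d2)
    (P1 : probability T1 R) (P2 : probability T2 R)
    (X : {RV P1 >-> R}) (Y : {RV P2 >-> R}) :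
  exists X' Y' : {RV (P1 \x P2)%E >-> R},
    [/\ forall z, X' z = X z.1, forall z, Y' z = Y z.2, independent_rv X' Y',
        eq_law (distribution (P1 \x P2)%E X') (distribution P1 X) &
        eq_law (distribution (P1 \x P2)%E Y') (distribution P2 Y)].
Proof.
have mX : measurable_fun setT (fun z : T1 * T2 => X z.1) by exact: measurableT_comp.
have mY : measurable_fun setT (fun z : T1 * T2 => Y z.2) by exact: measurableT_comp.
have [X' XE] := exists_mfun mX; have [Y' YE] := exists_mfun mY.
have PX A : measurable A -> (P1 \x P2)%E (X' @^-1` A) = P1 (X @^-1` A).
  move=> mA; rewrite (_ : X' @^-1` A = (X @^-1` A) `*` setT); last first.
    by apply/seteqP; split => z; rewrite /= XE; [|case].
  rewrite product_measure1E //; last exact: measurable_funPTI.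
  by rewrite -[RHS]mule1; congr (_ * _)%E; exact: probability_setT.
have PY A : measurable A -> (P1 \x P2)%E (Y' @^-1` A) = P2 (Y @^-1` A).
  move=> mA; rewrite (_ : Y' @^-1` A = setT `*` (Y @^-1` A)); last first.
    by apply/seteqP; split => z; rewrite /= YE; [|case].
  rewrite product_measure1E //; last exact: measurable_funPTI.
  by rewrite -[RHS]mul1e; congr (_ * _)%E; exact: probability_setT.
exists X', Y'; split => //.
move=> A B mA mB.
transitivity ((P1 \x P2)%E ((X @^-1` A) `*` (Y @^-1` B))).
  by congr (_ _); apply/seteqP; split => z; rewrite /= XE YE.
apply: etrans; first by apply: product_measure1E; exact: measurable_funPTI.
by congr (_ * _)%E; apply/esym; [exact: PX|exact: PY].
Qed.

Lemma exponential_integral d (T : measurableType d) (P : probability T R)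
    (G : {RV P >-> R}) (f : R -> R) :
  eq_law (distribution P G) (exponential_prob 1) ->
  measurable_fun setT f -> (forall x, 0 <= f x) ->
  (\int[P]_t (f (G t))%:E =
   \int[lebesgue_measure]_(x in `]0%R, +oo[) (f x * expR (- x))%:E)%E.
Proof.
move=> GE mf f0.
have mE : measurable_fun setT (fun x : R => expR (- x)) by exact: measurableT_comp.
have [G2 G2E] := @exists_mfun _ _ T (measurableTypeR R) G (measurable_funPT G).
transitivity (\int[distribution P G2]_x (f x)%:E)%E.
  rewrite ge0_integral_distribution //; last exact/measurable_EFinP.
  by apply: eq_integral => t _; rewrite /= G2E.
have G2P A : measurable A ->
    distribution P G2 A = (\int[lebesgue_measure]_(x in A) (exponential_pdf 1 x)%:E)%E.
  move=> mA; rewrite -[RHS]/(exponential_prob 1 A) -GE //.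
  by congr (P _); apply/seteqP; split => t; rewrite /= G2E.
have pdf0 x : 0 <= exponential_pdf 1 x :> R by exact: exponential_pdf_ge0.
transitivity (\int[lebesgue_measure]_x ((f x)%:E * (exponential_pdf 1 x)%:E))%E.
  apply: (@integral_density _ (measurableTypeR R) R (distribution P G2) lebesgue_measure) => //.
  - exact: measurable_exponential_pdf.
  - exact/measurable_EFinP.
rewrite integral_itv_obnd_cbnd; last first.
  by apply/measurable_EFinP/measurable_funTS; exact: measurable_funM.
rewrite [RHS]integral_mkcond; apply: eq_integral => x _.
rewrite -EFinM /exponential_pdf !patchE; case: ifPn => _; last by rewrite mulr0.
by rewrite mul1r mulN1r.
Qed.

Lemma exponential_laplace d (T : measurableType d) (P : probability T R)
    (G : {RV P >-> R}) (th : R) :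
  eq_law (distribution P G) (exponential_prob 1) -> 0 <= th ->
  (\int[P]_t (expR (- (th * G t)))%:E = ((1 + th)^-1)%:E)%E /\
  (\int[P]_t (expR (- (th * `|G t|)))%:E = ((1 + th)^-1)%:E)%E.
Proof.
move=> GE th0.
have m1 : measurable_fun setT (fun x : R => expR (- (th * x))) by exact: measurable_expRM.
have m2 : measurable_fun setT (fun x : R => expR (- (th * `|x|))).
  by apply: (measurableT_comp m1); exact: normr_measurable.
rewrite (exponential_integral GE m1) ?(exponential_integral GE m2); try by move=> x; exact: expR_ge0.
rewrite -integral_expRN ?ltr_wpDr //; split.
  apply: eq_integral => x _; rewrite -expRD; congr (expR _)%:E; ring.
apply: eq_integral => x; rewrite inE /= in_itv /= andbT => x0.
by rewrite gtr0_norm // -expRD; congr (expR _)%:E; ring.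
Qed.

(** An exponential variable may be negative on a null set, whereas [nonneg_rv] is a pointwise
    condition; the absolute value repairs this and keeps the law. *)
Lemma exponential_abs d (T : measurableType d) (P : probability T R)
    (G G' : {RV P >-> R}) : eq_law (distribution P G) (exponential_prob 1) ->
  (forall t, G' t = `|G t|) -> eq_law (distribution P G') (exponential_prob 1).
Proof.
move=> GE G'E A mA; rewrite -GE //.
have m1 : measurable_fun setT (\1_A : R -> R) by exact: measurable_indic.
have m2 : measurable_fun setT (fun x : R => \1_A `|x| : R).
  by apply: (measurableT_comp m1); exact: normr_measurable.
have PE (V : {RV P >-> R}) : distribution P V A = (\int[P]_t (\1_A (V t))%:E)%E.
  rewrite -[LHS]/(P (V @^-1` A)) -[X in P X]setIT -integral_indic //.
  exact: measurable_funPTI.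
rewrite !PE (exponential_integral GE m1) //.
under eq_integral do rewrite G'E.
rewrite (exponential_integral GE m2) //; apply: eq_integral => x.
by rewrite inE /= in_itv /= andbT => x0; rewrite gtr0_norm.
Qed.

End random_variables.

(** * Mixtures of exponential laws and their finite approximations *)

Section mixtures.
Context {R : realType}.
Implicit Types (l th : R).

Lemma prob_integral_le1 d (T : measurableType d) (P : probability T R) (f : T -> R) :
  measurable_fun setT f -> (forall t, 0 <= f t <= 1) ->
  (0 <= \int[P]_t (f t)%:E <= 1)%E.
Proof.
move=> mf f01; apply/andP; split.
  by apply: integral_ge0 => t _; rewrite lee_fin; have /andP[] := f01 t.
apply: (@le_trans _ _ (\int[P]_t (cst 1%E t))%E); last first.
  by rewrite integral_cst // mul1e; have := probability_setT P => /= ->.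
apply: ge0_le_integral => //.
- by move=> t _; rewrite lee_fin; have /andP[] := f01 t.
- exact/measurable_EFinP.
- by move=> t _; rewrite lee_fin; have /andP[] := f01 t.
Qed.

Lemma prob_integral_fineK d (T : measurableType d) (P : probability T R) (f : T -> R) :
  measurable_fun setT f -> (forall t, 0 <= f t <= 1) ->
  (fine (\int[P]_t (f t)%:E))%:E = (\int[P]_t (f t)%:E)%E.
Proof.
move=> mf f01; have /andP[i0 i1] := prob_integral_le1 P mf f01.
by rewrite fineK // ge0_fin_numE // (le_lt_trans i1) // ltry.
Qed.

Lemma prob_bounded_cvg d (T : measurableType d) (P : probability T R)
    (F : nat -> T -> R) (f : T -> R) :
  (forall n, measurable_fun setT (F n)) -> (forall n t, 0 <= F n t <= 1) ->
  (forall t, F n t @[n --> \oo] --> f t) ->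
  fine (\int[P]_t (F n t)%:E) @[n --> \oo] --> fine (\int[P]_t (f t)%:E).
Proof.
move=> mF F01 Ff.
have mf : measurable_fun setT f by apply: (measurable_fun_cvg (h := F)) => // t _.
have f01 t : 0 <= f t <= 1.
  have c : cvgn (F ^~ t) by apply/cvg_ex; exists (f t).
  rewrite -(cvg_lim _ (Ff t)) //; apply/andP; split.
    by apply: limr_ge => //; apply: nearW => n; have /andP[] := F01 n t.
  by apply: limr_le => //; apply: nearW => n; have /andP[] := F01 n t.
apply: fine_cvg; rewrite prob_integral_fineK //.
apply: (@dominated_cvg _ _ _ P setT measurableT (fun n => EFin \o F n) _ (cst 1%E)) => //.
- by move=> n; exact/measurable_EFinP.
- by move=> t _; apply: cvg_EFin; [exact: nearW|exact: Ff].
- apply/integrableP; split; first exact: measurable_cst.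
  rewrite (eq_integral (cst 1%E)) => [|t _]; last by rewrite /= normr1.
  by rewrite integral_cst // mul1e; have := probability_setT P => /= ->; rewrite ltry.
- by move=> n t _ /=; have /andP[? ?] := F01 n t; rewrite ger0_norm // lee_fin.
Qed.

Import HBNNSimple.

Lemma nnsfun_comp_integral d (T : measurableType d) (P : probability T R)
    (f : {nnsfun T >-> R}) (g : R -> R) : (forall y, 0 <= g y) ->
  (\int[P]_t (g (f t))%:E = (\sum_(y <- finmap.enum_fset (fset_set (range f)))
     g y * fine (P (f @^-1` [set y])))%:E)%E.
Proof.
move=> g0; rewrite -sumEFin.
transitivity (\int[P]_t (\sum_(y <- finmap.enum_fset (fset_set (range f)))
    ((g y)%:E * (\1_(f @^-1` [set y]) t)%:E)))%E.
  apply: eq_integral => t _; rewrite -fsbig_finite //=.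
  rewrite (fsbigD1 (f t)) //.
  have -> : \1_(f @^-1` [set f t]) t = 1 :> R by rewrite indicE mem_set.
  rewrite mule1 fsbig1; first exact/esym/adde0.
  by move=> y [_ /= /nesym yf]; rewrite indicE memNset // mule0.
rewrite ge0_integral_sum //; last 2 first.
- move=> y; apply: measurable_funeM; apply/measurable_EFinP; exact: measurable_indic.
- by move=> y t _; rewrite mule_ge0 // lee_fin.
apply: eq_bigr => y _; rewrite ge0_integralZl_EFin //; last first.
  by apply/measurable_EFinP; exact: measurable_indic.
by rewrite integral_indic // setIT EFinM fineK // fin_num_measure.
Qed.

Lemma measurable_me_kernel d (T : measurableType d) (Y : T -> R) th :
  measurable_fun setT Y -> (forall t, 0 <= Y t) -> 0 <= th ->
  measurable_fun setT (fun t => (1 + th * Y t)^-1).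
Proof.
move=> mY Y0 th0.
have -> : (fun t => (1 + th * Y t)^-1) = (fun x => (1 + th * Num.max 0 x)^-1) \o Y.
  by apply/funext => t /=; rewrite (max_idPr (Y0 t)).
apply: measurableT_comp => //; apply: continuous_measurable_fun => x.
apply: cvgV; first by rewrite gt_eqF // ltr_wpDr // mulr_ge0 // le_max lexx.
apply: cvgD; first exact: cvg_cst; apply: cvgM; first exact: cvg_cst.
exact: max0_continuous.
Qed.

Lemma me_kernel01 th (y : R) : 0 <= th -> 0 <= y -> 0 <= (1 + th * y)^-1 <= 1.
Proof.
move=> th0 y0; have ty : 0 <= th * y by rewrite mulr_ge0.
by rewrite invr_ge0 addr_ge0 //= invf_le1 ?lerDl // ltr_wpDr.
Qed.

Definition finite_mixture (f : R -> R) := exists n (w z : 'I_n -> R),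
  [/\ forall j, 0 <= w j, forall j, 0 <= z j, \sum_j w j = 1 &
      forall th, 0 <= th -> f th = \sum_j w j / (1 + th * z j)].

(** The matrix arguments handle finitely many nodes, so [Y] is replaced by simple functions
    increasing to it. *)
Lemma me_finite_approx d (T : measurableType d) (P : probability T R) (Y : {RV P >-> R}) :
  nonneg_rv Y -> exists F : nat -> R -> R, (forall n, finite_mixture (F n)) /\
    forall th, 0 <= th ->
      F n th @[n --> \oo] --> fine (\int[P]_t ((1 + th * Y t)^-1)%:E).
Proof.
move=> Y0; have mY : measurable_fun setT (EFin \o Y) by exact/measurable_EFinP.
have YE0 t : setT t -> (0 <= (EFin \o Y) t)%E by move=> _; rewrite lee_fin.
pose g := nnsfun_approx measurableT mY.
have gY t : g n t @[n --> \oo] --> Y t.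
  by have /fine_cvg := @cvg_nnsfun_approx _ _ _ _ measurableT _ mY YE0 t I.
exists (fun n th => fine (\int[P]_t ((1 + th * g n t)^-1)%:E)); split; last first.
  move=> th th0; apply: (prob_bounded_cvg (F := fun n t => (1 + th * g n t)^-1)).
  - by move=> n; apply: measurable_me_kernel.
  - by move=> n t; apply: me_kernel01.
  - move=> t; apply: cvgV; first by rewrite gt_eqF // ltr_wpDr // mulr_ge0.
    by apply: cvgD; [exact: cvg_cst|apply: cvgM => //; exact: cvg_cst].
move=> n; pose s := finmap.enum_fset (fset_set (range (g n))).
have I1 (h : R -> R) : (forall y, 0 <= h y) -> (\int[P]_t (h (g n t))%:E =
    (\sum_(i < size s) h (nth 0 s i) * fine (P (g n @^-1` [set nth 0 s i])))%:E)%E.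
  by move=> h0; rewrite nnsfun_comp_integral // (big_nth 0) big_mkord.
(* [Num.max 0] does not change the values of the nonnegative function [g n] and makes the sign of
   the nodes immediate. *)
exists (size s), (fun i => fine (P (g n @^-1` [set nth 0 s i]))),
  (fun i => Num.max 0 (nth 0 s i)); split.
- by move=> i; apply: fine_ge0; exact: measure_ge0.
- by move=> i; rewrite le_max lexx.
- have := I1 (fun=> 1) (fun=> ler01); rewrite integral_cst // mul1e.
  have := probability_setT P => /= -> [->].
  by apply: eq_bigr => i _; rewrite mul1r.
- move=> th th0; have := I1 (fun y => (1 + th * Num.max 0 y)^-1) _.
  rewrite (eq_integral (fun t => ((1 + th * g n t)^-1)%:E)) => [|t _]; last first.
    by rewrite (max_idPr _).
  move=> -> /=; first by apply: eq_bigr => i _; rewrite mulrC.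
  by move=> y; rewrite invr_ge0 addr_ge0 // mulr_ge0 // le_max lexx.
Qed.

End mixtures.

Section laplace_transforms.
Context {R : realType}.
Implicit Types (l th : R).

Lemma eq_law_integral d1 d2 (T1 : measurableType d1) (T2 : measurableType d2)
    (P1 : probability T1 R) (P2 : probability T2 R)
    (X1 : {RV P1 >-> R}) (X2 : {RV P2 >-> R}) (f : R -> R) :
  eq_law (distribution P1 X1) (distribution P2 X2) ->
  measurable_fun setT f -> (forall x, 0 <= f x) ->
  (\int[P1]_t (f (X1 t))%:E = \int[P2]_t (f (X2 t))%:E)%E.
Proof.
move=> X12 mf f0; have mfE : measurable_fun setT (EFin \o f) by exact/measurable_EFinP.
have fE0 x : (0 <= (EFin \o f) x)%E by rewrite lee_fin.
rewrite -(ge0_integral_distribution X1 mfE fE0) -(ge0_integral_distribution X2 mfE fE0).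
by apply: eq_measure_integral => A mA _; exact: X12.
Qed.

Lemma laplace_distribution d (T : measurableType d) (P : probability T R)
    (X : {RV P >-> R}) l :
  laplace (distribution P X) l = (\int[P]_t (expR (- (l * X t)))%:E)%E.
Proof.
rewrite /laplace ge0_integral_distribution //.
by apply/measurable_EFinP; exact: measurable_expRM.
Qed.

Lemma eq_law_laplace (P Q : probability R R) l : eq_law P Q -> laplace P l = laplace Q l.
Proof. by move=> PQ; apply: eq_measure_integral => A mA _; exact: PQ. Qed.

Lemma nonneg_rv_distribution d (T : measurableType d) (P : probability T R)
    (X : {RV P >-> R}) : nonneg_rv X -> on_nonneg (distribution P X).
Proof.
move=> X0; rewrite /on_nonneg -[LHS]/(P (X @^-1` [set x | 0 <= x])).
rewrite [X in _ X = _](_ : _ = setT); first exact: probability_setT.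
by apply/seteqP; split => // t _; exact: X0.
Qed.

Lemma measurable_rv_expR d (T : measurableType d) (P : probability T R)
    (X : {RV P >-> R}) l : measurable_fun setT (fun t => expR (- (l * X t))).
Proof. by apply: (measurableT_comp (measurable_expRM l)). Qed.

Lemma nonneg_rv_expR01 d (T : measurableType d) (P : probability T R)
    (X : {RV P >-> R}) l : nonneg_rv X -> 0 <= l ->
  forall t, 0 <= expR (- (l * X t)) <= 1.
Proof. by move=> X0 l0 t; apply: expRN01 => //; exact: X0. Qed.

Lemma laplace_at0 d (T : measurableType d) (P : probability T R)
    (X : {RV P >-> R}) (a : R) : nonneg_rv X -> 0 <= a ->
  fine (\int[P]_t (expR (- (n.+1%:R^-1 * a * X t)))%:E) @[n --> \oo] --> (1 : R).
Proof.
move=> X0 a0; have E : fine (\int[P]_t ((fun=> 1) t)%:E) = 1 :> R.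
  by rewrite integral_cst // mul1e; have := probability_setT P => /= ->.
rewrite -[X in _ --> X]E; apply: prob_bounded_cvg.
- by move=> n; exact: measurable_rv_expR.
- by move=> n; apply: nonneg_rv_expR01; rewrite ?mulr_ge0.
move=> t; rewrite -[X in _ --> X]expR0; apply: continuous_cvg; first exact: continuous_expR.
rewrite -[X in _ --> X]oppr0; apply: cvgN; rewrite -[X in _ --> X](mul0r (X t)).
apply: cvgM; last exact: cvg_cst; rewrite -[X in _ --> X](mul0r a).
by apply: cvgM; [exact: cvg_harmonic|exact: cvg_cst].
Qed.

Lemma independent_rvC d (T : measurableType d) (P : probability T R)
    (X Y : {RV P >-> R}) : independent_rv X Y -> independent_rv Y X.
Proof. by move=> XY A B mA mB; rewrite setIC XY // muleC. Qed.

Lemma exponential_mixture_laplace d (T : measurableType d) (P : probability T R)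
    (G Y : {RV P >-> R}) th :
  eq_law (distribution P G) (exponential_prob 1) -> nonneg_rv Y ->
  independent_rv G Y -> 0 <= th ->
  (\int[P]_t (expR (- (th * (G t * Y t))))%:E =
   \int[P]_t ((1 + th * Y t)^-1)%:E)%E.
Proof.
move=> GE Y0 /independent_rvC YG th0.
have mf : measurable_fun setT (fun z : R * R => (expR (- (th * (z.2 * z.1))))%:E).
  apply/measurable_EFinP; apply: (measurableT_comp (measurable_expRM th)).
  exact: measurable_funM.
have f0 (z : R * R) : (0 <= (expR (- (th * (z.2 * z.1))))%:E)%E by rewrite lee_fin expR_ge0.
rewrite (independent_integral YG mf f0) /=; apply: eq_integral => t _.
have [<- _] := exponential_laplace GE (mulr_ge0 th0 (Y0 t)).
by apply: eq_integral => s _; congr (expR _)%:E; ring.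
Qed.

Lemma ME_laplace (mu : probability R R) : ME mu ->
  exists (d : measure_display) (T : measurableType d) (P : probability T R)
    (Y : {RV P >-> R}), nonneg_rv Y /\
    forall th, 0 <= th -> laplace mu th = (\int[P]_t ((1 + th * Y t)^-1)%:E)%E.
Proof.
case=> d [T [P [G [Y [GE Y0 GY muE]]]]]; exists d, T, P, Y; split=> // th th0.
rewrite (eq_law_laplace _ muE) laplace_distribution.
exact: exponential_mixture_laplace.
Qed.

(** Measurability and the bounds belong to the induction: without them the expectations of convex
    combinations and limits could not be computed. *)
Lemma stieltjes_hull_expectation d (T : measurableType d) (P : probability T R)
    (X : {RV P >-> R}) (F : R * R -> R) :
  nonneg_rv X -> ME (distribution P X) -> cbf_hull F ->
  (forall l, 0 < l -> measurable_fun setT (fun t => F (l, X t)) /\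
    forall t, 0 <= F (l, X t) <= 1) /\
  stieltjes_hull (fun l => fine (\int[P]_t (F (l, X t))%:E)).
Proof.
move=> X0 /ME_laplace[d' [T' [P' [Y [Y0 YE]]]]].
elim=> [{}F [r r0 ->]|p {}F G /andP[p0 p1] _ [mF SF] _ [mG SG]|F' {}F _ IH F'F].
- have cb l : 0 < l -> 0 <= cbf r l by move=> /ltW; exact: cbf_ge0.
  have eE l t : expR (- (X t * cbf r l)) = expR (- (cbf r l * X t)) by rewrite [X t * _]mulrC.
  split=> [l l0|].
    split; first by under eq_fun do rewrite /= eE; exact: measurable_rv_expR.
    by move=> t; rewrite /= eE; apply: nonneg_rv_expR01 => //; exact: cb.
  have [F' [F'mix F'cvg]] := me_finite_approx Y0.
  apply: (@hull_lim _ _ _ _ (fun n l => F' n (cbf r l))); last first.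
    move=> l /= /cb l0; have := F'cvg _ l0; rewrite -YE // laplace_distribution.
    by under eq_integral do rewrite -eE.
  move=> n; have [k [w [z [w0 z0 w1 F'E]]]] := F'mix n.
  (* A multiple [z C] of a function [C = cbf r] is again a [cbf], with the first coordinates scaled
     by [z]. *)
  have : stieltjes_hull (fun l => \sum_j w j * (1 + cbf [seq (z j * q.1, q.2) | q <- r] l)^-1).
    apply: hull_sum => // j; apply: stieltjes_hull_inv_cbf.
    rewrite /nonneg_pairs all_map; apply/allP => q /(allP r0)/andP[q1 q2] /=.
    by rewrite mulr_ge0.
  move=> /hull_ext; apply=> l l0; rewrite F'E ?cb //; apply: eq_bigr => j _.
  congr (_ * (1 + _)^-1); rewrite /cbf big_map mulrC mulr_sumr.
  by apply: eq_bigr => q _ /=; rewrite !mulrA.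
- split=> [l l0|].
    have [mFl F01] := mF l l0; have [mGl G01] := mG l l0; split.
      by apply: measurable_funD; apply: measurable_funM.
    move=> t; have /andP[f0 f1] := F01 t; have /andP[g0 g1] := G01 t.
    apply/andP; split; first by rewrite addr_ge0 ?mulr_ge0 ?subr_ge0.
    apply: (@le_trans _ _ (p * 1 + (1 - p) * 1)); last by rewrite !mulr1 subrKC.
    by rewrite lerD // ler_wpM2l ?subr_ge0.
  have p01 : 0 <= p <= 1 by rewrite p0.
  apply: (hull_ext (hull_conv p01 SF SG)) => l l0.
  have [mFl F01] := mF l l0; have [mGl G01] := mG l l0.
  have F0 t : 0 <= F (l, X t) by have /andP[] := F01 t.
  have G0 t : 0 <= G (l, X t) by have /andP[] := G01 t.
  have q0 : 0 <= 1 - p by rewrite subr_ge0.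
  apply: EFin_inj; rewrite EFinD !EFinM !prob_integral_fineK //; last 2 first.
  + by apply: measurable_funD; apply: measurable_funM.
  + move=> t; have /andP[f0 f1] := F01 t; have /andP[g0 g1] := G01 t.
    apply/andP; split; first by rewrite addr_ge0 ?mulr_ge0.
    apply: (@le_trans _ _ (p * 1 + (1 - p) * 1)); last by rewrite !mulr1 subrKC.
    by rewrite lerD // ler_wpM2l.
  have mFE : measurable_fun setT (fun t => (F (l, X t))%:E) by exact/measurable_EFinP.
  have mGE : measurable_fun setT (fun t => (G (l, X t))%:E) by exact/measurable_EFinP.
  rewrite -!ge0_integralZl_EFin //; try by move=> t _; rewrite lee_fin.
  rewrite -ge0_integralD //; try by move=> t _; rewrite -EFinM lee_fin mulr_ge0.
  + by apply: measurable_funeM.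
  + by apply: measurable_funeM.
- have mF l : 0 < l -> measurable_fun setT (fun t => F (l, X t)).
    move=> l0; apply: (measurable_fun_cvg (h := fun n t => F' n (l, X t))).
      by move=> n; have [/(_ l l0)[]] := IH n.
    by move=> t _; apply: F'F; split => //; exact: X0.
  split=> [l l0|].
    split; first exact: mF.
    move=> t; have c := F'F (l, X t) (conj l0 (X0 t)).
    have cn : cvgn (F' ^~ (l, X t)) by apply/cvg_ex; exists (F (l, X t)).
    rewrite -(cvg_lim _ c) //; apply/andP; split.
      by apply: limr_ge => //; apply: nearW => n; have [/(_ l l0)[_ /(_ t)/andP[]]] := IH n.
    by apply: limr_le => //; apply: nearW => n; have [/(_ l l0)[_ /(_ t)/andP[]]] := IH n.
  apply: (@hull_lim _ _ _ _ (fun n l => fine (\int[P]_t (F' n (l, X t))%:E))).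
    by move=> n; have [] := IH n.
  move=> l l0; apply: (prob_bounded_cvg (F := fun n t => F' n (l, X t))).
  + by move=> n; have [/(_ l l0)[]] := IH n.
  + by move=> n; have [/(_ l l0)[]] := IH n.
  + by move=> t; apply: F'F; split => //; exact: X0.
Qed.

End laplace_transforms.

(** * Convolutions, roots and realisation by random variables *)

Section infinite_divisibility.
Context {R : realType}.
Implicit Types (l th : R) (mu nu : probability R R).

Lemma laplace_convolution mu nu l :
  laplace (convolution mu nu) l = (laplace mu l * laplace nu l)%E.
Proof.
have mE : measurable_fun setT (fun x : R => (expR (- (l * x)))%:E).
  by apply/measurable_EFinP; exact: measurable_expRM.
have mE2 : measurable_fun setT (fun z : R * R => (expR (- (l * Defs.add_pair z)))%:E).
  exact: (measurableT_comp mE measurable_add_pair).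
rewrite /laplace /convolution ge0_integral_distribution //.
rewrite fubini_tonelli1 //=.
rewrite -ge0_integralZr //; last by apply: integral_ge0 => x _; rewrite lee_fin.
apply: eq_integral => x _; rewrite /fubini_F /=.
rewrite -ge0_integralZl_EFin ?expR_ge0 //.
apply: eq_integral => y _.
by rewrite /Defs.add_pair /= -EFinM mulrDr opprD expRD.
Qed.

Lemma on_nonneg_convolution mu nu :
  on_nonneg mu -> on_nonneg nu -> on_nonneg (convolution mu nu).
Proof.
move=> m0 n0; pose D := [set x : R | 0 <= x].
have mD : measurable D.
  by rewrite (_ : D = `[0, +oo[%classic) //; apply/seteqP; split => x; rewrite /= in_itv /= andbT.
apply/eqP; rewrite eq_le probability_le1 //=.
have mAD : measurable (Defs.add_pair @^-1` D : set (R * R)).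
  by rewrite -[X in measurable X]setTI; exact: (measurable_add_pair measurableT).
apply: (@le_trans _ _ ((mu \x nu)%E (D `*` D))).
  rewrite le_eqVlt; apply/orP; left; apply/eqP/esym.
  apply: (etrans (product_measure1E _ _ mD mD)).
  by rewrite -[RHS]mule1; congr (_ * _)%E.
apply: le_measure; rewrite ?inE //; first exact: measurableX.
by move=> [x y] [/= x0 y0]; rewrite /D /Defs.add_pair /= addr_ge0.
Qed.

Lemma on_nonneg_convolution_power nu n :
  on_nonneg nu -> on_nonneg (convolution_power nu n).
Proof.
move=> n0; elim: n => [|n IHn] /=; last exact: on_nonneg_convolution.
by rewrite /on_nonneg /= diracE mem_set //= lexx.
Qed.

Lemma laplace_convolution_power nu n l (f : R) : laplace nu l = f%:E ->
  laplace (convolution_power nu n) l = (f ^+ n)%:E.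
Proof.
move=> nf; elim: n => [|n IHn] /=.
  rewrite /laplace integral_dirac //; last first.
    by apply/measurable_EFinP; exact: measurable_expRM.
  by rewrite diracT mul1e mulr0 oppr0 expR0.
by rewrite laplace_convolution nf IHn -EFinM exprS.
Qed.

(** [Num.max 0] extends the kernel to a continuous one on the whole line; the condition at 0 makes
    [nu] a genuine probability. *)
Lemma laplace_hull_rv (f : R -> R) : laplace_hull f ->
  f n.+1%:R^-1 @[n --> \oo] --> (1 : R) ->
  exists nu, on_nonneg nu /\ forall l, 0 < l -> laplace nu l = (f l)%:E.
Proof.
move=> fH f1.
have H : hull [set l | 0 < l] (fun g => exists2 x, 0 <= x &
    g = (fun l x => expR (- (l * Num.max 0 x))) ^~ x) f.
  apply: hull_sub fH => _ [x x0 ->]; apply: hull_base; exists x => //.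
  by rewrite (max_idPr x0).
have [] := @hull_random_variable _ (fun l x => expR (- (l * Num.max 0 x))) _ _ _ f H f1.
- move=> l _ x; apply: continuous_comp; last exact: continuous_expR.
  apply: continuousN; apply: continuousM; first exact: cst_continuous.
  exact: max0_continuous.
- by move=> l x _; exact: expR_ge0.
- move=> l x l0 x0; rewrite (max_idPr x0) expRN.
  have lx : 0 <= l * x by rewrite mulr_ge0 // ltW.
  by rewrite lef_pV2 ?expR_ge1Dx // posrE ?expR_gt0 // ltr_wpDr.
move=> rho [X [X0 XE]]; exists (distribution rho X); split.
  exact: nonneg_rv_distribution.
move=> l l0; rewrite laplace_distribution -XE //; apply: eq_integral => t _.
by rewrite (max_idPr (X0 t)).
Qed.

Lemma stieltjes_hull_rv (f : R -> R) : stieltjes_hull f ->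
  f n.+1%:R^-1 @[n --> \oo] --> (1 : R) ->
  exists (rho : probability R R) (Z : {RV rho >-> R}), nonneg_rv Z /\
    forall l, 0 < l -> (\int[rho]_t ((1 + l * Z t)^-1)%:E = (f l)%:E)%E.
Proof.
move=> fH f1.
have H : hull [set l | 0 < l] (fun g => exists2 x, 0 <= x &
    g = (fun l x => (1 + l * Num.max 0 x)^-1) ^~ x) f.
  apply: hull_sub fH => _ [x x0 ->]; apply: hull_base; exists x => //.
  by rewrite (max_idPr x0).
have d0 l x : 0 < l -> 0 < 1 + l * Num.max 0 x.
  by move=> l0; rewrite ltr_wpDr // mulr_ge0 ?(ltW l0) // le_max lexx.
have [] := @hull_random_variable _ (fun l x => (1 + l * Num.max 0 x)^-1) _ _ _ f H f1.
- move=> l l0 x; apply: cvgV; first exact/lt0r_neq0/d0.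
  apply: cvgD; first exact: cvg_cst; apply: cvgM; first exact: cvg_cst.
  exact: max0_continuous.
- by move=> l x l0; rewrite invr_ge0 ltW // d0.
- by move=> l x l0 x0; rewrite (max_idPr x0).
move=> rho [X [X0 XE]]; exists rho, X; split=> // l l0.
by rewrite -XE //; apply: eq_integral => t _; rewrite (max_idPr (X0 t)).
Qed.

Lemma me_integral_gt0 d (T : measurableType d) (P : probability T R)
    (Y : {RV P >-> R}) th : nonneg_rv Y -> 0 <= th ->
  0 < fine (\int[P]_t ((1 + th * Y t)^-1)%:E).
Proof.
move=> Y0 th0; have mY := measurable_me_kernel (measurable_funPT Y) Y0 th0.
have k01 t := me_kernel01 th0 (Y0 t).
rewrite lt_neqAle fine_ge0 ?andbT; last first.
  by apply: integral_ge0 => t _; rewrite lee_fin; have /andP[] := k01 t.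
apply/negP => /eqP i0.
have iE : (\int[P]_t `|((1 + th * Y t)^-1)%:E| = 0)%E.
  rewrite -[RHS]/(0%:E) i0 prob_integral_fineK //; apply: eq_integral => t _.
  by rewrite /= ger0_norm //; have /andP[] := k01 t.
have mYE : measurable_fun setT (fun t => ((1 + th * Y t)^-1)%:E) by exact/measurable_EFinP.
have [/(_ iE)[N [mN N0 NE]] _] := ae_eq_integral_abs P measurableT mYE.
have NT : N = setT.
  apply/seteqP; split => // t _; apply: NE => /= /(_ I)[].
  by apply/eqP; rewrite gt_eqF // invr_gt0 ltr_wpDr // mulr_ge0 ?Y0.
by move: N0; rewrite NT; have := probability_setT P => /= -> /eqP; rewrite onee_eq0.
Qed.

(** The Goldie-Steutel theorem for a general mixing variable: the finite approximations pass to the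
    limit since the transform is positive. *)
Lemma laplace_hull_me_powR d (T : measurableType d) (P : probability T R)
    (Y : {RV P >-> R}) a : nonneg_rv Y -> 0 <= a ->
  laplace_hull (fun l => fine (\int[P]_t ((1 + l * Y t)^-1)%:E) `^ a).
Proof.
move=> Y0 a0; have [F [Fmix Fcvg]] := me_finite_approx Y0.
apply: (@hull_lim _ _ _ _ (fun n l => F n l `^ a)) => [n|l /= /ltW l0].
  have [k [w [z [w0 z0 w1 FE]]]] := Fmix n.
  apply: (hull_ext (stieltjes_sum_powR w0 z0 w1 a0)) => l /= /ltW l0.
  by rewrite FE.
by apply: powR_cvg; [exact: me_integral_gt0|exact: Fcvg].
Qed.

Lemma gamma_closure_scale (f : R -> R) c : 0 <= c -> gamma_closure f ->
  gamma_closure (fun l => f (l * c)).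
Proof.
move=> c0; elim=> [b p b0 p0|{}f g _ IHf _ IHg|F {}f _ IH Ff f0].
- apply: (gamma_closure_ext (gamma_base (mulr_ge0 b0 c0) p0)) => l _.
  by congr (_^-1 `^ _); ring.
- exact: gamma_mul.
- apply: (gamma_lim IH) => l l0; first by apply: Ff; rewrite mulr_ge0.
  by apply: f0; rewrite mulr_ge0.
Qed.

End infinite_divisibility.

(** * Factorisation of the transform of the shifted product *)

Section shifted_products.
Context {R : realType}.
Implicit Types (l th a c : R).

Lemma laplace_rv_fineK d (T : measurableType d) (P : probability T R)
    (X : {RV P >-> R}) l : nonneg_rv X -> 0 <= l ->
  laplace (distribution P X) l = (fine (laplace (distribution P X) l))%:E.
Proof.
move=> X0 l0; rewrite laplace_distribution prob_integral_fineK //.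
  exact: measurable_rv_expR.
exact: nonneg_rv_expR01.
Qed.

Lemma shifted_product_laplace d (T : measurableType d) (P : probability T R)
    (X W : {RV P >-> R}) c l : independent_rv X W ->
  laplace (distribution P ((X + cst c) * W)) l =
  (\int[P]_t laplace (distribution P W) (l * (X t + c)))%E.
Proof.
move=> XW; rewrite laplace_distribution.
have mf : measurable_fun setT (fun z : R * R => (expR (- (l * ((z.1 + c) * z.2))))%:E).
  apply/measurable_EFinP; apply: (measurableT_comp (measurable_expRM l)).
  by apply: measurable_funM => //; exact: measurable_funD.
have f0 (z : R * R) : (0 <= (expR (- (l * ((z.1 + c) * z.2))))%:E)%E.
  by rewrite lee_fin expR_ge0.
rewrite (independent_integral XW mf f0) /=; apply: eq_integral => t _.
by rewrite laplace_distribution; apply: eq_integral => s _; rewrite mulrA.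
Qed.

Lemma shifted_product_factor d (T : measurableType d) (P : probability T R)
    (X W : {RV P >-> R}) c (phi : R -> R) : nonneg_rv X -> independent_rv X W ->
  ME (distribution P X) -> 0 <= c -> gamma_closure phi ->
  (forall l, 0 <= l -> laplace (distribution P W) l = (phi l)%:E) ->
  exists2 S, stieltjes_hull S & forall l, 0 < l ->
    laplace (distribution P ((X + cst c) * W)) l = (phi (l * c) * S l)%:E.
Proof.
move=> X0 XW XME c0 phiG phiE.
have [mF SF] := stieltjes_hull_expectation X0 XME (gamma_closure_ratio c0 phiG).
exists (fun l => fine (\int[P]_t (phi (l * (X t + c)) / phi (l * c))%:E)) => // l l0.
have [ml l01] := mF l l0; rewrite /= in ml l01.
have l0' t : 0 <= phi (l * (X t + c)) / phi (l * c) by have /andP[] := l01 t.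
have pc : 0 < phi (l * c).
  by have /andP[] := gamma_closure_itv01 phiG (mulr_ge0 (ltW l0) c0).
rewrite shifted_product_laplace // EFinM prob_integral_fineK //.
rewrite -ge0_integralZl_EFin //; last 3 first.
- by move=> t _; rewrite lee_fin.
- exact/measurable_EFinP.
- exact/ltW.
apply: eq_integral => t _; rewrite phiE; last first.
  by rewrite mulr_ge0 ?(ltW l0) // addr_ge0 // X0.
by rewrite -EFinM mulrCA divff ?mulr1 // gt_eqF.
Qed.

Lemma mixture_of_exponentials d (T : measurableType d) (P : probability T R)
    (mu : probability R R) (Z : {RV P >-> R}) : ME mu -> nonneg_rv Z ->
  exists (d' : measure_display) (T' : measurableType d') (P' : probability T' R)
    (M : {RV P' >-> R}), [/\ nonneg_rv M, ME (distribution P' M) &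
    forall l, 0 <= l ->
      laplace (distribution P' M) l = (\int[P]_t ((1 + l * Z t)^-1)%:E)%E].
Proof.
case=> d0 [T0 [P0 [G [_ [GE _ _ _]]]]] Z0.
(* The law [mu] supplies an exponential variable; made nonnegative everywhere and placed on a
   product space with [Z], it builds the new mixture. *)
have [Ga GaE] : exists Ga : {RV P0 >-> R}, forall t, Ga t = `|G t|.
  by apply: exists_mfun; exact: measurableT_comp.
have [G' [Z' [G'E Z'E GZ G'L Z'L]]] := independent_product Ga Z.
have G'exp : eq_law (distribution (P0 \x P)%E G') (exponential_prob 1).
  by move=> A mA; rewrite G'L //; exact: (exponential_abs GE GaE).
have Z'0 : nonneg_rv Z' by move=> z; rewrite Z'E; exact: Z0.
exists _, _, (P0 \x P)%E, (G' * Z'); split.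
- by move=> z /=; rewrite mulr_ge0 ?Z'0 // G'E GaE.
- by exists _, _, (P0 \x P)%E, G', Z'; split.
move=> l l0; rewrite laplace_distribution.
rewrite (exponential_mixture_laplace G'exp Z'0 GZ l0).
have mK : measurable_fun setT (fun x : R => (1 + l * `|x|)^-1).
  by apply: measurable_me_kernel => //; exact: normr_measurable.
have K0 (x : R) : 0 <= (1 + l * `|x|)^-1 by rewrite invr_ge0 addr_ge0 ?mulr_ge0.
have := eq_law_integral Z'L mK K0.
under eq_integral do rewrite ger0_norm ?Z'0 //.
by under [X in _ = X -> _]eq_integral do rewrite ger0_norm ?Z0 //.
Qed.

Lemma sum_laplace d (T : measurableType d) (P : probability T R)
    (W M : {RV P >-> R}) c l : independent_rv W M ->
  laplace (distribution P (c *: W + M)) l =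
  (laplace (distribution P W) (l * c) * laplace (distribution P M) l)%E.
Proof.
move=> WM; rewrite !laplace_distribution.
have mf : measurable_fun setT (fun z : R * R => (expR (- (l * (c * z.1 + z.2))))%:E).
  apply/measurable_EFinP; apply: (measurableT_comp (measurable_expRM l)).
  by apply: measurable_funD => //; exact: measurable_funM.
have f0 (z : R * R) : (0 <= (expR (- (l * (c * z.1 + z.2))))%:E)%E.
  by rewrite lee_fin expR_ge0.
have mE th : measurable_fun setT (fun t => (expR (- (th * W t)))%:E).
  by apply/measurable_EFinP; exact: measurable_rv_expR.
have mE' th : measurable_fun setT (fun t => (expR (- (th * M t)))%:E).
  by apply/measurable_EFinP; exact: measurable_rv_expR.
apply: etrans; first exact: (independent_integral WM mf f0).
rewrite /=.
rewrite -ge0_integralZr //; last by apply: integral_ge0 => t _; rewrite lee_fin expR_ge0.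
apply: eq_integral => t _; rewrite -ge0_integralZl_EFin ?expR_ge0 //.
by apply: eq_integral => s _; rewrite -EFinM -expRD mulrDr opprD mulrA.
Qed.

(** The root of the first factor rescales gamma shapes and that of the second is given by
    Goldie-Steutel. Their product tends to 1 at 0, hence is the transform of a law, whose
    convolution power is identified by uniqueness. *)
Lemma infinitely_divisible_factors (mu : probability R R) (phi S : R -> R)
    d (T : measurableType d) (P : probability T R) (Z : {RV P >-> R}) c :
  on_nonneg mu -> gamma_closure phi -> nonneg_rv Z -> 0 <= c ->
  (forall l, 0 < l -> (\int[P]_t ((1 + l * Z t)^-1)%:E = (S l)%:E)%E) ->
  (forall l, 0 < l -> laplace mu l = (phi (l * c) * S l)%:E) ->
  phi (n.+1%:R^-1 * c) * S n.+1%:R^-1 @[n --> \oo] --> (1 : R) ->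
  infinitely_divisible mu.
Proof.
move=> mu0 phiG Z0 c0 ZE muE mu1; split=> // n n2.
pose a : R := n%:R^-1; have a0 : 0 <= a by rewrite invr_ge0.
have SE l : 0 < l -> fine (\int[P]_t ((1 + l * Z t)^-1)%:E) = S l.
  by move=> /ZE ->.
have S0 l : 0 < l -> 0 < S l.
  by move=> l0; rewrite -SE //; apply: me_integral_gt0 => //; exact: ltW.
have phi0 l : 0 < l -> 0 < phi (l * c).
  by move=> /ltW l0; have /andP[] := gamma_closure_itv01 phiG (mulr_ge0 l0 c0).
have fH : laplace_hull (fun l => (phi (l * c) * S l) `^ a).
  apply: (hull_ext (laplace_hullM
    (gamma_closure_laplace (gamma_closure_powR a0 (gamma_closure_scale c0 phiG)))
    (laplace_hull_me_powR Z0 a0))) => l /= l0.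
  by rewrite SE // powRM ?ltW ?phi0 ?S0.
have f1 : (phi (m.+1%:R^-1 * c) * S m.+1%:R^-1) `^ a @[m --> \oo] --> (1 : R).
  by rewrite -[X in _ --> X](congr1 (@^~ a) (powR1 R)); apply: powR_cvg.
have [nu [nu0 nuE]] := laplace_hull_rv fH f1.
exists nu; apply: laplace_uniqueness => //; first exact: on_nonneg_convolution_power.
move=> l l0; rewrite (laplace_convolution_power _ (nuE l l0)) muE //; congr (_%:E).
by rewrite -powR_mulrn ?powR_ge0 // -powRrM mulVf ?powRr1 ?pnatr_eq0 -?lt0n ?(ltnW n2) ?ltW ?mulr_gt0 ?phi0 ?S0.
Qed.

End shifted_products.

Unset Implicit Arguments.

Theorem proposition2p2 (R : realType) (d : measure_display)
    (T : measurableType d) (P : probability T R) (X W : {RV P >-> R})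
    (hX : nonneg_rv X) (hW : nonneg_rv W) (hXW : independent_rv X W)
    (hXME : ME (distribution P X)) (hWGGC : GGC (distribution P W))
    (c : R) (hc : 0 <= c) :
  (exists (d' : measure_display) (T' : measurableType d')
          (P' : probability T' R) (W' M : {RV P' >-> R}),
     [/\ nonneg_rv W' /\ nonneg_rv M,
         independent_rv W' M,
         eq_law (distribution P' W') (distribution P W),
         ME (distribution P' M) &
         eq_law (distribution P ((X + cst c) * W))
                (distribution P' (c *: W' + M))]) /\
  infinitely_divisible (distribution P ((X + cst c) * W)).
Proof.
pose phi l := fine (laplace (distribution P W) l).
have phiG : gamma_closure phi by exact: GGC_gamma_closure.
have phiE l : 0 <= l -> laplace (distribution P W) l = (phi l)%:E.
  by move=> l0; exact: laplace_rv_fineK.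
have [S SH LE] := shifted_product_factor hX hXW hXME hc phiG phiE.
have V0 : nonneg_rv ((X + cst c) * W : {RV P >-> R}).
  move=> t; change (0 <= (X t + c) * W t); apply: mulr_ge0; last exact: hW.
  by apply: addr_ge0; [exact: hX|exact: hc].
have phi1 : phi (n.+1%:R^-1 * c) @[n --> \oo] --> (1 : R).
  by have := laplace_at0 hW hc; rewrite /phi; under eq_fun do rewrite -laplace_distribution.
have L1 : phi (n.+1%:R^-1 * c) * S n.+1%:R^-1 @[n --> \oo] --> (1 : R).
  have := laplace_at0 V0 ler01; under eq_fun do rewrite mulr1 -laplace_distribution.
  by under eq_fun do rewrite LE ?invr_gt0 //=.
have phi_gt0 n : 0 < phi (n.+1%:R^-1 * c).
  by have /andP[] := gamma_closure_itv01 phiG (mulr_ge0 (ltW (harmonic_gt0 n)) hc).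
(* Along [1 / (n + 1)] the full transform and [phi] both tend to 1, hence so does [S]: its mixing
   variable has no mass at infinity. *)
have S1 : S n.+1%:R^-1 @[n --> \oo] --> (1 : R).
  have <- : (fun n => phi (n.+1%:R^-1 * c) * S n.+1%:R^-1 * (phi (n.+1%:R^-1 * c))^-1) =
      (fun n => S n.+1%:R^-1).
    by apply/funext => n; rewrite mulrAC divff ?mul1r // gt_eqF.
  rewrite -[X in _ --> X](mulr1 1); apply: cvgM => //.
  by rewrite -[X in _ --> X]invr1; apply: cvgV.
have [rho [Z [Z0 ZE]]] := stieltjes_hull_rv SH S1.
split; last by apply: infinitely_divisible_factors Z0 hc ZE LE L1 => //; exact: nonneg_rv_distribution.
have [d1 [T1 [P1 [M1 [M10 M1ME M1E]]]]] := mixture_of_exponentials hXME Z0.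
have [W' [M [W'E ME' W'M W'L ML]]] := independent_product W M1.
exists _, _, (P \x P1)%E, W', M; split=> //.
- by split=> z; [rewrite W'E; exact: hW|rewrite ME'; exact: M10].
- case: M1ME => d2 [T2 [P2 [G [Y [GE Y0 GY M1L]]]]].
  by exists d2, T2, P2, G, Y; split=> // A mA; exact: etrans (ML A mA) (M1L A mA).
apply: laplace_uniqueness; [exact: nonneg_rv_distribution| |].
  apply: nonneg_rv_distribution => z /=.
  by rewrite addr_ge0 ?mulr_ge0 ?W'E ?ME' // ?hW ?M10.
move=> l l0; rewrite sum_laplace // (eq_law_laplace _ W'L) (eq_law_laplace _ ML).
by rewrite phiE ?mulr_ge0 ?(ltW l0) // M1E ?(ltW l0) // ZE // LE // EFinM.
Qed.
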